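(* Suppose $\Psi:\mathbb{D}\times E\to\mathbb{C}$ is a holomorphic motion of a set $E\subset\mathbb{C}$, and that $\alpha>0$, $\gamma\in\mathbb{R}$ are given. Let $\lambda\in\mathbb{D}\setminus\{0\}$ and write $\Psi_\lambda(z)=\Psi(\lambda,z)$. Assume that at every point $z\in E$ there are scales $r_j\to0$, $r_j>0$ (depending on $z$) along which $\Psi_\lambda$ stretches with exponent $\alpha$, $$\lim_{j\to\infty}\frac{\log|\Psi_\lambda(z+r_j)-\Psi_\lambda(z)|}{\log r_j}=\alpha,$$ and simultaneously rotates with rate $\gamma$, $$\lim_{j\to\infty}\frac{\arg\big(\Psi_\lambda(z+r_j)-\Psi_\lambda(z)\big)}{\log|\Psi_\lambda(z+r_j)-\Psi_\lambda(z)|}=\gamma .$$ Then $$\dim(E)\ \leqslant\ 1+\alpha-\frac1{|\lambda|}\sqrt{(1-\alpha)^2+(1-|\lambda|^2)\alpha^2\gamma^2}\, .$$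
   Context: $\mathbb{D}$ is the open unit disk in $\mathbb{C}$. A holomorphic motion of $E\subset\mathbb{C}$ is a map $\Psi:\mathbb{D}\times E\to\mathbb{C}$ such that $z\mapsto\Psi(\lambda,z)$ is injective for each $\lambda\in\mathbb{D}$, $\lambda\mapsto\Psi(\lambda,z)$ is holomorphic for each $z\in E$, and $\Psi(0,z)=z$. By Slodkowski's theorem every holomorphic motion of $E$ extends to a holomorphic motion of $\mathbb{C}$, and the extended maps $\Psi_\lambda:\mathbb{C}\to\mathbb{C}$ are quasiconformal homeomorphisms; when $z+r_j\notin E$, the values $\Psi_\lambda(z+r_j)$ in the hypotheses are those of such an extension, fixed once and for all. The argument is the imaginary part of a continuous branch, in $r>0$, of $\log(\Psi_\lambda(z+r)-\Psi_\lambda(z))$ (the limit is independent of which branch is used). $\dim$ denotes Hausdorff dimension, with the convention $\dim\emptyset=-\infty$. *)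

(* Defs.v *)
From HB Require Import structures.
From mathcomp Require Import all_boot all_order all_algebra.
From mathcomp Require Import all_classical all_reals all_analysis.
From mathcomp Require Import complex.

Set Implicit Arguments.
Unset Strict Implicit.
Unset Printing Implicit Defensive.

Import Order.TTheory GRing.Theory Num.Theory.
Import numFieldNormedType.Exports.
Import ComplexField.Normc.

Local Open Scope classical_set_scope.
Local Open Scope ring_scope.
Local Open Scope complex_scope.

(* [cabs] is R-valued, whereas the norm [`|z|] of R[i] takes values in R[i]. *)
Definition cabs (R : realType) (z : R[i]) : R := normc z.

Definition cexp (R : realType) (z : R[i]) : R[i] :=
  (expR (complex.Re z))%:C * (cos (complex.Im z) +i* sin (complex.Im z)).

Definition unit_disk (R : realType) : set R[i] := [set z | cabs z < 1].
Arguments unit_disk R _ : clear implicits.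

(* Functions are total, but no value Psi l z with l outside the disk or z
   outside E is constrained. Since R[i] is the field of scalars here,
   [derivable _ l 1] is complex differentiability at l. *)
Definition holomorphic_motion (R : realType) (E : set R[i])
    (Psi : R[i] -> R[i] -> R[i]) : Prop :=
  [/\ forall l, unit_disk R l -> {in E &, injective (Psi l)},
      forall z, E z -> forall l, unit_disk R l ->
        derivable (fun w : R[i]^o => Psi w z : R[i]^o) l 1
    & forall z, E z -> Psi 0 z = z].

(* L is a continuous branch of log (f (z + r) - f z) over r > 0. *)
Definition log_branch (R : realType) (f : R[i] -> R[i]) (z : R[i])
    (L : R -> R[i]) : Prop :=
  {within [set r : R | 0 < r], continuous (L : R -> R[i]^o)} /\
  (forall r : R, 0 < r -> cexp (L r) = f (z + r%:C) - f z).

Section hausdorff.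
Variable R : realType.
Local Open Scope ereal_scope.
Implicit Types (A U : set R[i]) (s delta : R).

Definition diam U : \bar R :=
  ereal_sup (0 |` [set (cabs (p.1 - p.2))%:E | p in U `*` U]).

(* |U|^s with the convention 0^0 = 1 for nonempty U of diameter 0, and
   |set0|^s = 0 for every s. *)
Definition diam_pow s U : \bar R :=
  if pselect (U = set0) then 0 else diam U `^ s.

Definition hausdorff_premeasure s delta A : \bar R :=
  ereal_inf [set \sum_(0 <= i <oo) diam_pow s (U i) | U in
    [set U : nat -> set R[i] |
      A `<=` \bigcup_i U i /\ forall i, diam (U i) <= delta%:E]].

Definition hausdorff_measure s A : \bar R :=
  ereal_sup [set hausdorff_premeasure s delta A | delta in
    [set delta : R | (0 < delta)%R]].

Definition hausdorff_dim A : \bar R :=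
  if pselect (A = set0) then -oo
  else ereal_inf [set s%:E | s in
         [set s : R | (0 <= s)%R /\ hausdorff_measure s A = 0]].

End hausdorff.

(* Main.v *)
Require Import Defs.
From HB Require Import structures.
From mathcomp Require Import all_boot all_order all_algebra.
From mathcomp Require Import all_classical all_reals all_analysis.
From mathcomp Require Import complex.
From mathcomp Require Import ring lra.

Import Order.TTheory GRing.Theory Num.Theory.
Import numFieldNormedType.Exports.
Import ComplexField.Normc.

Set Implicit Arguments.
Unset Strict Implicit.
Unset Printing Implicit Defensive.

Local Open Scope classical_set_scope.
Local Open Scope ring_scope.
Local Open Scope complex_scope.

(** The bound comes from applying the Schwarz-Pick inequality to an average of
logarithms.

Fix z in E and a small r. As mu runs through the disk, the function
phi(mu) = Phi_mu(z + r) - Phi_mu(z) is holomorphic without zeros and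
phi(0) = r, so it has a holomorphic logarithm G with G(0) = ln r. At mu = l the
hypotheses say G(l) = (alpha + i alpha gamma) ln r up to a relative error which
tends to 0 along the scales r_j ([scale_witness_small]). The rotation
hypothesis is about a logarithm which is continuous in r, whereas G is
continuous in mu; both agree up to a constant which depends on z but not on r
([log_branch_shift]), and this constant disappears after division by ln r.

Take n points z_i of a bounded part of E that are separated by 2 * 2^-k, with
scales r_i comparable to 2^-k. Quasisymmetry of the motion makes the image
points separated in proportion to |phi_i(mu)|, so disjoint squares of these
sizes fit in a bounded region and the sum of the |phi_i(mu)|^2 is at most B for
|mu| < rho ([motion_packing]). By concavity of the logarithm the holomorphic
function

    F = (2 / n) * (G_1 + ... + G_n) + ln n - ln (B + 1)

has negative real part on |mu| < rho. Write n = 2^(k sigma). Up to the factor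
k ln 2 and errors that vanish as k grows, F(0) = sigma - 2 and
F(l) = sigma - 2 alpha - 2 i alpha gamma. Schwarz-Pick for the left half-plane,
rho |F(l) - F(0)| <= |l| |F(l) + conj F(0)|, becomes in the limit rho -> 1

    (1 - alpha)^2 + (alpha gamma)^2
      <= |l|^2 ((1 + alpha - sigma)^2 + (alpha gamma)^2),

while F(0), F(l) having negative real part gives sigma <= 1 + alpha; together
sigma is at most the claimed exponent ([motion_counting]). So for every s beyond
that exponent, the points of a bounded part of E at which the scale 2^-k occurs
are covered by at most 2^(k s') disks of radius 2 * 2^-k with some s' < s, once k
is large; summing over k shows that the s-dimensional measure of E vanishes.

The quasisymmetry of the motion is Schottky's theorem applied to the ratio
(Phi_mu(x) - Phi_mu(a)) / (Phi_mu(b) - Phi_mu(a)), which omits 0 and 1.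
Everything is deduced from complex differentiability alone: Goursat's theorem
gives primitives, difference quotients of primitives have two derivatives, and
for functions with two derivatives the maximum principle is an elementary
statement about four-point averages. The maximum principle gives the Schwarz
lemma and Cauchy's estimate, hence the holomorphy of the derivative, holomorphic
logarithms, Bloch's theorem and Schottky's theorem. *)

(** * Modulus and components of complex numbers *)

Section Modulus.
Variable R : realType.
Implicit Types (z w : R[i]) (x y e : R).

Lemma cabs_sqr z : cabs z ^+ 2 = complex.Re z ^+ 2 + complex.Im z ^+ 2.
Proof. by case: z => a b; rewrite /cabs /= sqr_sqrtr // addr_ge0 ?sqr_ge0. Qed.

Lemma cabs_ge0 z : 0 <= cabs z.
Proof. by case: z => a b; rewrite /cabs /= sqrtr_ge0. Qed.

Lemma cabs0 : cabs (0 : R[i]) = 0. Proof. exact: normc0. Qed.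

Lemma cabs1 : cabs (1 : R[i]) = 1. Proof. exact: normc1. Qed.

Lemma cabsM z w : cabs (z * w) = cabs z * cabs w. Proof. exact: normcM. Qed.

Lemma cabsV z : cabs z^-1 = (cabs z)^-1. Proof. exact: normcV. Qed.

Lemma cabsN z : cabs (- z) = cabs z. Proof. exact: normcN. Qed.

Lemma cabsX z n : cabs (z ^+ n) = cabs z ^+ n.
Proof. by elim: n => [|n IH]; rewrite ?expr0 ?cabs1// !exprS cabsM IH. Qed.

Lemma cabs_distC z w : cabs (z - w) = cabs (w - z).
Proof. by rewrite -cabsN opprB. Qed.

Lemma cabs_eq0 z : (cabs z == 0) = (z == 0).
Proof.
by apply/eqP/eqP => [|->]; [exact: eq0_normc|exact: cabs0].
Qed.

Lemma cabs_gt0 z : (0 < cabs z) = (z != 0).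
Proof. by rewrite lt_def cabs_ge0 andbT cabs_eq0. Qed.

Lemma ler_cabsD z w : cabs (z + w) <= cabs z + cabs w.
Proof. exact: le_normcD. Qed.

Lemma ler_cabsB z w : cabs (z - w) <= cabs z + cabs w.
Proof. by rewrite (le_trans (ler_cabsD _ _))// cabsN. Qed.

Lemma lerB_cabs z w : cabs z - cabs w <= cabs (z - w).
Proof. by have := ler_cabsD (z - w) w; rewrite subrK lerBlDr. Qed.

Lemma lerB_cabsD z w : cabs z - cabs w <= cabs (z + w).
Proof. by have := lerB_cabs z (- w); rewrite opprK cabsN. Qed.

Lemma cabs_real x : cabs (x%:C : R[i]) = `|x|.
Proof. by rewrite /cabs /= expr0n /= addr0 sqrtr_sqr. Qed.

Lemma cabs_Re z : `|complex.Re z| <= cabs z.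
Proof.
by rewrite -(@ler_pXn2r _ 2)// ?nnegrE ?cabs_ge0// cabs_sqr real_normK ?num_real//
           lerDl sqr_ge0.
Qed.

Lemma cabs_Im z : `|complex.Im z| <= cabs z.
Proof.
by rewrite -(@ler_pXn2r _ 2)// ?nnegrE ?cabs_ge0// cabs_sqr real_normK ?num_real//
           lerDr sqr_ge0.
Qed.

Lemma cabs_le_ReIm z : cabs z <= `|complex.Re z| + `|complex.Im z|.
Proof.
rewrite -(@ler_pXn2r _ 2)// ?nnegrE ?cabs_ge0 ?addr_ge0// cabs_sqr.
rewrite -(real_normK (num_real (complex.Re z))) -(real_normK (num_real (complex.Im z))).
have := normr_ge0 (complex.Re z); have := normr_ge0 (complex.Im z); nra.
Qed.

Lemma cabs_conj z : cabs z^*%C = cabs z.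
Proof. by case: z => a b; rewrite /cabs /= sqrrN. Qed.

Lemma ReD z w : complex.Re (z + w) = complex.Re z + complex.Re w.
Proof. by case: z; case: w. Qed.
Lemma ImD z w : complex.Im (z + w) = complex.Im z + complex.Im w.
Proof. by case: z; case: w. Qed.
Lemma ReN z : complex.Re (- z) = - complex.Re z. Proof. by case: z. Qed.
Lemma ImN z : complex.Im (- z) = - complex.Im z. Proof. by case: z. Qed.
Lemma ReM z w :
  complex.Re (z * w) = complex.Re z * complex.Re w - complex.Im z * complex.Im w.
Proof. by case: z; case: w. Qed.
Lemma ImM z w :
  complex.Im (z * w) = complex.Re z * complex.Im w + complex.Im z * complex.Re w.
Proof. by case: z; case: w. Qed.

Lemma complex_ext z w :
  complex.Re z = complex.Re w -> complex.Im z = complex.Im w -> z = w.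
Proof. by case: z; case: w => a b c d /= -> ->. Qed.

Definition ReImE := (ReD, ImD, ReN, ImN, ReM, ImM).

Lemma cabs_sum (I : Type) (s : seq I) (P : pred I) (F : I -> R[i]) :
  cabs (\sum_(i <- s | P i) F i) <= \sum_(i <- s | P i) cabs (F i).
Proof.
elim/big_rec2 : _ => [|i y z _ IH]; first by rewrite cabs0.
by rewrite (le_trans (ler_cabsD _ _))// lerD2l.
Qed.

End Modulus.

(** * Induction on squares by subdivision *)

Section SquareInduction.
Variable R : realType.
Implicit Types (P : R -> R -> R -> Prop) (x y s a b : R).

Lemma geometric_small (c d : R) : 0 < d -> exists n, c / 2 ^+ n < d.
Proof.
move=> d0; exists (Num.truncn (c / d)).+1.
set n := (Num.truncn _).+1.
have cd : c / d < n%:R by rewrite /n truncnS_gt.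
rewrite ltr_pdivrMr ?exprn_gt0//.
rewrite ltr_pdivrMr// in cd; apply: (lt_le_trans cd).
rewrite mulrC ler_pM2l// -natrX ler_nat ltnW//; exact: ltn_expl.
Qed.

(** If a property fails on a square it fails on a quarter of it; the nested
failing squares shrink to a point, near which the property holds. This single
bisection argument serves for compactness of closed bounded sets, for the mean
value inequality and for Goursat's theorem. *)
Lemma square_induction P x0 y0 s0 : 0 < s0 ->
  (forall x y s, 0 < s -> P x y (s / 2) -> P (x + s / 2) y (s / 2) ->
    P x (y + s / 2) (s / 2) -> P (x + s / 2) (y + s / 2) (s / 2) -> P x y s) ->
  (forall a b, x0 <= a <= x0 + s0 -> y0 <= b <= y0 + s0 ->
    exists2 d, 0 < d & forall x y s, 0 < s < d -> x <= a <= x + s ->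
      y <= b <= y + s -> P x y s) ->
  P x0 y0 s0.
Proof.
move=> s00 merge loc; apply: contrapT => nP.
pose Q := {p : R * R * R | 0 < p.2 /\ ~ P p.1.1 p.1.2 p.2}.
have step (q : Q) : exists q' : Q, [/\ (sval q').2 = (sval q).2 / 2,
    (sval q).1.1 <= (sval q').1.1,
    (sval q').1.1 + (sval q').2 <= (sval q).1.1 + (sval q).2,
    (sval q).1.2 <= (sval q').1.2 &
    (sval q').1.2 + (sval q').2 <= (sval q).1.2 + (sval q).2].
  case: q => -[[x y] s] /= [s0_ nPq].
  have h0 : 0 < s / 2 by lra.
  apply: contrapT => nex; apply: nPq; apply: merge => //; apply: contrapT => nPq.
  - by apply: nex; exists (exist _ (x, y, s / 2) (conj h0 nPq)) => /=; split; lra.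
  - by apply: nex; exists (exist _ (x + s / 2, y, s / 2) (conj h0 nPq)) => /=; split; lra.
  - by apply: nex; exists (exist _ (x, y + s / 2, s / 2) (conj h0 nPq)) => /=; split; lra.
  - by apply: nex; exists (exist _ (x + s / 2, y + s / 2, s / 2) (conj h0 nPq)) => /=; split; lra.
have [nxt nxtP] := choice step.
pose q n : Q := iter n nxt (exist _ (x0, y0, s0) (conj s00 nP)).
pose X n := (sval (q n)).1.1; pose Y n := (sval (q n)).1.2; pose S n := (sval (q n)).2.
have SE n : S n = s0 / 2 ^+ n.
  elim: n => [|n IH]; first by rewrite expr0 divr1.
  rewrite /S /q /=; have [-> _ _ _ _] := nxtP (q n).
  by rewrite -/(S n) IH exprS invfM mulrA -mulrA [_^-1 * 2^-1]mulrC mulrA.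
have S0 n : 0 < S n by exact: (proj1 (svalP (q n))).
have lim (Z : nat -> R) : (forall n, Z n <= Z n.+1) ->
    (forall n, Z n.+1 + S n.+1 <= Z n + S n) ->
    exists a, forall n, Z n <= a <= Z n + S n.
  move=> Zi Zd.
  have Zi' n k : Z n <= Z (n + k)%N.
    by elim: k => [|k IH]; [rewrite addn0|rewrite addnS (le_trans IH)].
  have Zd' n k : Z (n + k)%N + S (n + k)%N <= Z n + S n.
    by elim: k => [|k IH]; [rewrite addn0|rewrite addnS (le_trans _ IH)].
  have Zub m n : Z m <= Z n + S n.
    have [mn|/ltnW nm] := leqP m n.
      by rewrite (le_trans (Zi' m (n - m)%N)) ?subnKC// lerDl ltW.
    by rewrite (le_trans _ (Zd' n (m - n)%N)) ?subnKC// lerDl ltW.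
  exists (sup (range Z)) => n; apply/andP; split.
    by apply: ub_le_sup; [exists (Z 0%N + S 0%N) => _ [m _ <-]|exists n].
  by apply: ge_sup; [exists (Z 0%N); exists 0%N|move=> _ [m _ <-]].
have [a Ha] := lim X (fun n => let: And5 _ h _ _ _ := nxtP (q n) in h)
                     (fun n => let: And5 _ _ h _ _ := nxtP (q n) in h).
have [b Hb] := lim Y (fun n => let: And5 _ _ _ h _ := nxtP (q n) in h)
                     (fun n => let: And5 _ _ _ _ h := nxtP (q n) in h).
have [d d0 Hd] := loc a b (Ha 0%N) (Hb 0%N).
have [n Hn] := geometric_small s0 d0.
apply: (proj2 (svalP (q n))); apply: Hd; [|exact: Ha|exact: Hb].
by rewrite -/(S n) S0 SE Hn.
Qed.

Lemma interval_induction (P : R -> R -> Prop) x0 s0 : 0 < s0 ->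
  (forall x s, 0 < s -> P x (s / 2) -> P (x + s / 2) (s / 2) -> P x s) ->
  (forall a, x0 <= a <= x0 + s0 -> exists2 d, 0 < d & forall x s,
     0 < s < d -> x <= a <= x + s -> P x s) ->
  P x0 s0.
Proof.
move=> s00 merge loc.
apply: (@square_induction (fun x _ s => P x s) x0 0 s0 s00).
  by move=> x y s s_0 ? ? _ _; exact: merge.
by move=> a b /loc[d d0 Hd] _; exists d => // x y s ? ? _; exact: Hd.
Qed.

End SquareInduction.

(** * Complex differentiability *)

Section Local.
Variable R : realType.
Local Notation C := R[i].
Implicit Types (z w h : C) (f g : C -> C) (P Q : C -> Prop).

(** Errors are measured with the real-valued modulus, so that they can be
handled by linear arithmetic over the reals. *)
Definition near0 P := exists2 d : R, 0 < d & forall h, cabs h < d -> P h.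

Lemma near0I P Q : near0 P -> near0 Q -> near0 (fun h => P h /\ Q h).
Proof.
move=> [d d0 Hd] [e e0 He]; exists (Num.min d e); first by rewrite lt_min d0 e0.
by move=> h; rewrite lt_min => /andP[/Hd Ph /He Qh].
Qed.

Lemma near0W P Q : (forall h, P h -> Q h) -> near0 P -> near0 Q.
Proof. by move=> PQ [d d0 Hd]; exists d => // h /Hd /PQ. Qed.

Lemma near0_lt (d : R) : 0 < d -> near0 (fun h => cabs h < d).
Proof. by move=> d0; exists d. Qed.

Lemma normr_cabs z : `|z| = (cabs z)%:C. Proof. by case: z. Qed.

Lemma near0P P : near0 P <-> \forall h \near (0 : C^o), P h.
Proof.
split=> [[d d0 Hd]|/nbhs_ballP[/= e e0 He]].
  apply/nbhs_ballP; exists d%:C => /=; first by rewrite ltcR.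
  by move=> h; rewrite -ball_normE /= sub0r normrN normr_cabs ltcR; exact: Hd.
exists (complex.Re e) => [|h hd].
  by move: e0; rewrite ltcE /= => /andP[].
apply: He; rewrite -ball_normE /= sub0r normrN normr_cabs.
by move: e0 hd; case: e => a b; rewrite !ltcE /= => /andP[/eqP -> _] ->; rewrite eqxx.
Qed.

Definition ccont f z := forall e, 0 < e -> near0 (fun h => cabs (f (z + h) - f z) <= e).

Definition cderiv f z (d : C) := forall e, 0 < e ->
  near0 (fun h => cabs (f (z + h) - f z - d * h) <= e * cabs h).

(** Bridge to the norm-based derivative, through which the rules of calculus are inherited. *)
Lemma cderivP f z d : is_derive (z : C^o) 1 (f : C^o -> C^o) d <-> cderiv f z d.
Proof.
split.
  move=> [fz <-] e e0.
  have : (fun h : C^o => h^-1 *: (((f : C^o -> C^o) \o shift (z : C^o)) (h *: 1) - f z)) @ 0^' --> 'D_1 (f : C^o -> C^o) z.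
    exact: fz.
  move/cvgrPdist_le => /(_ e%:C); rewrite ltcR => /(_ e0).
  rewrite /prop_near1 /dnbhs /within /= => /near0P [r r0 Hr]; exists r => // h hr.
  have [->|h0] := eqVneq h 0; first by rewrite addr0 mulr0 subr0 subrr cabs0 mulr0.
  have := Hr h hr h0; rewrite normr_cabs lecR => He.
  have -> : f (z + h) - f z - 'D_1 (f : C^o -> C^o) z * h =
     - ('D_1 (f : C^o -> C^o) z - h^-1 *: (f (h *: (1 : C^o) + z) - f z)) * h.
    rewrite /GRing.scale /= mulr1 [h + z]addrC; field; exact: h0.
  by rewrite cabsM cabsN ler_wpM2r ?cabs_ge0.
move=> fz.
have H : (fun h : C^o => h^-1 *: (((f : C^o -> C^o) \o shift (z : C^o)) (h *: 1) - f z)) @ 0^' --> (d : C^o).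
  apply/cvgrPdist_le => e e0.
  have e0' : 0 < complex.Re e by move: e0; rewrite ltcE /= => /andP[].
  have ee : e = (complex.Re e)%:C.
    by move: e0; case: e {e0'} => a b; rewrite ltcE /= => /andP[/eqP -> _].
  rewrite /prop_near1 /dnbhs /within /=; apply/near0P.
  apply: near0W (fz _ e0') => h /= Hh h0.
  rewrite normr_cabs ee lecR.
  have -> : d - h^-1 *: (f (h *: (1 : C^o) + z) - f z) = - (f (z + h) - f z - d * h) / h.
    rewrite /GRing.scale /= mulr1 [h + z]addrC; field; exact: h0.
  by rewrite cabsM cabsN cabsV ler_pdivrMr ?cabs_gt0.
apply: DeriveDef; first by apply/cvg_ex; exists d.
by apply: cvg_lim.
Qed.

(** The form in which the holomorphy of a motion is used. *)
Lemma derivable_cderiv f z :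
  derivable (f : C^o -> C^o) (z : C^o) 1 -> exists d, cderiv f z d.
Proof. by move=> /derivableP; exists ('D_1 (f : C^o -> C^o) z); apply/cderivP. Qed.

Lemma cderiv_cst (c z : C) : cderiv (fun=> c) z 0.
Proof. by move=> e e0; exists 1 => // h _; rewrite mul0r !subrr cabs0 mulr_ge0 ?cabs_ge0 ?ltW. Qed.

Lemma cderiv_id z : cderiv id z 1.
Proof. by apply/cderivP; exact: is_derive_id. Qed.

Lemma cderivD f g z a b : cderiv f z a -> cderiv g z b ->
  cderiv (fun x => f x + g x) z (a + b).
Proof. by move=> /cderivP ? /cderivP ?; apply/cderivP; exact: is_deriveD. Qed.

Lemma cderivN f z a : cderiv f z a -> cderiv (fun x => - f x) z (- a).
Proof. by move=> /cderivP ?; apply/cderivP; exact: is_deriveN. Qed.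

Lemma cderivB f g z a b : cderiv f z a -> cderiv g z b ->
  cderiv (fun x => f x - g x) z (a - b).
Proof. by move=> fa /cderivN; exact: cderivD. Qed.

Lemma cderivM f g z a b : cderiv f z a -> cderiv g z b ->
  cderiv (fun x => f x * g x) z (a * g z + f z * b).
Proof.
move=> /cderivP fa /cderivP gb.
have H := @is_deriveM C C^o f g z 1 a b fa gb.
have -> : a * g z + f z * b = f z *: (b : C^o) + g z *: (a : C^o).
  by rewrite /GRing.scale /= addrC [g _ * _]mulrC.
exact: (proj1 (cderivP (fun x => f x * g x) z _) H).
Qed.

Lemma cderivV f z a : f z != 0 -> cderiv f z a ->
  cderiv (fun x => (f x)^-1) z (- a / f z ^+ 2).
Proof.
move=> fz0 /cderivP [fz <-]; apply/cderivP; apply: DeriveDef.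
  exact: (@derivableV C C^o f).
by rewrite (@deriveV C C^o f)// /GRing.scale /= !mulNr mulrC.
Qed.

Lemma cderiv_eq f z a b : a = b -> cderiv f z a -> cderiv f z b.
Proof. by move=> ->. Qed.

Lemma cderiv_near f g z a : near0 (fun h => f (z + h) = g (z + h)) ->
  cderiv f z a -> cderiv g z a.
Proof.
move=> fg fa e e0.
have [d d0 H] := fg; have fg0 : f z = g z by rewrite -[z]addr0 H// cabs0.
by apply: near0W (near0I fg (fa e e0)) => h [<-]; rewrite fg0.
Qed.

Lemma cderivZ (c : C) f z a : cderiv f z a -> cderiv (fun x => c * f x) z (c * a).
Proof.
by move=> fa; apply: cderiv_eq (cderivM (cderiv_cst c z) fa); rewrite mul0r add0r.
Qed.

Lemma cderiv_cont f z a : cderiv f z a -> ccont f z.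
Proof.
move=> fa e e0.
have c0 : 0 < e / (1 + cabs a) by rewrite divr_gt0// ltr_pwDl// cabs_ge0.
apply: near0W (near0I (fa 1 ltr01) (near0_lt c0)) => h [H1 H2].
have -> : f (z + h) - f z = (f (z + h) - f z - a * h) + a * h by rewrite subrK.
apply: le_trans (ler_cabsD _ _) _; rewrite cabsM.
rewrite ltr_pdivlMr ?ltr_pwDl ?cabs_ge0// in H2.
nra.
Qed.

Lemma ccont_near0 f z (P : C -> Prop) : ccont f z ->
  near0 P -> near0 (fun h => P (f (z + h) - f z)).
Proof.
move=> fz [d d0 Pd]; have e0 : 0 < d / 2 by lra.
apply: near0W (fz _ e0) => h Hh; apply: Pd; lra.
Qed.

Lemma ccont_comp f g z : ccont f z -> ccont g (f z) -> ccont (g \o f) z.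
Proof.
move=> fz gz e e0; apply: near0W (ccont_near0 fz (gz e e0)) => h /=.
by rewrite subrKC.
Qed.

Lemma cderiv_comp f g z a b : cderiv f z a -> cderiv g (f z) b ->
  cderiv (fun x => g (f x)) z (b * a).
Proof.
move=> fa gb e e0.
have a1 : 0 < 1 + cabs a by rewrite ltr_pwDl// cabs_ge0.
have b1 : 0 < 1 + cabs b by rewrite ltr_pwDl// cabs_ge0.
have e1 : 0 < Num.min 1 (e / 2 / (1 + cabs b)) by rewrite lt_min ltr01 !divr_gt0.
have e2 : 0 < e / 2 / (1 + cabs a) by rewrite !divr_gt0.
apply: near0W (near0I (fa _ e1) (ccont_near0 (cderiv_cont fa) (gb _ e2))) => h /=.
set k := f (z + h) - f z => -[H1].
have -> : f z + k = f (z + h) by rewrite /k subrKC.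
have kh : cabs k <= (1 + cabs a) * cabs h.
  have -> : k = (k - a * h) + a * h by rewrite subrK.
  rewrite (le_trans (ler_cabsD _ _))// cabsM mulrDl lerD2r (le_trans H1)//.
  by rewrite ler_wpM2r ?cabs_ge0// ge_min lexx.
have H1' : (1 + cabs b) * cabs (k - a * h) <= e / 2 * cabs h.
  rewrite mulrC -ler_pdivlMr// (le_trans H1)// [leRHS]mulrAC ler_wpM2r ?cabs_ge0//.
  by rewrite ge_min lexx orbT.
move=> H2.
have {}H2 : cabs (g (f (z + h)) - g (f z) - b * k) <= e / 2 * cabs h.
  apply: le_trans H2 _; apply: le_trans (ler_wpM2l (ltW e2) kh) _.
  by rewrite mulrA -(mulrA _ _ (1 + cabs a)) mulVf ?mulr1// gt_eqF.
have -> : g (f (z + h)) - g (f z) - b * a * h =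
  (g (f (z + h)) - g (f z) - b * k) + b * (k - a * h) by ring.
rewrite (le_trans (ler_cabsD _ _))// cabsM.
have := cabs_ge0 (k - a * h); lra.
Qed.

Lemma cderivX f z a n : cderiv f z a ->
  cderiv (fun x => f x ^+ n) z (n%:R * f z ^+ n.-1 * a).
Proof.
move=> fa; elim: n => [|n IH].
  by apply: cderiv_eq (cderiv_cst 1 z); rewrite !mul0r.
rewrite (_ : (fun x => f x ^+ n.+1) = (fun x => f x * f x ^+ n)); last first.
  by apply/funext => x; rewrite exprS.
apply: cderiv_eq (cderivM fa IH) => /=.
case: n {IH} => [|n] /=; first by rewrite !expr0; ring.
by rewrite exprS -[n.+2%:R]natr1; ring.
Qed.

Lemma cderiv_sum (I : Type) (s : seq I) (F : I -> C -> C) (a : I -> C) z :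
  (forall i, cderiv (F i) z (a i)) ->
  cderiv (fun x => \sum_(i <- s) F i x) z (\sum_(i <- s) a i).
Proof.
move=> Fa; elim: s => [|i s IH].
  rewrite big_nil (_ : (fun _ => _) = (fun=> 0)); first exact: cderiv_cst.
  by apply/funext => x; rewrite big_nil.
rewrite big_cons (_ : (fun _ => _) = (fun x => F i x + \sum_(j <- s) F j x)).
  exact: cderivD.
by apply/funext => x; rewrite big_cons.
Qed.

Lemma ccont_id z : ccont id z. Proof. exact: cderiv_cont (cderiv_id z). Qed.

End Local.

(** * Extreme values and uniform continuity on closed bounded sets *)

Section Compactness.
Variable R : realType.
Local Notation C := R[i].
Implicit Types (K : C -> Prop) (z w : C).

Definition cclosed K := forall z, ~ K z -> near0 (fun h => ~ K (z + h)).
Definition cbounded K := exists M : R, forall z, K z -> cabs z <= M.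

Definition in_square (x y s : R) z :=
  [/\ x <= complex.Re z, complex.Re z <= x + s, y <= complex.Im z & complex.Im z <= y + s].

Lemma in_square_split x y s z : in_square x y s z ->
  [\/ in_square x y (s / 2) z, in_square (x + s / 2) y (s / 2) z,
      in_square x (y + s / 2) (s / 2) z | in_square (x + s / 2) (y + s / 2) (s / 2) z].
Proof.
move=> [h1 h2 h3 h4].
by case: (leP (complex.Re z) (x + s / 2)) => hx; case: (leP (complex.Im z) (y + s / 2)) => hy;
  [apply: Or41|apply: Or43|apply: Or42|apply: Or44]; split; lra.
Qed.

Lemma in_square_dist x y s a b z : x <= a <= x + s -> y <= b <= y + s ->
  in_square x y s z -> cabs (z - a +i* b) <= 2 * s.
Proof.
move=> Ha Hb [h1 h2 h3 h4].
rewrite (le_trans (cabs_le_ReIm _))// !ReImE /=.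
have : `|complex.Re z - a| <= s by rewrite ler_norml; lra.
have : `|complex.Im z - b| <= s by rewrite ler_norml; lra.
lra.
Qed.

Lemma near0_square (P : C -> Prop) a b : near0 (fun h => P (a +i* b + h)) ->
  exists2 d : R, 0 < d & forall x y s, 0 < s < d -> x <= a <= x + s ->
    y <= b <= y + s -> forall z, in_square x y s z -> P z.
Proof.
move=> [d d0 Hd]; exists (d / 2); first by lra.
move=> x y s sd Ha Hb z /(in_square_dist Ha Hb) Hz.
by rewrite -[z](subrKC (a +i* b)); apply: Hd; lra.
Qed.

Lemma cabs_in_square M z : cabs z <= M -> in_square (- M) (- M) (2 * M) z.
Proof.
move=> zM; have := le_trans (cabs_Re z) zM; have := le_trans (cabs_Im z) zM.
by rewrite !ler_norml => /andP[? ?] /andP[? ?]; split; lra.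
Qed.

(** Otherwise every point of K has a neighbourhood on which u stays below one
of its own values, and by subdivision K as a whole has this property. *)
Lemma compact_max K (u : C -> R) : cclosed K -> cbounded K -> (exists z, K z) ->
  (forall z, K z -> forall e, 0 < e -> near0 (fun h => u (z + h) <= u z + e)) ->
  exists2 z, K z & forall w, K w -> u w <= u z.
Proof.
move=> Kc [M KM] [k0 Kk0] uc; apply: contrapT => nomax.
have nomax' z : K z -> exists2 w, K w & u z < u w.
  move=> Kz; apply: contrapT => H; apply: nomax; exists z => // w Kw.
  by rewrite leNgt; apply/negP => zw; apply: H; exists w.
(* Such bounds merge: the larger of two is still exceeded by some value of u on K. *)
pose P x y s := exists m, (exists2 v, K v & m < u v) /\
  forall w, K w -> in_square x y s w -> u w <= m.
have M0 : 0 < `|M| + 1 by rewrite ltr_wpDl.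
have : P (- (`|M| + 1)) (- (`|M| + 1)) (2 * (`|M| + 1)).
apply: square_induction.
- lra.
- move=> x y s s0 [m1 [[v1 Kv1 mv1] H1]] [m2 [[v2 Kv2 mv2] H2]].
  move=> [m3 [[v3 Kv3 mv3] H3]] [m4 [[v4 Kv4 mv4] H4]].
  exists (Num.max (Num.max m1 m2) (Num.max m3 m4)); split.
    have good m n : (exists2 v, K v & m < u v) -> (exists2 v, K v & n < u v) ->
      exists2 v, K v & Num.max m n < u v by case: (leP m n).
    by apply: (@good); apply: (@good); [exists v1|exists v2|exists v3|exists v4].
  by move=> w Kw /in_square_split[] Hw; rewrite !le_max;
    [rewrite (H1 w Kw Hw)|rewrite (H2 w Kw Hw)|rewrite (H3 w Kw Hw)|rewrite (H4 w Kw Hw)];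
    rewrite ?orbT.
- move=> a b _ _; have [Kz|nKz] := pselect (K (a +i* b)).
    have [v Kv uv] := nomax' _ Kz.
    have e0 : 0 < (u v - u (a +i* b)) / 2 by lra.
    have [d d0 Hd] := @near0_square (fun w => u w <= u (a +i* b) + (u v - u (a +i* b)) / 2)
      a b (uc _ Kz _ e0).
    exists d => // x y s sd Ha Hb; exists (u (a +i* b) + (u v - u (a +i* b)) / 2); split.
      by exists v => //; lra.
    by move=> w _; exact: Hd.
  have [d d0 Hd] := @near0_square (fun w => ~ K w) a b (Kc _ nKz).
  exists d => // x y s sd Ha Hb; exists (u k0 - 1); split; first by exists k0 => //; lra.
  by move=> w Kw /(Hd _ _ _ sd Ha Hb).
move=> [m [[v Kv mv] Hm]]; suff : u v <= m by lra.
apply: Hm => //; apply: cabs_in_square; have := KM _ Kv; have := ler_norm M; lra.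
Qed.

Lemma ccont_cabs (f : C -> C) z : ccont f z -> forall e : R, 0 < e ->
  near0 (fun h => cabs (f (z + h)) <= cabs (f z) + e).
Proof.
move=> fz e e0; apply: near0W (fz e e0) => h.
have := lerB_cabs (f (z + h)) (f z); lra.
Qed.

Lemma compact_bounded K (f : C -> C) : cclosed K -> cbounded K ->
  (forall z, K z -> ccont f z) -> exists2 M : R, 0 < M & forall z, K z -> cabs (f z) <= M.
Proof.
move=> Kc Kb fc; have [[k0 Kk0]|nK] := pselect (exists z, K z); last first.
  by exists 1 => // z Kz; case: nK; exists z.
have [|z Kz Hz] := @compact_max K (fun z => cabs (f z)) Kc Kb (ex_intro _ k0 Kk0).
  by move=> z Kz; apply: ccont_cabs; exact: fc.
exists (cabs (f z) + 1) => [|w /Hz]; first by rewrite ltr_wpDl// cabs_ge0.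
by move=> H; rewrite ler_wpDr.
Qed.

Lemma compact_ucont K (f : C -> C) : cclosed K -> cbounded K ->
  (forall z, K z -> ccont f z) ->
  forall e : R, 0 < e -> exists2 d : R, 0 < d &
    forall z w, K z -> cabs (w - z) < d -> cabs (f w - f z) <= e.
Proof.
move=> Kc [M KM] fc e e0.
pose P x y s := exists2 d : R, 0 < d & forall z w, K z -> in_square x y s z ->
  cabs (w - z) < d -> cabs (f w - f z) <= e.
have M0 : 0 < `|M| + 1 by rewrite ltr_wpDl.
have : P (- (`|M| + 1)) (- (`|M| + 1)) (2 * (`|M| + 1)).
apply: square_induction.
- lra.
- move=> x y s s0 [d1 d10 H1] [d2 d20 H2] [d3 d30 H3] [d4 d40 H4].
  exists (Num.min (Num.min d1 d2) (Num.min d3 d4)); first by rewrite !lt_min d10 d20 d30 d40.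
  move=> z w Kz /in_square_split Hz; rewrite !lt_min => /andP[/andP[w1 w2] /andP[w3 w4]].
  by case: Hz => Hz; [exact: H1|exact: H2|exact: H3|exact: H4].
- move=> a b _ _; have [Kz|nKz] := pselect (K (a +i* b)); last first.
    have [d d0 Hd] := @near0_square (fun w => ~ K w) a b (Kc _ nKz).
    exists d => // x y s sd Ha Hb; exists 1 => // z w Kz /(Hd _ _ _ sd Ha Hb) //.
  have e2 : 0 < e / 2 by lra.
  have [d d0 Hd] := fc _ Kz _ e2.
  exists (d / 4) => [|x y s sd Ha Hb]; first by lra.
  exists (d / 2); first by lra.
  move=> z w _ /(in_square_dist Ha Hb) Hz zw.
  have close v : cabs (v - a +i* b) < d -> cabs (f v - f (a +i* b)) <= e / 2.
    by move=> /Hd; rewrite subrKC.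
  have -> : f w - f z = (f w - f (a +i* b)) - (f z - f (a +i* b)) by ring.
  rewrite (le_trans (ler_cabsB _ _))//.
  have := close z; have := close w.
  have := ler_cabsD (w - z) (z - a +i* b); rewrite addrA subrK.
  move=> ? H1 H2; have := H1 _; have := H2 _; lra.
move=> [d d0 Hd]; exists d => // z w Kz; apply: Hd => //.
apply: cabs_in_square; have := KM _ Kz; have := ler_norm M; lra.
Qed.

Lemma cclosed_disk (a : C) (r : R) : cclosed (fun z => cabs (z - a) <= r).
Proof.
move=> z /negP; rewrite -ltNge => zr; exists (cabs (z - a) - r); first by lra.
move=> h hr; apply/negP; rewrite -ltNge.
have := lerB_cabsD (z - a) h; rewrite addrAC; lra.
Qed.

Lemma cbounded_disk (a : C) (r : R) : cbounded (fun z => cabs (z - a) <= r).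
Proof.
exists (r + cabs a) => z zr; have := lerB_cabs z a; lra.
Qed.

End Compactness.

(** * Mean value inequality and integrals along segments *)

Section RealVariable.
Variable R : realType.
Local Notation C := R[i].
Implicit Types (G g : R -> C) (t s a b : R).

Definition rderiv G t (d : C) := forall e, 0 < e -> exists2 del : R, 0 < del &
  forall s, `|s| < del -> cabs (G (t + s) - G t - d * s%:C) <= e * `|s|.

Definition rcont g t := forall e, 0 < e -> exists2 del : R, 0 < del &
  forall s, `|s| < del -> cabs (g (t + s) - g t) <= e.

(** Subdivision reduces the claim to short intervals, where the increment is
the derivative times the length up to a small relative error. *)
Lemma mean_value_le G a b M : a <= b ->
  (forall t, a <= t <= b -> exists2 d, rderiv G t d & cabs d <= M) ->
  cabs (G b - G a) <= M * (b - a).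
Proof.
rewrite le_eqVlt => /predU1P[->|ab GM]; first by rewrite !subrr cabs0 mulr0.
have ba : 0 < b - a by lra.
apply/ler_addgt0Pr => e e0.
have e1 : 0 < e / (b - a) by rewrite divr_gt0.
suff : cabs (G (a + (b - a)) - G a) <= (M + e / (b - a)) * (b - a).
  by rewrite subrKC mulrDl divfK// gt_eqF.
apply: (@interval_induction R (fun x s => cabs (G (x + s) - G x) <= (M + e / (b - a)) * s)) => //.
  move=> x s s0; rewrite -addrA -splitr => H1 H2.
  have -> : G (x + s) - G x = (G (x + s) - G (x + s / 2)) + (G (x + s / 2) - G x) by ring.
  rewrite (le_trans (ler_cabsD _ _))//; lra.
move=> t Ht; have [|d Gd dM] := GM t; first by lra.
have [del del0 H] := Gd _ e1; exists del => // x s sdel xts.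
have -> : G (x + s) - G x = (G (t + (x + s - t)) - G t - d * (x + s - t)%:C)
   - (G (t + (x - t)) - G t - d * (x - t)%:C) + d * s%:C.
  by rewrite !subrKC !rmorphB !rmorphD /=; ring.
have H1 : `|x + s - t| < del by rewrite ger0_norm; lra.
have H2 : `|x - t| < del by rewrite ler0_norm; lra.
have := H _ H1; have := H _ H2.
rewrite (@ger0_norm _ (x + s - t)) 1?(@ler0_norm _ (x - t)); [|lra|lra] => {H1 H2} H1 H2.
apply: le_trans (ler_cabsD _ _) _; rewrite cabsM cabs_real (@ger0_norm _ s); last by lra.
apply: le_trans (lerD (ler_cabsB _ _) (lexx _)) _.
have : cabs d * s <= M * s by rewrite ler_wpM2r//; lra.
move: H1 H2; set u := cabs _; set v := cabs _; nra.
Qed.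

Lemma rderivB G g t (a b : C) : rderiv G t a -> rderiv g t b ->
  rderiv (fun x => G x - g x) t (a - b).
Proof.
move=> Ga gb e e0; have e2 : 0 < e / 2 by lra.
have [d1 d10 H1] := Ga _ e2; have [d2 d20 H2] := gb _ e2.
exists (Num.min d1 d2); first by rewrite lt_min d10 d20.
move=> s; rewrite lt_min => /andP[/H1 {}H1 /H2 {}H2].
have -> : G (t + s) - g (t + s) - (G t - g t) - (a - b) * s%:C =
  (G (t + s) - G t - a * s%:C) - (g (t + s) - g t - b * s%:C) by ring.
rewrite (le_trans (ler_cabsB _ _))//; lra.
Qed.

Lemma rderivZ (c : C) G t (a : C) : rderiv G t a -> rderiv (fun x => c * G x) t (c * a).
Proof.
move=> Ga e e0; have c0 : 0 < cabs c + 1 by rewrite ltr_wpDl// cabs_ge0.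
have e1 : 0 < e / (cabs c + 1) by rewrite divr_gt0.
have [d d0 H] := Ga _ e1; exists d => // s /H {}H.
rewrite -mulrBr -mulrA -mulrBr cabsM.
rewrite mulrAC ler_pdivlMr// mulrC in H; apply: le_trans H.
by rewrite ler_wpM2r ?cabs_ge0// lerDl.
Qed.

Lemma cderiv_line (F : C -> C) (p v : C) t d : cderiv F (p + t%:C * v) d ->
  rderiv (fun t => F (p + t%:C * v)) t (d * v).
Proof.
move=> Fd e e0; have v0 : 0 < cabs v + 1 by rewrite ltr_wpDl// cabs_ge0.
have e1 : 0 < e / (cabs v + 1) by rewrite divr_gt0.
have [del del0 H] := Fd _ e1; exists (del / (cabs v + 1)); first by rewrite divr_gt0.
move=> s; rewrite ltr_pdivlMr// => Hs.
have sv : cabs (s%:C * v) <= `|s| * (cabs v + 1).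
  by rewrite cabsM cabs_real ler_wpM2l// lerDl.
have := H _ (le_lt_trans sv Hs).
have -> : p + (t + s)%:C * v = p + t%:C * v + s%:C * v by rewrite rmorphD /=; ring.
have -> : d * v * s%:C = d * (s%:C * v) by ring.
move=> /le_trans; apply.
by rewrite mulrAC ler_pdivrMr// -mulrA ler_pM2l.
Qed.

(** Applied to the difference of G and H. It yields at once that a primitive is
unique up to a constant and that its increments depend continuously on the
integrand. *)
Lemma primitive_close_le g G H a b M :
  (forall t, Num.min a b <= t <= Num.max a b -> rderiv G t (g t)) ->
  (forall t, Num.min a b <= t <= Num.max a b -> exists2 d, rderiv H t d & cabs (g t - d) <= M) ->
  cabs (G b - G a - (H b - H a)) <= M * `|b - a|.
Proof.
wlog ab : a b / a <= b => [Hw|].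
  have /orP[ab|ba] := le_total a b; first exact: Hw.
  move=> H1 H2; rewrite -cabsN distrC.
  have -> : - (G b - G a - (H b - H a)) = G a - G b - (H a - H b) by ring.
  by apply: Hw => // t; rewrite minC maxC; [exact: H1|exact: H2].
rewrite min_l// max_r// ger0_norm ?subr_ge0// => H1 H2.
have -> : G b - G a - (H b - H a) = (G b - H b) - (G a - H a) by ring.
apply: (@mean_value_le (fun t => G t - H t)) => // t /[dup] /H1 Gt /H2[d Ht gd].
by exists (g t - d) => //; exact: rderivB.
Qed.

Lemma real_derive_eps (u : R -> R) t (d : R) : is_derive t 1 u d ->
  forall e, 0 < e -> exists2 del : R, 0 < del &
    forall s, `|s| < del -> `|u (t + s) - u t - d * s| <= e * `|s|.
Proof.
move=> [du <-] e e0.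
have : (fun h => h^-1 *: ((u \o shift t) (h *: 1) - u t)) @ 0^' --> 'D_1 u t by exact: du.
move/cvgrPdist_le => /(_ e e0); rewrite /prop_near1 /dnbhs /within /=.
move=> /nbhs_ballP[/= del del0 Hd]; exists del => // s sd.
have [->|s0] := eqVneq s 0; first by rewrite addr0 mulr0 subrr subr0 normr0 mulr0.
have := Hd s; rewrite /ball /= sub0r normrN => /(_ sd s0).
rewrite /GRing.scale /= mulr1 => H.
have -> : u (t + s) - u t - 'D_1 u t * s = - ('D_1 u t - s^-1 * (u (s + t) - u t)) * s.
  by rewrite [s + t]addrC; field.
by rewrite normrM normrN ler_wpM2r.
Qed.

Lemma real_primitive (T : R) (u : R -> R) : continuous u ->
  exists U : R -> R, forall t, `|t| < T -> forall e, 0 < e -> exists2 del : R, 0 < del &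
    forall s, `|s| < del -> `|U (t + s) - U t - u t * s| <= e * `|s|.
Proof.
move=> cu.
pose U x := (\int[lebesgue_measure]_(t in `[(- T)%R, x]) (u t))%R.
exists U => t tT e e0.
have [tT1 tT2] : - T < t /\ t < T by move: tT; rewrite ltr_norml => /andP[].
have iu : lebesgue_measure.-integrable `[(- T)%R, T] (EFin \o u).
  apply: continuous_compact_integrable; first exact: segment_compact.
  by apply: continuous_subspaceT => x; exact: cu.
have [dU dUE] : derivable U t 1 /\ U^`()%classic t = u t.
  exact: continuous_FTC1_closed tT2 iu tT1 (cu t).
clearbody U.
suff D : is_derive t 1 U (u t) by exact: real_derive_eps D e e0.
by apply: DeriveDef; [exact: dU|rewrite -derive1E].
Qed.

Lemma rcont_continuous (u : R -> R) :
  (forall t e, 0 < e -> exists2 del : R, 0 < del & forall s, `|s| < del -> `|u (t + s) - u t| <= e) ->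
  continuous u.
Proof.
move=> H t; apply/cvgrPdist_le => e e0; have [d d0 Hd] := H t e e0.
apply/nbhs_ballP; exists d => //= s; rewrite /ball /= distrC => /Hd.
by rewrite subrKC distrC.
Qed.

Lemma complex_primitive (T : R) g : (forall t, rcont g t) ->
  exists G, forall t, `|t| < T -> rderiv G t (g t).
Proof.
move=> gc.
have [|U HU] := @real_primitive T (fun t => complex.Re (g t)).
  apply: rcont_continuous => t e e0; have [d d0 Hd] := gc t e e0.
  exists d => // s /Hd; apply: le_trans.
  by apply: le_trans (cabs_Re _); rewrite !ReImE.
have [|V HV] := @real_primitive T (fun t => complex.Im (g t)).
  apply: rcont_continuous => t e e0; have [d d0 Hd] := gc t e e0.
  exists d => // s /Hd; apply: le_trans.
  by apply: le_trans (cabs_Im _); rewrite !ReImE.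
exists (fun t => U t +i* V t) => t tT e e0; have e2 : 0 < e / 2 by lra.
have [d1 d10 H1] := HU _ tT _ e2; have [d2 d20 H2] := HV _ tT _ e2.
exists (Num.min d1 d2); first by rewrite lt_min d10 d20.
move=> s; rewrite lt_min => /andP[/H1 {}H1 /H2 {}H2].
rewrite (le_trans (cabs_le_ReIm _))// !ReImE /= !mulr0 subr0 add0r; lra.
Qed.

(** A chosen primitive, meaningful on the interval between -T and T only. With it,
the additivity of the integral [cint] in its bounds is an algebraic identity. *)
Definition primitive_on T g : R -> C :=
  xget (fun=> 0) [set G | forall t, `|t| < T -> rderiv G t (g t)].

Definition cint T g a b := primitive_on T g b - primitive_on T g a.

Lemma primitive_onP T g : (forall t, rcont g t) ->
  forall t, `|t| < T -> rderiv (primitive_on T g) t (g t).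
Proof.
move=> gc; have [G HG] := complex_primitive T gc.
exact: (@xgetPex _ (fun=> 0) [set G | forall t, `|t| < T -> rderiv G t (g t)] (ex_intro _ G HG)).
Qed.

(** All estimates of integrals go through this comparison with an explicit
primitive H of an approximate integrand. *)
Lemma cint_approx T g H a b M : `|a| < T -> `|b| < T -> (forall t, rcont g t) ->
  (forall t, Num.min a b <= t <= Num.max a b -> exists2 d, rderiv H t d & cabs (g t - d) <= M) ->
  cabs (cint T g a b - (H b - H a)) <= M * `|b - a|.
Proof.
move=> aT bT gc gH; apply: primitive_close_le gH => t tab.
apply: primitive_onP => //; move: aT bT tab; rewrite !ltr_norml.
by rewrite ge_min le_max => /andP[? ?] /andP[? ?] /andP[/orP[]? /orP[]?]; lra.
Qed.

End RealVariable.

(** * Goursat's theorem *)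

Section Goursat.
Variables (R : realType) (T : R).
Local Notation C := R[i].
Variable f : C -> C.
Hypothesis fcont : forall z, ccont f z.
Implicit Types (x y a b s t : R).

Let hor y := fun t : R => f (t +i* y).
Let ver x := fun t : R => f (x +i* t).

Lemma horE y t : t +i* y = (0 +i* y) + t%:C * 1.
Proof. by rewrite mulr1; apply: complex_ext; rewrite !ReImE /=; ring. Qed.

Lemma verE x t : x +i* t = (x +i* 0) + t%:C * (0 +i* 1).
Proof. by apply: complex_ext; rewrite !ReImE /=; ring. Qed.

Lemma hor_cont y t : rcont (hor y) t.
Proof.
move=> e e0; have [d d0 Hd] := fcont (t +i* y) e0; exists d => // s sd.
have := Hd s%:C; rewrite cabs_real => /(_ sd); rewrite /hor.
by have -> : t +i* y + s%:C = (t + s) +i* y by apply: complex_ext; rewrite /= ?addr0.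
Qed.

Lemma ver_cont x t : rcont (ver x) t.
Proof.
move=> e e0; have [d d0 Hd] := fcont (x +i* t) e0; exists d => // s sd.
have := Hd (0 +i* s); rewrite {1}/cabs /= expr0n /= add0r sqrtr_sqr => /(_ sd); rewrite /ver.
by have -> : x +i* t + 0 +i* s = x +i* (t + s) by apply: complex_ext; rewrite /= ?addr0.
Qed.

Lemma hor_approx (L l : C -> C) y a b M : `|a| < T -> `|b| < T ->
  (forall t, Num.min a b <= t <= Num.max a b -> cderiv L (t +i* y) (l (t +i* y)) /\
     cabs (f (t +i* y) - l (t +i* y)) <= M) ->
  cabs (cint T (hor y) a b - (L (b +i* y) - L (a +i* y))) <= M * `|b - a|.
Proof.
move=> aT bT H; apply: (@cint_approx _ _ _ (fun t => L (t +i* y))) => //.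
  exact: hor_cont.
move=> t /H[H1 H2]; exists (l (t +i* y) * 1); last by rewrite mulr1.
rewrite (_ : (fun t0 => L (t0 +i* y)) = (fun t0 => L (0 +i* y + t0%:C * 1))).
  by apply: cderiv_line; rewrite -horE.
by apply/funext => u; rewrite horE.
Qed.

Lemma ver_approx (L l : C -> C) x a b M : `|a| < T -> `|b| < T ->
  (forall t, Num.min a b <= t <= Num.max a b -> cderiv L (x +i* t) (l (x +i* t)) /\
     cabs (f (x +i* t) - l (x +i* t)) <= M) ->
  cabs ((0 +i* 1) * cint T (ver x) a b - (L (x +i* b) - L (x +i* a))) <= M * `|b - a|.
Proof.
move=> aT bT H; pose v : C := 0 +i* 1.
have vv : - v * v = 1 by apply: complex_ext; rewrite !ReImE /=; ring.
have -> : v * cint T (ver x) a b - (L (x +i* b) - L (x +i* a)) =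
  v * (cint T (ver x) a b - (- v * L (x +i* b) - - v * L (x +i* a))).
  have vv' : v * v = -1 by rewrite -vv; ring.
  transitivity (v * cint T (ver x) a b + v * v * (L (x +i* b) - L (x +i* a))); last by ring.
  by rewrite vv'; ring.
have v1 : cabs v = 1 by rewrite /cabs /= expr0n /= add0r expr1n sqrtr1.
rewrite cabsM v1 mul1r.
apply: (@cint_approx _ _ _ (fun t => - v * L (x +i* t))) => //.
  exact: ver_cont.
move=> t /H[H1 H2]; exists (l (x +i* t)) => //.
have -> : l (x +i* t) = - v * (l (x +i* t) * v) by rewrite [l _ * v]mulrC mulrA vv mul1r.
apply: rderivZ.
rewrite (_ : (fun t0 => L (x +i* t0)) = (fun t0 => L (x +i* 0 + t0%:C * v))).
  by apply: cderiv_line; rewrite -verE.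
by apply/funext => u; rewrite verE.
Qed.

(** The contour integral over the boundary of the rectangle with corner x + iy and sides a, b of either sign. *)
Definition rect_int x y a b : C :=
  cint T (hor y) x (x + a) + (0 +i* 1) * cint T (ver (x + a)) y (y + b)
  - cint T (hor (y + b)) x (x + a) - (0 +i* 1) * cint T (ver x) y (y + b).

Lemma rect_int_split x y a b : rect_int x y a b =
  rect_int x y (a / 2) (b / 2) + rect_int (x + a / 2) y (a / 2) (b / 2) +
  rect_int x (y + b / 2) (a / 2) (b / 2) + rect_int (x + a / 2) (y + b / 2) (a / 2) (b / 2).
Proof. by rewrite /rect_int -!(addrA _ (_ / 2) (_ / 2)) -!splitr /cint; ring. Qed.

Lemma between01 x a t : Num.min x (x + a) <= t <= Num.max x (x + a) ->
  exists2 u, 0 <= u <= 1 & t = x + a * u.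
Proof.
have [->|a0] := eqVneq a 0.
  rewrite addr0 minxx maxxx => /le_anti <-; exists 0; first by rewrite lexx ler01.
  by rewrite mulr0 addr0.
move=> H; exists ((t - x) / a); last by rewrite mulrC divfK// subrKC.
move: a0 H; rewrite neq_lt => /orP[a0|a0].
  rewrite min_r ?max_l; [|lra|lra] => H.
  by rewrite ler_ndivlMr// ler_ndivrMr// mul0r mul1r; lra.
rewrite min_l ?max_r; [|lra|lra] => H.
by rewrite ler_pdivlMr// ler_pdivrMr// mul0r mul1r; lra.
Qed.

(** Near a point p of differentiability, f is an affine function up to
e * |z - p|. The affine function has a primitive, so its contour integral
vanishes and only the error contributes. *)
Lemma rect_int_local p d e x y a b :
  `|x| < T -> `|x + a| < T -> `|y| < T -> `|y + b| < T ->
  (forall z, cabs (z - p) <= `|a| + `|b| -> cabs (f z - f p - d * (z - p)) <= e * cabs (z - p)) ->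
  0 <= e ->
  (forall u v, 0 <= u <= 1 -> 0 <= v <= 1 ->
     cabs (((x + a * u) +i* (y + b * v)) - p) <= `|a| + `|b|) ->
  cabs (rect_int x y a b) <= 2 * e * (`|a| + `|b|) ^+ 2.
Proof.
move=> xT xaT yT ybT Hf e0 Hin.
pose l z := f p + d * (z - p); pose L z := f p * z + d / 2 * (z - p) ^+ 2.
have Ll z : cderiv L z (l z).
  apply: cderiv_eq (cderivD (cderivZ _ (cderiv_id z)) (cderivZ _
    (@cderivX _ (fun w => w - p) z 1 2 _))).
    by rewrite /l /= expr1; field.
  by apply: cderiv_eq (cderivB (cderiv_id z) (cderiv_cst p z)); rewrite subr0.
have ab0 : 0 <= `|a| + `|b| by rewrite addr_ge0.
have M u v : 0 <= u <= 1 -> 0 <= v <= 1 ->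
    cderiv L ((x + a * u) +i* (y + b * v)) (l ((x + a * u) +i* (y + b * v))) /\
    cabs (f ((x + a * u) +i* (y + b * v)) - l ((x + a * u) +i* (y + b * v))) <= e * (`|a| + `|b|).
  move=> u01 v01; split; first exact: Ll.
  rewrite /l opprD addrA; apply: le_trans (Hf _ (Hin _ _ u01 v01)) _.
  by rewrite ler_wpM2l// Hin.
have z01 : 0 <= (0 : R) <= 1 by rewrite lexx ler01.
have o01 : 0 <= (1 : R) <= 1 by rewrite lexx ler01.
have H1 : cabs (cint T (hor y) x (x + a) - (L ((x + a) +i* y) - L (x +i* y))) <=
    e * (`|a| + `|b|) * `|x + a - x|.
  apply: (@hor_approx L l) => // t /between01[u u01 ->].
  by have := M u 0 u01 z01; rewrite mulr0 addr0.
have H2 : cabs ((0 +i* 1) * cint T (ver (x + a)) y (y + b) -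
    (L ((x + a) +i* (y + b)) - L ((x + a) +i* y))) <= e * (`|a| + `|b|) * `|y + b - y|.
  apply: (@ver_approx L l) => // t /between01[u u01 ->].
  by have := M 1 u o01 u01; rewrite mulr1.
have H3 : cabs (cint T (hor (y + b)) x (x + a) - (L ((x + a) +i* (y + b)) - L (x +i* (y + b))))
    <= e * (`|a| + `|b|) * `|x + a - x|.
  apply: (@hor_approx L l) => // t /between01[u u01 ->].
  by have := M u 1 u01 o01; rewrite mulr1.
have H4 : cabs ((0 +i* 1) * cint T (ver x) y (y + b) -
    (L (x +i* (y + b)) - L (x +i* y))) <= e * (`|a| + `|b|) * `|y + b - y|.
  apply: (@ver_approx L l) => // t /between01[u u01 ->].
  by have := M 0 u z01 u01; rewrite mulr0 addr0.
have Ea : x + a - x = a by ring.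
have Eb : y + b - y = b by ring.
move: H1 H2 H3 H4; rewrite Ea Eb.
set I1 := cint _ _ _ _; set I2 := _ * cint _ _ _ _; set I3 := cint _ _ _ _.
set I4 := _ * cint _ _ _ _ => H1 H2 H3 H4.
have -> : rect_int x y a b =
    (I1 - (L ((x + a) +i* y) - L (x +i* y))) +
    (I2 - (L ((x + a) +i* (y + b)) - L ((x + a) +i* y))) -
    (I3 - (L ((x + a) +i* (y + b)) - L (x +i* (y + b)))) -
    (I4 - (L (x +i* (y + b)) - L (x +i* y))).
  by rewrite /rect_int -/I1 -/I2 -/I3 -/I4; ring.
apply: le_trans (ler_cabsB _ _) _; apply: le_trans (lerD (ler_cabsB _ _) (lexx _)) _.
apply: le_trans (lerD (lerD (ler_cabsD _ _) (lexx _)) (lexx _)) _.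
apply: le_trans (lerD (lerD (lerD H1 H2) H3) H4) _.
by rewrite le_eqVlt; apply/orP; left; apply/eqP; ring.
Qed.

Lemma dist_between x a s u : 0 < s -> x <= a <= x + s -> 0 <= u <= 1 ->
  `|x + s * u - a| <= s.
Proof. by move=> s_gt0 xas u01; rewrite ler_norml; nra. Qed.

(** The corners and sides are A, B times those of a square with parameters in
the unit square, so that subdivision of squares subdivides the rectangle. An
integral of size at most e * s^2 on small pieces adds up to at most e. *)
Lemma goursat x0 y0 A B :
  `|x0| < T -> `|x0 + A| < T -> `|y0| < T -> `|y0 + B| < T ->
  (forall u v, 0 <= u <= 1 -> 0 <= v <= 1 ->
    exists d, cderiv f ((x0 + A * u) +i* (y0 + B * v)) d) ->
  rect_int x0 y0 A B = 0.
Proof.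
move=> H1 H2 H3 H4 fd; apply/eqP; rewrite -cabs_eq0; apply/eqP/le_anti.
rewrite cabs_ge0 andbT; apply/ler_addgt0Pr => e e0; rewrite add0r.
pose K := 2 * (`|A| + `|B|) ^+ 2 + 1.
have K0 : 0 < K by rewrite ltr_wpDl// mulr_ge0// exprn_ge0// addr_ge0.
(* The bound is proportional to the area of the piece, so that it is additive. *)
pose P x y s := 0 <= x -> x + s <= 1 -> 0 <= y -> y + s <= 1 ->
  cabs (rect_int (x0 + A * x) (y0 + B * y) (A * s) (B * s)) <= e * s ^+ 2.
have bnd X D u : `|X| < T -> `|X + D| < T -> 0 <= u <= 1 -> `|X + D * u| < T.
  move=> X1 X2 /andP[u0 u1].
  have -> : X + D * u = (1 - u) * X + u * (X + D) by ring.
  apply: le_lt_trans (ler_normD _ _) _; rewrite !normrM (ger0_norm u0) ger0_norm ?subr_ge0//.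
  have [->|un0] := eqVneq u 0; first by rewrite subr0 mul1r mul0r addr0.
  have up : 0 < u by rewrite lt_def un0.
  have -> : T = (1 - u) * T + u * T by ring.
  by apply: ler_ltD; [rewrite ler_wpM2l ?subr_ge0// ltW|rewrite ltr_pM2l].
suff : P 0 0 1 by rewrite /P !mulr0 !mulr1 expr1n mulr1 !addr0 !add0r; apply.
apply: square_induction => //.
  move=> x y s s0 P1 P2 P3 P4 x_0 x1 y_0 y1; rewrite rect_int_split.
  have /= Q1 := P1 x_0 ltac:(lra) y_0 ltac:(lra).
  have /= Q2 := P2 ltac:(lra) ltac:(lra) y_0 ltac:(lra).
  have /= Q3 := P3 x_0 ltac:(lra) ltac:(lra) ltac:(lra).
  have /= Q4 := P4 ltac:(lra) ltac:(lra) ltac:(lra) ltac:(lra).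
  have EX : x0 + A * (x + s / 2) = x0 + A * x + A * s / 2 by ring.
  have EY : y0 + B * (y + s / 2) = y0 + B * y + B * s / 2 by ring.
  rewrite ?EX ?EY !(mulrA A) !(mulrA B) in Q1 Q2 Q3 Q4.
  apply: le_trans (ler_cabsD _ _) _; apply: le_trans (lerD (ler_cabsD _ _) (lexx _)) _.
  apply: le_trans (lerD (lerD (ler_cabsD _ _) (lexx _)) (lexx _)) _.
  have -> : e * s ^+ 2 = e * (s / 2) ^+ 2 + e * (s / 2) ^+ 2 + e * (s / 2) ^+ 2 + e * (s / 2) ^+ 2 by field.
  by rewrite !lerD.
move=> a b; rewrite !add0r => a01 b01.
have [d Hd] := fd a b a01 b01.
have eK : 0 < e / K by rewrite divr_gt0.
have [del del0 {}Hd] := Hd _ eK.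
have AB0 : 0 <= `|A| + `|B| by rewrite addr_ge0.
exists (del / (`|A| + `|B| + 1)); first by rewrite divr_gt0// ltr_wpDl.
move=> x y s /andP[s0]; rewrite ltr_pdivlMr ?ltr_wpDl// => sdel xas ybs x_0 x1 y_0 y1.
have -> : e * s ^+ 2 = e / K * K * s ^+ 2 by rewrite divfK// gt_eqF.
have ss : `|s| = s by rewrite gtr0_norm.
have := @rect_int_local ((x0 + A * a) +i* (y0 + B * b)) d (e / K)
  (x0 + A * x) (y0 + B * y) (A * s) (B * s).
rewrite !normrM ss -mulrDl => H; apply: (le_trans (H _ _ _ _ _ _ _)).
- by apply: bnd => //; lra.
- by rewrite -addrA -mulrDr; apply: bnd => //; lra.
- by apply: bnd => //; lra.
- by rewrite -addrA -mulrDr; apply: bnd => //; lra.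
- move=> z Hz; have := Hd (z - (x0 + A * a) +i* (y0 + B * b)); rewrite subrKC; apply.
  apply: le_lt_trans Hz _; nra.
- exact: ltW.
- move=> u v u01 v01; apply: le_trans (cabs_le_ReIm _) _; rewrite !ReImE /=.
  have -> : x0 + A * x + A * s * u - (x0 + A * a) = A * (x + s * u - a) by ring.
  have -> : y0 + B * y + B * s * v - (y0 + B * b) = B * (y + s * v - b) by ring.
  rewrite !normrM mulrDl; apply: lerD; rewrite ler_wpM2l//; exact: dist_between.
- have -> : 2 * (e / K) * ((`|A| + `|B|) * s) ^+ 2 = e / K * (2 * (`|A| + `|B|) ^+ 2) * s ^+ 2.
    by rewrite exprMn; ring.
  by rewrite ler_wpM2r ?sqr_ge0// ler_wpM2l ?(ltW eK)// lerDl.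
Qed.

End Goursat.

(** * Primitives of holomorphic functions *)

Section Primitive.
Variable R : realType.
Local Notation C := R[i].

Lemma cabs_mono (u v u' v' : R) : `|u| <= `|u'| -> `|v| <= `|v'| ->
  cabs (u +i* v) <= cabs (u' +i* v').
Proof.
move=> uu vv; rewrite /cabs /= ler_wsqrtr// -(real_normK (num_real u)) -(real_normK (num_real v)).
rewrite -(real_normK (num_real u')) -(real_normK (num_real v')).
by rewrite lerD// lerXn2r// nnegrE.
Qed.

(** The integral along the path 0, Re z, z. By Goursat's theorem, moving z by
a + ib changes it by the integral along an L-shaped path from z to z + a + ib. The
rectangle to which Goursat's theorem applies has its corners on the real axis
and at height Im z, hence lies in the disk. *)
Lemma primitive_continuous_disk (f : C -> C) (r : R) : (forall z, ccont f z) ->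
  (forall z, cabs z < r -> exists d, cderiv f z d) ->
  exists F, forall z, cabs z < r -> cderiv F z (f z).
Proof.
move=> fc fd; pose T : R := `|r| + 1.
exists (fun z => cint T (fun t => f (t +i* 0)) 0 (complex.Re z) +
  (0 +i* 1) * cint T (fun t => f (complex.Re z +i* t)) 0 (complex.Im z)).
move=> z zr e e0; have e4 : 0 < e / 2 by lra.
have rT : r < T by rewrite /T; have := ler_norm r; lra.
have T0 : 0 < T by rewrite /T ltr_wpDl.
have [d d0 Hd] := fc z _ e4.
exists (Num.min d (r - cabs z)) => [|h]; first by rewrite lt_min d0 subr_gt0.
rewrite lt_min => /andP[hd hr].
case: z zr Hd hr => x y zr Hd hr; case: h hd hr => a b hd hr /=.
have aab : cabs (a +i* 0) <= cabs (a +i* b) by rewrite cabs_mono// normr0.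
have bab : cabs (0 +i* b) <= cabs (a +i* b) by rewrite cabs_mono// normr0.
have zhr : cabs ((x + a) +i* y) < r.
  have -> : (x + a) +i* y = x +i* y + a +i* 0 by apply: complex_ext; rewrite /= ?addr0.
  apply: le_lt_trans (ler_cabsD _ _) _; lra.
have xT : `|x| < T by have : `|x| <= cabs (x +i* y) := cabs_Re (x +i* y); lra.
have yT : `|y| < T by have : `|y| <= cabs (x +i* y) := cabs_Im (x +i* y); lra.
have xaT : `|x + a| < T by have : `|x + a| <= cabs ((x + a) +i* y) := cabs_Re ((x + a) +i* y); lra.
have zhr2 : cabs ((x + a) +i* (y + b)) < r.
  have -> : (x + a) +i* (y + b) = x +i* y + a +i* b by [].
  apply: le_lt_trans (ler_cabsD _ _) _; lra.
have ybT : `|y + b| < T by have : `|y + b| <= cabs ((x + a) +i* (y + b)) := cabs_Im ((x + a) +i* (y + b)); lra.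
have N0T : `|(0 : R)| < T by rewrite normr0.
have : rect_int T f x 0 a y = 0.
  apply: goursat => //; rewrite ?add0r// => u v /andP[u0 u1] /andP[v0 v1].
  apply: fd; rewrite add0r; apply: le_lt_trans (_ : cabs ((x + a * u) +i* y) < r).
    by apply: cabs_mono => //; rewrite normrM (ger0_norm v0) ler_piMr.
  have -> : (x + a * u) +i* y = x +i* y + (a * u) +i* 0 by apply: complex_ext; rewrite /= ?addr0.
  apply: le_lt_trans (ler_cabsD _ _) _.
  have : cabs ((a * u) +i* 0) <= cabs (a +i* b).
    apply: cabs_mono; last by rewrite normr0.
    by rewrite normrM (ger0_norm u0) ler_piMr.
  lra.
rewrite /rect_int add0r => Hrect.
have Hh : cabs (cint T (fun t => f (t +i* y)) x (x + a) - (f (x +i* y) * ((x + a) +i* y) - f (x +i* y) * (x +i* y))) <= e / 2 * `|x + a - x|.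
  apply: (@hor_approx _ T f fc (fun w => f (x +i* y) * w) (fun=> f (x +i* y))) => // t Ht; split.
    by apply: cderiv_eq (cderivZ _ (cderiv_id _)); rewrite mulr1.
  have [u /andP[u0 u1] ->] := between01 Ht.
  have -> : (x + a * u) +i* y = x +i* y + (a * u) +i* 0 by apply: complex_ext; rewrite /= ?addr0.
  apply: Hd; apply: le_lt_trans hd; apply: cabs_mono; last by rewrite normr0.
  by rewrite normrM (ger0_norm u0) ler_piMr.
have Hv : cabs ((0 +i* 1) * cint T (fun t => f ((x + a) +i* t)) y (y + b) - (f (x +i* y) * ((x + a) +i* (y + b)) - f (x +i* y) * ((x + a) +i* y))) <= e / 2 * `|y + b - y|.
  apply: (@ver_approx _ T f fc (fun w => f (x +i* y) * w) (fun=> f (x +i* y))) => // t Ht; split.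
    by apply: cderiv_eq (cderivZ _ (cderiv_id _)); rewrite mulr1.
  have [u /andP[u0 u1] ->] := between01 Ht.
  have -> : (x + a) +i* (y + b * u) = x +i* y + a +i* (b * u) by [].
  apply: Hd; apply: le_lt_trans hd; apply: cabs_mono => //.
  by rewrite normrM (ger0_norm u0) ler_piMr.
have Ea : x + a - x = a by ring.
have Eb : y + b - y = b by ring.
rewrite Ea in Hh; rewrite Eb in Hv.
have : e / 2 * `|a| + e / 2 * `|b| <= e * cabs (a +i* b).
  have : `|a| <= cabs (a +i* b) := cabs_Re (a +i* b).
  have : `|b| <= cabs (a +i* b) := cabs_Im (a +i* b).
  nra.
apply: le_trans; apply: le_trans _ (lerD Hh Hv); apply: le_trans _ (ler_cabsD _ _).
rewrite le_eqVlt; apply/orP; left; apply/eqP; congr cabs.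
rewrite /= -[RHS]addr0 -[X in _ = _ + X]Hrect.
have -> : (x + a) +i* (y + b) = x +i* y + a +i* b by [].
rewrite /cint; ring.
Qed.

Definition holo (r : R) (f : C -> C) := forall z, cabs z < r -> exists d, cderiv f z d.

(** Composition with the retraction onto a closed disk makes a function
continuous on the whole plane without changing it inside. *)
Lemma retract_cont (r : R) z : 0 < r ->
  ccont (fun z : C => z * (r / Num.max r (cabs z))%:C) z.
Proof.
move=> r0 e e0; have e2 : 0 < e / 2 by lra.
apply: near0W (near0_lt e2) => h he.
pose m := Num.max r (cabs z); pose n := Num.max r (cabs (z + h)).
have m0 : 0 < m by rewrite lt_max r0.
have n0 : 0 < n by rewrite lt_max r0.
have rm : r <= m by rewrite le_max lexx.
have rn : r <= n by rewrite le_max lexx.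
have zm : cabs z <= m by rewrite le_max lexx orbT.
have mn : `|m - n| <= cabs h.
  have := lerB_cabsD z h; have := ler_cabsD z h; have := cabs_ge0 h.
  rewrite ler_norml /m /n; case: (leP r (cabs z)); case: (leP r (cabs (z + h))) => *; lra.
rewrite -/m -/n.
have -> : (z + h) * (r / n)%:C - z * (r / m)%:C = h * (r / n)%:C + z * (r * (m - n) / (m * n))%:C.
  have -> : r * (m - n) / (m * n) = r / n - r / m by field; rewrite !gt_eqF.
  by rewrite rmorphB /=; ring.
apply: le_trans (ler_cabsD _ _) _; rewrite !cabsM !cabs_real.
have h1 : cabs h * `|r / n| <= cabs h.
  rewrite ler_piMr ?cabs_ge0// ger0_norm; last by rewrite divr_ge0// ltW.
  by rewrite ler_pdivrMr// mul1r.
have h2 : cabs z * `|r * (m - n) / (m * n)| <= cabs h.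
  rewrite normrM normrM (gtr0_norm r0) (@gtr0_norm _ (m * n)^-1) ?invr_gt0 ?mulr_gt0//.
  rewrite !mulrA ler_pdivrMr ?mulr_gt0//.
  have q : cabs z * r <= m * n by apply: ler_pM; rewrite ?cabs_ge0// ltW.
  by rewrite [leRHS]mulrC; apply: ler_pM; rewrite ?mulr_ge0 ?cabs_ge0 ?(ltW r0).
lra.
Qed.

Lemma near0_disk (r : R) z : cabs z < r -> near0 (fun h : C => cabs (z + h) < r).
Proof.
move=> zr; exists (r - cabs z); first by rewrite subr_gt0.
move=> h Hh; apply: le_lt_trans (ler_cabsD _ _) _; lra.
Qed.

Lemma segment_disk (r : R) (z w : C) t : cabs z < r -> cabs w < r -> 0 <= t <= 1 ->
  cabs (z + t%:C * (w - z)) < r.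
Proof.
move=> zr wr /andP[t0 t1].
have -> : z + t%:C * (w - z) = (1 - t)%:C * z + t%:C * w by rewrite rmorphB rmorph1 /=; ring.
apply: le_lt_trans (ler_cabsD _ _) _; rewrite !cabsM !cabs_real ger0_norm ?subr_ge0// ger0_norm//.
have : (1 - t) * cabs z + t * cabs w <= (1 - t) * Num.max (cabs z) (cabs w) + t * Num.max (cabs z) (cabs w).
  by apply: lerD; rewrite ler_wpM2l ?subr_ge0// le_max lexx ?orbT.
move/le_lt_trans; apply; rewrite -mulrDl subrK mul1r gt_max zr wr //.
Qed.

Lemma complex_mvt (F : C -> C) (z w c : C) (M : R) :
  (forall t, 0 <= t <= 1 -> exists2 d, cderiv F (z + t%:C * (w - z)) d & cabs (d - c) <= M) ->
  cabs (F w - F z - c * (w - z)) <= M * cabs (w - z).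
Proof.
move=> H.
have := @mean_value_le R (fun t => F (z + t%:C * (w - z)) - c * (z + t%:C * (w - z))) 0 1 (M * cabs (w - z)) ler01.
rewrite mul1r mul0r addr0 subrKC subr0 mulr1.
have -> : F w - c * w - (F z - c * z) = F w - F z - c * (w - z) by ring.
apply=> t /H[d Fd dc]; exists (d * (w - z) - c * (w - z)).
  apply: rderivB; first exact: cderiv_line.
  apply: (@cderiv_line _ (fun v => c * v)).
  by apply: cderiv_eq (cderivZ _ (cderiv_id _)); rewrite mulr1.
by rewrite -mulrBl cabsM ler_wpM2r ?cabs_ge0.
Qed.

Lemma complex_mvt0 (F : C -> C) (z w : C) (M : R) :
  (forall t, 0 <= t <= 1 -> exists2 d, cderiv F (z + t%:C * (w - z)) d & cabs d <= M) ->
  cabs (F w - F z) <= M * cabs (w - z).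
Proof.
move=> H; have := @complex_mvt F z w 0 M; rewrite mul0r subr0; apply=> t /H[d Fd dM].
by exists d; rewrite ?subr0.
Qed.

Lemma cderiv0_cst (F : C -> C) r : (forall z, cabs z < r -> cderiv F z 0) ->
  forall z w, cabs z < r -> cabs w < r -> F w = F z.
Proof.
move=> F0 z w zr wr; apply/eqP; rewrite -subr_eq0 -cabs_eq0; apply/eqP/le_anti.
rewrite cabs_ge0 andbT; have := @complex_mvt0 F z w 0; rewrite mul0r; apply=> t t01.
by exists 0; rewrite ?cabs0//; apply: F0; exact: segment_disk.
Qed.

Lemma holo_primitive_lt (r' r : R) f : 0 < r' -> r' < r -> holo r f ->
  exists F, forall z, cabs z < r' -> cderiv F z (f z).
Proof.
move=> r0 rr fr; pose ret (z : C) := z * (r' / Num.max r' (cabs z))%:C.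
have retE z : cabs z <= r' -> ret z = z.
  by move=> zr; rewrite /ret max_l// divff ?gt_eqF// mulr1.
have ret_lt z : cabs (ret z) < r.
  apply: le_lt_trans rr; rewrite /ret cabsM cabs_real.
  have m0 : 0 < Num.max r' (cabs z) by rewrite lt_max r0.
  rewrite ger0_norm; last by rewrite divr_ge0// ltW.
  by rewrite mulrA ler_pdivrMr// mulrC ler_pM2l// le_max lexx orbT.
have fret z : cabs z < r' -> near0 (fun h => f (z + h) = (f \o ret) (z + h)).
  by move=> /near0_disk; apply: near0W => h /ltW /retE /= ->.
have [|z zr|F HF] := @primitive_continuous_disk (f \o ret) r'.
- move=> z; apply: ccont_comp; first exact: retract_cont.
  by have [d /cderiv_cont] := fr _ (ret_lt z).
- have [d Hd] := fr _ (lt_trans zr rr); exists d.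
  exact: cderiv_near (fret _ zr) Hd.
exists F => z zr; apply: cderiv_eq (HF z zr) => /=; rewrite retE// ltW//.
Qed.

(** Primitives on smaller concentric disks agree after subtraction of their
value at 0, so they glue. *)
Lemma holo_primitive (r : R) f : 0 < r -> holo r f ->
  exists F, forall z, cabs z < r -> cderiv F z (f z).
Proof.
move=> r0 fr.
have ex (s : R) : exists F, 0 < s < r -> forall z, cabs z < s -> cderiv F z (f z).
  have [/andP[s0 sr]|ns] := boolP (0 < s < r); last by exists id.
  by have [F HF] := holo_primitive_lt s0 sr fr; exists F.
have [F HF] := choice ex.
pose rho (z : C) := (cabs z + r) / 2.
have rhoP z : cabs z < r -> 0 < rho z < r /\ cabs z < rho z.
  by move=> zr; rewrite /rho; have := cabs_ge0 z; split; lra.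
have uniq s t z : 0 < s < r -> 0 < t < r -> cabs z < s -> cabs z < t ->
    F s z - F s 0 = F t z - F t 0.
  move=> sr tr zs zt; pose m := Num.min s t.
  have zm : cabs z < m by rewrite lt_min zs zt.
  have m0 : cabs (0 : C) < m by rewrite cabs0 lt_min; case/andP: sr => ->; case/andP: tr => ->.
  have E : F s z - F t z = F s 0 - F t 0.
    apply: (@cderiv0_cst (fun z => F s z - F t z) m) => // w.
    rewrite lt_min => /andP[ws wt].
    by apply: cderiv_eq (cderivB (HF s sr w ws) (HF t tr w wt)); rewrite subrr.
  have -> : F s z - F s 0 = F t z - F t 0 + ((F s z - F t z) - (F s 0 - F t 0)) by ring.
  by rewrite E subrr addr0.
exists (fun z => F (rho z) z - F (rho z) 0) => z zr.
have [rz zrho] := rhoP _ zr.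
have D : cderiv (fun w => F (rho z) w - F (rho z) 0) z (f z).
  by apply: cderiv_eq (cderivB (HF _ rz _ zrho) (cderiv_cst _ _)); rewrite subr0.
apply: cderiv_near D; apply: near0W (near0I (near0_disk zr) (near0_disk zrho)) => h [hr hrho].
have [rh hh] := rhoP _ hr; exact: uniq.
Qed.

End Primitive.

(** * Maximum principle, Schwarz lemma and Cauchy's estimate *)

Section MaximumPrinciple.
Variable R : realType.
Local Notation C := R[i].
Implicit Types (f g F : C -> C) (z w h a d : C) (r e M : R).

(** Two derivatives at z are what the maximum principle needs. Difference
quotients of primitives have them, although a holomorphic function is not yet
known to. *)
Definition twice_at f z := exists2 f1, near0 (fun h => cderiv f (z + h) (f1 (z + h))) &
  exists d, cderiv f1 z d.

Lemma near0_at0 (P : C -> Prop) : near0 P -> P 0.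
Proof. by move=> [d d0]; apply; rewrite cabs0. Qed.

Lemma twice_at_cderiv f z : twice_at f z -> exists d, cderiv f z d.
Proof. by move=> [f1 /near0_at0]; rewrite addr0; exists (f1 z). Qed.

Lemma twice_atM f g z : twice_at f z -> twice_at g z -> twice_at (fun x => f x * g x) z.
Proof.
move=> [f1 Hf [a fa]] [g1 Hg [b gb]].
exists (fun x => f1 x * g x + f x * g1 x).
  by apply: near0W (near0I Hf Hg) => h [? ?]; exact: cderivM.
have := near0_at0 Hf; have := near0_at0 Hg; rewrite addr0 => gz fz.
by eexists; apply: cderivD; apply: cderivM; eassumption.
Qed.

Lemma twice_atD f g z : twice_at f z -> twice_at g z -> twice_at (fun x => f x + g x) z.
Proof.
move=> [f1 Hf [a fa]] [g1 Hg [b gb]].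
exists (fun x => f1 x + g1 x).
  by apply: near0W (near0I Hf Hg) => h [? ?]; exact: cderivD.
by eexists; apply: cderivD; eassumption.
Qed.

Lemma twice_at_cst (c : C) z : twice_at (fun=> c) z.
Proof.
exists (fun=> 0); first by exists 1 => // h _; exact: cderiv_cst.
by exists 0; exact: cderiv_cst.
Qed.

Lemma twice_at_id z : twice_at id z.
Proof.
exists (fun=> 1); first by exists 1 => // h _; exact: cderiv_id.
by exists 0; exact: cderiv_cst.
Qed.

Lemma near0_neq0 f z : ccont f z -> f z != 0 -> near0 (fun h => f (z + h) != 0).
Proof.
move=> fz fz0; have e0 : 0 < cabs (f z) / 2 by rewrite divr_gt0// cabs_gt0.
apply: near0W (fz _ e0) => h; apply: contraTneq => ->.
by rewrite sub0r cabsN -ltNge; lra.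
Qed.

Lemma twice_atV f z : f z != 0 -> twice_at f z -> twice_at (fun x => (f x)^-1) z.
Proof.
move=> fz0 [f1 Hf [a fa]].
have fd : cderiv f z (f1 z) by have := near0_at0 Hf; rewrite addr0.
exists (fun x => - f1 x / f x ^+ 2).
  by apply: near0W (near0I Hf (near0_neq0 (cderiv_cont fd) fz0)) => h [? ?]; exact: cderivV.
eexists; apply: cderivM; first exact: cderivN fa.
apply: cderivV; first by rewrite expf_neq0.
exact: cderivX fd.
Qed.

Lemma twice_atX f z n : twice_at f z -> twice_at (fun x => f x ^+ n) z.
Proof.
move=> fz; elim: n => [|n IH]; first exact: twice_at_cst.
rewrite (_ : (fun x => f x ^+ n.+1) = (fun x => f x * f x ^+ n)); first exact: twice_atM.
by apply/funext => x; rewrite exprS.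
Qed.

Lemma taylor2 f z : twice_at f z -> exists d a, forall e, 0 < e ->
  near0 (fun h => cabs (f (z + h) - f z - d * h - a * h ^+ 2) <= e * cabs h ^+ 2).
Proof.
move=> [f1 Hf [b f1b]]; exists (f1 z), (b / 2) => e e0.
have [d d0 H] := near0I Hf (f1b e e0); exists d => // h hd.
have := @complex_mvt R (fun w => f w - b / 2 * (w - z) ^+ 2) z (z + h) (f1 z) (e * cabs h).
rewrite [z + h - z]addrAC subrr add0r expr0n /= mulr0 subr0.
have -> : f (z + h) - f z - f1 z * h - b / 2 * h ^+ 2 = f (z + h) - b / 2 * h ^+ 2 - f z - f1 z * h by ring.
have -> : e * cabs h ^+ 2 = e * cabs h * cabs h by rewrite expr2 mulrA.
apply => t /andP[t0 t1].
have th : cabs (t%:C * h) < d.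
  by apply: le_lt_trans hd; rewrite cabsM cabs_real ger0_norm// ler_piMl ?cabs_ge0.
have [fd f1d] := H _ th.
exists (f1 (z + t%:C * h) - b * (t%:C * h)).
  apply: cderivB fd _.
  apply: cderiv_eq (cderivZ _ (cderivX 2 (cderivB (cderiv_id _) (cderiv_cst z _)))).
  by rewrite expr1; field.
have -> : f1 (z + t%:C * h) - b * (t%:C * h) - f1 z = f1 (z + t%:C * h) - f1 z - b * (t%:C * h) by ring.
apply: le_trans f1d _; rewrite ler_pM2l// cabsM cabs_real ger0_norm//.
by rewrite ler_piMl ?cabs_ge0.
Qed.

Lemma parallelogram z w :
  cabs (z + w) ^+ 2 + cabs (z - w) ^+ 2 = 2 * (cabs z ^+ 2 + cabs w ^+ 2).
Proof. by rewrite !cabs_sqr !ReImE; ring. Qed.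

(** Over the four directions t, it, -t, -it the first and second order terms of
a quadratic polynomial cancel in the mean of its squared modulus, which is thus
at least |a|^2 + |d|^2 t^2. *)
Lemma four_point_sum (a d b : C) (t : R) :
  cabs (a + d * t%:C + b * t%:C ^+ 2) ^+ 2 + cabs (a + d * (0 +i* t) + b * (0 +i* t) ^+ 2) ^+ 2
  + (cabs (a + d * - t%:C + b * (- t%:C) ^+ 2) ^+ 2
  + cabs (a + d * - (0 +i* t) + b * (- (0 +i* t)) ^+ 2) ^+ 2)
  = 4 * (cabs a ^+ 2 + cabs d ^+ 2 * t ^+ 2 + cabs b ^+ 2 * t ^+ 4).
Proof.
have sqi : (0 +i* t) ^+ 2 = - t%:C ^+ 2 by apply: complex_ext; rewrite !expr2 !ReImE /=; ring.
have ct : cabs (t%:C : C) ^+ 2 = t ^+ 2 by rewrite cabs_sqr /= expr0n addr0.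
have ci : cabs (0 +i* t) ^+ 2 = t ^+ 2 by rewrite cabs_sqr /= expr0n add0r.
pose A := b * t%:C ^+ 2; pose B := d * t%:C; pose D := d * (0 +i* t).
have -> : a + d * t%:C + b * t%:C ^+ 2 = (a + A) + B by rewrite /A /B; ring.
have -> : a + d * - t%:C + b * (- t%:C) ^+ 2 = (a + A) - B by rewrite /A /B; ring.
have -> : a + d * (0 +i* t) + b * (0 +i* t) ^+ 2 = (a - A) + D by rewrite sqi /A /D; ring.
have -> : a + d * - (0 +i* t) + b * (- (0 +i* t)) ^+ 2 = (a - A) - D by rewrite sqrrN sqi /A /D; ring.
have P1 := parallelogram (a + A) B; have P2 := parallelogram (a - A) D.
have P3 := parallelogram a A.
have nA : cabs A ^+ 2 = cabs b ^+ 2 * t ^+ 4.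
  by rewrite /A cabsM cabsX exprMn ct -exprM.
have nB : cabs B ^+ 2 = cabs d ^+ 2 * t ^+ 2 by rewrite /B cabsM exprMn ct.
have nD : cabs D ^+ 2 = cabs d ^+ 2 * t ^+ 2 by rewrite /D cabsM exprMn ci.
rewrite nA in P3; rewrite nB in P1; rewrite nD in P2; lra.
Qed.

(** A strict form of subharmonicity: the mean of |f|^2 over four directions does
not drop to second order, and that of e |z|^2 increases. *)
Lemma twice_at_not_max f z e : 0 < e -> twice_at f z ->
  ~ near0 (fun h => cabs (f (z + h)) ^+ 2 + e * cabs (z + h) ^+ 2 <= cabs (f z) ^+ 2 + e * cabs z ^+ 2).
Proof.
move=> e0 /taylor2[d [b Hf]] Hmax.
pose B := cabs (f z) + cabs d + cabs b + 1.
have B0 : 0 < B by rewrite /B; have := cabs_ge0 (f z); have := cabs_ge0 d; have := cabs_ge0 b; lra.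
have eta0 : 0 < e / (4 * B) by rewrite divr_gt0// mulr_gt0.
(* eta is chosen so that the Taylor error, 2 B eta t^2, costs half of the gain e t^2. *)
have [del del0 H] := near0I (near0I (Hf _ eta0) Hmax) (near0_lt (@ltr01 R)).
pose t := Num.min (del / 2) (1 / 2).
have t0 : 0 < t by rewrite lt_min; apply/andP; split; lra.
have td : t < del.
  by rewrite /t; case: (leP (del / 2) (1 / 2)) => *; lra.
have ht h : cabs h = t -> cabs (f z + d * h + b * h ^+ 2) ^+ 2 - e / 2 * t ^+ 2 + e * cabs (z + h) ^+ 2
    <= cabs (f z) ^+ 2 + e * cabs z ^+ 2.
  move=> hE; have [|[Hh1 Hh2] Hh3] := H h; first by rewrite hE.
  apply: le_trans Hh2; rewrite lerD2r.
  set P := f z + d * h + b * h ^+ 2.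
  have PB : cabs P <= B.
    rewrite /P; apply: le_trans (ler_cabsD _ _) _; apply: le_trans (lerD (ler_cabsD _ _) (lexx _)) _.
    rewrite !cabsM /B.
    have h0 := cabs_ge0 h; have h1 := ltW Hh3.
    have := ler_piMr (cabs_ge0 d) h1; have := ler_piMr (cabs_ge0 b) (mulr_ile1 h0 h0 h1 h1); lra.
  have rE : cabs (f (z + h) - P) <= e / (4 * B) * t ^+ 2.
    by rewrite -hE; apply: le_trans Hh1; rewrite /P !opprD !addrA.
  have : cabs P <= cabs (f (z + h)) + e / (4 * B) * t ^+ 2.
    have := lerB_cabs P (f (z + h)); rewrite cabs_distC; lra.
  set eta := e / (4 * B) * t ^+ 2 => Pf.
  have eta1 : 2 * B * eta = e / 2 * t ^+ 2.
    by rewrite /eta; field; rewrite gt_eqF.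
  have etap : 0 <= eta by rewrite /eta mulr_ge0 ?sqr_ge0// ltW.
  have P0 := cabs_ge0 P; have F0 := cabs_ge0 (f (z + h)).
  rewrite -eta1 lerBlDr -lerBlDl subr_sqr.
  have [PF|/ltW FP] := leP (cabs P) (cabs (f (z + h))).
    apply: (@le_trans _ _ 0); first by apply: mulr_le0_ge0; [rewrite subr_le0|exact: addr_ge0].
    by apply: mulr_ge0 => //; apply: mulr_ge0 => //; exact: ltW.
  rewrite [leLHS]mulrC; apply: ler_pM.
  - exact: addr_ge0.
  - by rewrite subr_ge0.
  - by have := lerD PB (le_trans FP PB); rewrite mulr_natl mulr2n.
  - by rewrite lerBlDl.
have t1 : cabs (t%:C : C) = t by rewrite cabs_real gtr0_norm.
have t2 : cabs (0 +i* t) = t by rewrite /cabs /= expr0n /= add0r sqrtr_sqr gtr0_norm.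
have := ht _ t1; have := ht _ t2.
have := ht (- t%:C); rewrite cabsN => /(_ t1).
have := ht (- (0 +i* t)); rewrite cabsN => /(_ t2).
have := four_point_sum (f z) d b t; have := four_point_sum z 1 0 t.
rewrite !mul1r !mul0r !addr0 cabs1 cabs0 expr1n expr0n /= mul0r addr0 mul1r.
set u1 := cabs (_ + _) ^+ 2; set u2 := cabs (_ + _) ^+ 2; set u3 := cabs (_ + _) ^+ 2.
set u4 := cabs (_ + _) ^+ 2.
set v1 := cabs (_ + _) ^+ 2; set v2 := cabs (_ + _) ^+ 2; set v3 := cabs (_ + _) ^+ 2.
set v4 := cabs (_ + _) ^+ 2.
move=> U V W1 W2 W3 W4.
have : 0 < e * t ^+ 2 by rewrite mulr_gt0// exprn_gt0.
have : 0 <= cabs d ^+ 2 * t ^+ 2 by rewrite mulr_ge0 ?sqr_ge0.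
have : 0 <= cabs b ^+ 2 * t ^+ 4 by rewrite mulr_ge0 ?sqr_ge0// exprn_ge0// ltW.
have : e * (u1 + u2 + (u3 + u4)) = e * (4 * (cabs z ^+ 2 + t ^+ 2)) by rewrite U.
lra.
Qed.

Lemma usc_sqr (u : C -> R) z : (forall w, 0 <= u w) ->
  (forall e, 0 < e -> near0 (fun h => u (z + h) <= u z + e)) ->
  forall e, 0 < e -> near0 (fun h => u (z + h) ^+ 2 <= u z ^+ 2 + e).
Proof.
move=> u0 uz e e0.
have c0 : 0 < Num.min 1 (e / (2 * u z + 1)).
  by rewrite lt_min ltr01 divr_gt0//; have := u0 z; lra.
apply: near0W (uz _ c0) => h; have := u0 (z + h); have z0 := u0 z.
move: c0; set c := Num.min _ _ => c0 h0 Hh.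
have c1 : c <= 1 by rewrite ge_min lexx.
have c2 : c * (2 * u z + 1) <= e.
  by rewrite -ler_pdivlMr ?ge_min ?lexx ?orbT//; lra.
nra.
Qed.

(** B plays the role of the boundary of K. The function |f|^2 + e |z|^2 attains
its maximum on K, and not at an interior point; then e tends to 0. *)
Lemma maximum_principle (K B : C -> Prop) f M : cclosed K -> cbounded K ->
  (forall z, K z -> ccont f z) ->
  (forall z, K z -> B z \/ near0 (fun h => K (z + h)) /\ twice_at f z) ->
  (forall z, K z -> B z -> cabs (f z) <= M) -> 0 <= M ->
  forall z, K z -> cabs (f z) <= M.
Proof.
move=> Kc Kb fc KB BM M0 z Kz; have [L KL] := Kb.
rewrite -(@ler_pXn2r _ 2)// ?nnegrE ?cabs_ge0//.
apply/ler_addgt0Pr => e e0.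
have L0 : 0 <= L by apply: le_trans (KL z Kz); exact: cabs_ge0.
have e1 : 0 < e / (L ^+ 2 + 1) by rewrite divr_gt0// ltr_wpDl// sqr_ge0.
set eps := e / (L ^+ 2 + 1) in e1.
have [||w Kw wmax] := @compact_max R K (fun w => cabs (f w) ^+ 2 + eps * cabs w ^+ 2) Kc Kb.
- by exists z.
- move=> w Kw c c0; have c2 : 0 < c / 2 by lra.
  have c3 : 0 < c / 2 / eps by rewrite divr_gt0.
  have A := usc_sqr (fun v => cabs_ge0 (f v)) (ccont_cabs (fc w Kw)) c2.
  have D := usc_sqr (@cabs_ge0 R) (ccont_cabs (@ccont_id R w)) c3.
  apply: near0W (near0I A D) => h [H1 H2].
  have : eps * cabs (w + h) ^+ 2 <= eps * (cabs w ^+ 2 + c / 2 / eps) by rewrite ler_pM2l.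
  by rewrite mulrDr [eps * (_ / eps)]mulrC divfK ?gt_eqF//; lra.
have [Bw|[Kint ftw]] := KB w Kw; last first.
  case: (twice_at_not_max e1 ftw); apply: near0W Kint => h; exact: wmax.
have := wmax z Kz; have := BM w Kw Bw; have := KL w Kw; have := cabs_ge0 w.
have := cabs_ge0 (f w) => fw0 w0 wL fwM zw.
have : eps * cabs w ^+ 2 <= e.
  apply: (@le_trans _ _ (eps * L ^+ 2)); first by rewrite ler_wpM2l ?(ltW e1)// lerXn2r// nnegrE.
  by rewrite /eps mulrAC ler_pdivrMr ?ltr_wpDl ?sqr_ge0// ler_wpM2l ?(ltW e0)// lerDl.
have : 0 <= eps * cabs z ^+ 2 by rewrite mulr_ge0 ?sqr_ge0// ltW.
have : cabs (f w) ^+ 2 <= M ^+ 2 by rewrite lerXn2r// nnegrE.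
lra.
Qed.

Lemma bernoulli (x : R) n : 0 <= x -> 1 + n%:R * x <= (1 + x) ^+ n.
Proof.
move=> x0; elim: n => [|n IH]; first by rewrite mul0r addr0 expr0.
rewrite exprS -natr1; apply: le_trans (ler_wpM2l (_ : 0 <= 1 + x) IH); last by lra.
have : 0 <= n%:R * x * x by rewrite !mulr_ge0.
lra.
Qed.

Lemma pow_le_scale (x y c k : R) : 0 <= x -> 0 < y -> 0 < c -> 
  (forall n, x ^+ n * c <= y ^+ n * k) -> x <= y.
Proof.
move=> x0 y0 c0 H; rewrite leNgt; apply/negP => yx.
pose d := x / y - 1; have d0 : 0 < d by rewrite subr_gt0 ltr_pdivlMr// mul1r.
have H' n : (1 + d) ^+ n * c <= k.
  rewrite /d subrKC expr_div_n mulrAC ler_pdivrMr ?exprn_gt0//.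
  by rewrite [leRHS]mulrC.
pose n := (Num.truncn (k / c / d)).+1.
have : k / c / d < n%:R by rewrite /n truncnS_gt.
rewrite !ltr_pdivrMr// => kn.
have := H' n; have := ler_wpM2r (ltW c0) (bernoulli n (ltW d0)); lra.
Qed.

Lemma cclosed_annulus (e r : R) : cclosed (fun w : C => e <= cabs w <= r).
Proof.
move=> z; have [ze|ze] := ltP (cabs z) e => H.
  exists (e - cabs z); first by rewrite subr_gt0.
  by move=> h Hh /andP[]; have := ler_cabsD z h; lra.
have zr : r < cabs z by rewrite ltNge; apply/negP => zr; apply: H; apply/andP.
exists (cabs z - r); first by rewrite subr_gt0.
by move=> h Hh /andP[]; have := lerB_cabsD z h; lra.
Qed.

(** G(w) / w is not known to be regular at 0. The maximum principle is applied
to (G(w) / w)^n w on an annulus: the extra factor w makes its values on a small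
inner circle negligible, and it disappears as n grows. *)
Lemma schwarz_twice r G M : 0 < M -> (forall z, cabs z < r -> twice_at G z) ->
  G 0 = 0 -> (forall z, cabs z < r -> cabs (G z) <= M) ->
  forall z, cabs z < r -> cabs (G z) * r <= M * cabs z.
Proof.
move=> M0 G2 G0 GM z zr.
have [->|z0] := eqVneq z 0; first by rewrite G0 cabs0 mul0r mulr0.
have zp : 0 < cabs z by rewrite cabs_gt0.
have main rho : cabs z < rho < r -> cabs (G z) * rho <= M * cabs z.
  move=> /andP[zrho rhor]; have rho0 : 0 < rho by lra.
  rewrite -ler_pdivrMr// mulrAC -ler_pdivlMr//.
  apply: (@pow_le_scale _ _ (cabs z) rho) => //.
  - by rewrite divr_ge0// cabs_ge0.
  - by rewrite divr_gt0.
  move=> n; have [|d Gd] := @twice_at_cderiv G 0; first by apply: G2; rewrite cabs0; lra.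
  have [del del0 Hdel] := Gd 1 ltr01.
  pose A := cabs d + 1; have A0 : 0 < A by rewrite ltr_wpDl// cabs_ge0.
  have Asmall w : cabs w < del -> cabs (G w) <= A * cabs w.
    move=> /Hdel; rewrite add0r G0 subr0 mul1r => H.
    have := lerB_cabs (G w) (d * w); rewrite cabsM /A; lra.
  (* The inner radius depends on n. *)
  pose e := Num.min (Num.min (del / 2) (cabs z)) ((M / rho) ^+ n * rho / A ^+ n).
  have e0 : 0 < e.
    by rewrite !lt_min zp !divr_gt0 ?mulr_gt0 ?exprn_gt0// ?divr_gt0.
  have ed : e < del by apply: (@le_lt_trans _ _ (del / 2)); [rewrite !ge_min lexx|lra].
  have ez : e <= cabs z by rewrite !ge_min lexx !orbT.
  have eA : A ^+ n * e <= (M / rho) ^+ n * rho.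
    by rewrite mulrC -ler_pdivlMr ?exprn_gt0// ge_min lexx orbT.
  have neq0 w : e <= cabs w -> w != 0 by rewrite -cabs_gt0; exact: lt_le_trans.
  have tw w : e <= cabs w -> cabs w < r -> twice_at (fun w => (G w * w^-1) ^+ n * w) w.
    move=> we wr; apply: twice_atM (twice_at_id _); apply: twice_atX; apply: twice_atM.
      exact: G2.
    by apply: (@twice_atV id); [exact: neq0|exact: twice_at_id].
  have -> : (cabs (G z) / cabs z) ^+ n * cabs z = cabs ((G z * z^-1) ^+ n * z).
    by rewrite cabsM cabsX cabsM cabsV.
  apply: (@maximum_principle (fun w => e <= cabs w <= rho)
    (fun w => cabs w = e \/ cabs w = rho) (fun w => (G w * w^-1) ^+ n * w)).
  - exact: cclosed_annulus.
  - by exists rho => w /andP[].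
  - move=> w /andP[we wr]; have [|d' /cderiv_cont//] := twice_at_cderiv (tw w we _).
    exact: le_lt_trans wr rhor.
  - move=> w /andP[]; rewrite le_eqVlt => /predU1P[->|we]; first by left; left.
    rewrite le_eqVlt => /predU1P[->|wr]; first by left; right.
    right; split; last by apply: tw; [exact: ltW|exact: lt_trans wr rhor].
    exists (Num.min (cabs w - e) (rho - cabs w)); first by rewrite lt_min !subr_gt0 we.
    move=> h; rewrite lt_min => /andP[h1 h2].
    have := ler_cabsD w h; have := lerB_cabsD w h => ? ?; apply/andP; split; lra.
  - move=> w /andP[we wr]; rewrite cabsM cabsX cabsM cabsV => -[] wE; rewrite wE.
      apply: le_trans eA; rewrite ler_pM2r// lerXn2r ?nnegrE ?(ltW A0)//.
        by rewrite divr_ge0 ?cabs_ge0// ltW.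
      by rewrite ler_pdivrMr// -wE; apply: Asmall; rewrite wE.
    rewrite ler_pM2r// lerXn2r ?nnegrE//.
    - by rewrite divr_ge0 ?cabs_ge0// ltW.
    - by rewrite divr_ge0// ltW.
    - by rewrite ler_pM2r ?invr_gt0//; apply: GM; lra.
  - by rewrite mulr_ge0 ?exprn_ge0 ?divr_ge0// ltW.
  - by rewrite ez ltW.
have [->|Gz0] := eqVneq (G z) 0; first by rewrite cabs0 mul0r mulr_ge0 ?cabs_ge0// ltW.
have Gp : 0 < cabs (G z) by rewrite cabs_gt0.
rewrite leNgt; apply/negP => bad.
have mr : M * cabs z / cabs (G z) < r by rewrite ltr_pdivrMr// [r * _]mulrC.
(* Let rho tend to r. *)
pose m := Num.max (cabs z) (M * cabs z / cabs (G z)).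
have m1 : m < r by rewrite gt_max zr.
have m2 : cabs z <= m by rewrite le_max lexx.
have m3 : M * cabs z / cabs (G z) <= m by rewrite le_max lexx orbT.
rewrite ler_pdivrMr// in m3.
have /main : cabs z < (m + r) / 2 < r by apply/andP; split; lra.
nra.
Qed.

Lemma derivative_bound f a d (k r : R) : 0 < r -> cderiv f a d ->
  (forall h, cabs h < r -> cabs (f (a + h) - f a) <= k * cabs h) -> cabs d <= k.
Proof.
move=> r0 fd H; apply/ler_addgt0Pr => e e0.
have [del del0 Hd] := near0I (fd e e0) (near0_lt r0).
have t0 : 0 < del / 2 by lra.
have tE : cabs ((del / 2)%:C : C) = del / 2 by rewrite cabs_real gtr0_norm.
have [|] := Hd (del / 2)%:C; rewrite tE; first by lra.
move=> H1 H2; have := H (del / 2)%:C; rewrite tE => /(_ H2).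
have := lerB_cabs (d * (del / 2)%:C) (f (a + (del / 2)%:C) - f a).
rewrite (cabs_distC (d * _)) cabsM tE => H3 H4.
rewrite -(ler_pM2r t0) mulrDl; lra.
Qed.

Lemma cderiv_shift f a w d : cderiv f (a + w) d -> cderiv (fun v => f (a + v)) w d.
Proof.
move=> gd; apply: cderiv_eq (cderiv_comp (cderivD (cderiv_cst a w) (cderiv_id w)) gd).
by rewrite add0r mulr1.
Qed.

Lemma twice_at_shift f a z : twice_at f (a + z) -> twice_at (fun w => f (a + w)) z.
Proof.
move=> [f1 Hf [d fd]]; exists (fun w => f1 (a + w)).
  by apply: near0W Hf => h; rewrite -addrA; exact: cderiv_shift.
by exists d; exact: cderiv_shift.
Qed.

Lemma cauchy_twice r f d M : 0 < r -> 0 < M -> (forall z, cabs z < r -> twice_at f z) ->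
  (forall z, cabs z < r -> cabs (f z) <= M) -> cderiv f 0 d -> cabs d * r <= 2 * M.
Proof.
move=> r0 M0 f2 fM fd; rewrite -ler_pdivlMr//.
apply: (derivative_bound r0 fd) => h hr; rewrite add0r mulrAC ler_pdivlMr//.
have M2 : 0 < 2 * M by lra.
apply: (@schwarz_twice r (fun z => f z - f 0) (2 * M)) => //.
- by move=> z zr; apply: twice_atD; [exact: f2|exact: twice_at_cst].
- by rewrite subrr.
- move=> z zr; have := ler_cabsB (f z) (f 0); have := fM z zr.
  by have := fM 0; rewrite cabs0 => /(_ r0); lra.
Qed.

(** The difference quotients of a primitive F of f are bounded by sup |f| and have
two derivatives; their derivatives at 0 converge to that of f. *)
Lemma cauchy_estimate0 r f d M : 0 < r -> 0 < M -> holo r f ->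
  (forall z, cabs z < r -> cabs (f z) <= M) -> cderiv f 0 d -> cabs d * r <= 2 * M.
Proof.
move=> r0 M0 fh fM fd; have [F HF] := holo_primitive r0 fh.
have main s : 0 < s < r -> cabs d * s <= 2 * M.
  move=> /andP[s0 sr]; rewrite -ler_pdivlMr//; apply: (@derivative_bound f 0 d _ (r - s)) => //.
    by rewrite subr_gt0.
  move=> h hr; rewrite add0r; have [->|h0] := eqVneq h 0.
    by rewrite subrr cabs0 mulr0.
  have hp : 0 < cabs h by rewrite cabs_gt0.
  rewrite -ler_pdivrMr// -cabsV -cabsM ler_pdivlMr//.
  apply: (@cauchy_twice s (fun z => (F (h + z) - F z) * h^-1)) => //.
  - move=> z zs; apply: twice_atM; last exact: twice_at_cst.
    have zr : cabs z < r by lra.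
    have hzr : cabs (h + z) < r by have := ler_cabsD h z; lra.
    have F2 w : cabs w < r -> twice_at F w.
      by move=> wr; exists f; [apply: near0W (near0_disk wr) => k; exact: HF|exact: fh].
    apply: twice_atD; first by apply: twice_at_shift; exact: F2.
    have -> : (fun x => - F x) = (fun x => -1 * F x) by apply/funext => x; rewrite mulN1r.
    by apply: twice_atM; [exact: twice_at_cst|exact: F2].
  - move=> z zs; rewrite cabsM cabsV ler_pdivrMr//.
    have zr : cabs z < r by lra.
    have hzr : cabs (h + z) < r by have := ler_cabsD h z; lra.
    have := @complex_mvt0 R F z (h + z) M; rewrite addrK; apply=> t t01.
    have := @segment_disk _ r z (h + z) t zr hzr t01; rewrite addrK => sg.
    by exists (f (z + t%:C * h)); [exact: HF|exact: fM].
  - have F0 : cderiv F 0 (f 0) by apply: HF; rewrite cabs0.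
    have Fh : cderiv (fun z => F (h + z)) 0 (f h).
      by apply: cderiv_shift; rewrite addr0; apply: HF; lra.
    apply: cderiv_eq (cderivM (cderivB Fh F0) (cderiv_cst h^-1 0)).
    by rewrite mulr0 addr0.
rewrite leNgt; apply/negP => bad.
have d0 : 0 < cabs d.
  by rewrite lt_def cabs_ge0 andbT; apply/negP => /eqP dE; move: bad; rewrite dE mul0r; lra.
have m1 : 2 * M / cabs d < r by rewrite ltr_pdivrMr// [r * _]mulrC.
have m0 : 0 < 2 * M / cabs d by rewrite divr_gt0// mulr_gt0.
have /main : 0 < (2 * M / cabs d + r) / 2 < r by apply/andP; split; lra.
have E : cabs d * (2 * M / cabs d) = 2 * M by rewrite mulrC divfK// gt_eqF.
nra.
Qed.

Lemma cauchy_estimate r f a d M : 0 < r -> 0 < M ->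
  (forall h, cabs h < r -> exists d, cderiv f (a + h) d) ->
  (forall h, cabs h < r -> cabs (f (a + h)) <= M) -> cderiv f a d -> cabs d * r <= 2 * M.
Proof.
move=> r0 M0 fh fM fd; apply: (@cauchy_estimate0 r (fun w => f (a + w))) => //.
  by move=> z /fh[b fb]; exists b; exact: cderiv_shift.
by apply: cderiv_shift; rewrite addr0.
Qed.

End MaximumPrinciple.

(** * Derivatives of holomorphic functions; Schwarz-Pick and its consequences *)

Section Regularity.
Variable R : realType.
Local Notation C := R[i].
Implicit Types (f g F : C -> C) (z w h a d : C) (r e M : R).

Lemma cauchy_limit_real (u : C -> R) :
  (forall e, 0 < e -> exists2 del : R, 0 < del & forall k j, k != 0 -> j != 0 ->
     cabs k < del -> cabs j < del -> `|u k - u j| <= e) ->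
  exists l, forall e, 0 < e -> exists2 del : R, 0 < del & forall k, k != 0 ->
     cabs k < del -> `|u k - l| <= e.
Proof.
move=> H; pose A := [set x : R | exists2 del : R, 0 < del & forall k, k != 0 -> cabs k < del -> x <= u k].
have pt (del : R) : 0 < del -> exists2 k : C, k != 0 & cabs k < del.
  move=> d0; have d2 : 0 < del / 2 by lra.
  exists (del / 2)%:C; first by rewrite -cabs_gt0 cabs_real gtr0_norm.
  by rewrite cabs_real gtr0_norm; lra.
have inA e del j : 0 < del -> (forall k, k != 0 -> cabs k < del -> `|u k - u j| <= e) -> A (u j - e).
  move=> d0 Hk; exists del => // k k0 kd; have := Hk k k0 kd; rewrite ler_norml; lra.
have ubA e del j : 0 < del -> (forall k, k != 0 -> cabs k < del -> `|u k - u j| <= e) ->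
    ubound A (u j + e).
  move=> d0 Hk x [c c0 Hx]; have mp : 0 < Num.min del c by rewrite lt_min d0 c0.
  have [k k0] := pt _ mp; rewrite lt_min => /andP[kd kc].
  by have := Hk k k0 kd; have := Hx k k0 kc; rewrite ler_norml; lra.
exists (sup A) => e e0; have [del d0 Hd] := H e e0; exists del => // j j0 jd.
have Hj k : k != 0 -> cabs k < del -> `|u k - u j| <= e by move=> k0 kd; exact: Hd.
have A1 := inA _ _ _ d0 Hj; have A2 := ubA _ _ _ d0 Hj.
have : u j - e <= sup A by apply: ub_le_sup => //; exists (u j + e).
have : sup A <= u j + e by apply: ge_sup => //; exists (u j - e).
by rewrite ler_norml; lra.
Qed.

Lemma cauchy_limit (Q : C -> C) :
  (forall e, 0 < e -> exists2 del : R, 0 < del & forall k j, k != 0 -> j != 0 ->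
     cabs k < del -> cabs j < del -> cabs (Q k - Q j) <= e) ->
  exists l, forall e, 0 < e -> exists2 del : R, 0 < del & forall k, k != 0 ->
     cabs k < del -> cabs (Q k - l) <= e.
Proof.
move=> H.
have [|a Ha] := @cauchy_limit_real (fun k => complex.Re (Q k)).
  move=> e /H[del d0 Hd]; exists del => // k j *; apply: le_trans (Hd k j _ _ _ _) => //.
  by apply: le_trans (cabs_Re _); rewrite !ReImE.
have [|b Hb] := @cauchy_limit_real (fun k => complex.Im (Q k)).
  move=> e /H[del d0 Hd]; exists del => // k j *; apply: le_trans (Hd k j _ _ _ _) => //.
  by apply: le_trans (cabs_Im _); rewrite !ReImE.
exists (a +i* b) => e e0; have e2 : 0 < e / 2 by lra.
have [d1 d10 H1] := Ha _ e2; have [d2 d20 H2] := Hb _ e2.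
exists (Num.min d1 d2); first by rewrite lt_min d10.
move=> k k0; rewrite lt_min => /andP[/(H1 k k0) {}H1 /(H2 k k0) {}H2].
by apply: le_trans (cabs_le_ReIm _) _; rewrite !ReImE /=; lra.
Qed.

(** For a primitive F of f, the quotients (F(w + k) - F(w)) / k are uniformly
close to f, so by Cauchy's estimate their derivatives (f(w + k) - f(w)) / k
are uniformly Cauchy as k tends to 0. A second use of Cauchy's estimate makes the
derivatives (f1(w + k) - f1(w)) / k of these Cauchy, hence convergent. *)
Lemma holo_deriv r f f1 : 0 < r -> (forall z, cabs z < r -> cderiv f z (f1 z)) -> holo r f1.
Proof.
move=> r0 ff1 z zr.
have fh : holo r f by move=> w /ff1; exists (f1 w).
have [F HF] := holo_primitive r0 fh.
pose rho := (r - cabs z) / 4; have rho0 : 0 < rho by rewrite /rho; lra.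
have rhoE : 4 * rho = r - cabs z by rewrite /rho; lra.
(* The constant 4 leaves room for two Cauchy estimates on disks of radius rho. *)
have uni e : 0 < e -> exists2 del : R, 0 < del & forall k j w, k != 0 -> j != 0 ->
    cabs k < del -> cabs j < del -> cabs (w - z) <= rho ->
    cabs ((f (w + k) - f w) / k - (f (w + j) - f w) / j) <= e.
  move=> e0; pose eta := e * rho / 4; have eta0 : 0 < eta by rewrite /eta divr_gt0// mulr_gt0.
  have fc w : cabs (w - z) <= 3 * rho -> ccont f w.
    by move=> wz; have := lerB_cabs w z => ?; have [|d /cderiv_cont//] := fh w; lra.
  have [del d0 Hd] := compact_ucont (@cclosed_disk R z _) (@cbounded_disk R z _) fc eta0.
  exists (Num.min del rho); first by rewrite lt_min d0.
  have q k w : k != 0 -> cabs k < Num.min del rho -> cabs (w - z) <= 2 * rho ->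
      cabs ((F (w + k) - F w) / k - f w) <= eta.
    move=> k0; rewrite lt_min => /andP[kd kr] wz.
    have kp : 0 < cabs k by rewrite cabs_gt0.
    have -> : (F (w + k) - F w) / k - f w = (F (w + k) - F w - f w * k) / k by field.
    rewrite cabsM cabsV ler_pdivrMr//.
    have := @complex_mvt R F w (w + k) (f w) eta; rewrite [w + k - w]addrAC subrr add0r.
    apply=> t /andP[t0 t1].
    have tk : cabs (t%:C * k) <= cabs k.
      by rewrite cabsM cabs_real ger0_norm// ler_piMl ?cabs_ge0.
    exists (f (w + t%:C * k)).
      apply: HF; have := ler_cabsD w (t%:C * k); have := lerB_cabs w z; lra.
    by apply: Hd; [lra|rewrite [w + _ - w]addrAC subrr add0r; lra].
  move=> k j w k0 j0 kd jd wz.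
  have e2 : 0 < 2 * eta by lra.
  have := @cauchy_estimate R rho (fun v => (F (v + k) - F v) / k - (F (v + j) - F v) / j) w
    ((f (w + k) - f w) / k - (f (w + j) - f w) / j) (2 * eta) rho0 e2.
  have dq l v : cabs l < Num.min del rho -> cabs (v - z) <= 2 * rho ->
      cderiv (fun v => (F (v + l) - F v) / l) v ((f (v + l) - f v) / l).
    rewrite lt_min => /andP[_ lr] vz.
    have vr : cabs v < r by have := lerB_cabs v z; lra.
    have vlr : cabs (v + l) < r by have := ler_cabsD v l; have := lerB_cabs v z; lra.
    have Fl : cderiv (fun v => F (v + l)) v (f (v + l)).
      apply: cderiv_eq (cderiv_comp (cderivD (cderiv_id v) (cderiv_cst l v)) (HF _ vlr)).
      by rewrite addr0 mulr1.
    apply: cderiv_eq (cderivM (cderivB Fl (HF _ vr)) (cderiv_cst l^-1 v)).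
    by rewrite mulr0 addr0.
  have wh h : cabs h < rho -> cabs (w + h - z) <= 2 * rho.
    by move=> hr; rewrite addrAC; have := ler_cabsD (w - z) h; lra.
  have -> : 2 * (2 * eta) = e * rho by rewrite /eta; lra.
  rewrite ler_pM2r//; apply.
  - move=> h /wh ?; eexists; apply: cderivB; exact: dq.
  - move=> h /wh ?.
    have -> : (F (w + h + k) - F (w + h)) / k - (F (w + h + j) - F (w + h)) / j =
      ((F (w + h + k) - F (w + h)) / k - f (w + h)) - ((F (w + h + j) - F (w + h)) / j - f (w + h)) by ring.
    apply: le_trans (ler_cabsB _ _) _.
    have := q k (w + h) k0 kd ltac:(assumption); have := q j (w + h) j0 jd ltac:(assumption); lra.
  - by apply: cderivB; apply: dq => //; lra.
have [|l Hl] := @cauchy_limit (fun k => (f1 (z + k) - f1 z) / k).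
  move=> e e0; have eta0 : 0 < e * rho / 2 by rewrite divr_gt0// mulr_gt0.
  have [del d0 Hd] := uni _ eta0; exists (Num.min del rho); first by rewrite lt_min d0.
  move=> k j k0 j0; rewrite !lt_min => /andP[kd kr] /andP[jd jr].
  have := @cauchy_estimate R rho (fun v => (f (v + k) - f v) / k - (f (v + j) - f v) / j) z
    ((f1 (z + k) - f1 z) / k - (f1 (z + j) - f1 z) / j) (e * rho / 2) rho0 eta0.
  have dq l v : cabs l < rho -> cabs (v - z) <= rho ->
      cderiv (fun v => (f (v + l) - f v) / l) v ((f1 (v + l) - f1 v) / l).
    move=> lr vz.
    have vr : cabs v < r by have := lerB_cabs v z; lra.
    have vlr : cabs (v + l) < r by have := ler_cabsD v l; have := lerB_cabs v z; lra.
    have Fl : cderiv (fun v => f (v + l)) v (f1 (v + l)).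
      apply: cderiv_eq (cderiv_comp (cderivD (cderiv_id v) (cderiv_cst l v)) (ff1 _ vlr)).
      by rewrite addr0 mulr1.
    apply: cderiv_eq (cderivM (cderivB Fl (ff1 _ vr)) (cderiv_cst l^-1 v)).
    by rewrite mulr0 addr0.
  have -> : 2 * (e * rho / 2) = e * rho by lra.
  rewrite ler_pM2r//; apply.
  - move=> h hr; eexists; apply: cderivB; apply: dq => //; rewrite addrAC subrr add0r; exact: ltW.
  - by move=> h hr; apply: Hd => //; rewrite addrAC subrr add0r ltW.
  - by apply: cderivB; apply: dq => //; rewrite subrr cabs0 ltW.
exists l => e /Hl[del d0 Hd]; exists del => // k kd.
have [->|k0] := eqVneq k 0; first by rewrite addr0 mulr0 subr0 subrr cabs0 mulr0.
have -> : f1 (z + k) - f1 z - l * k = ((f1 (z + k) - f1 z) / k - l) * k by field.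
by rewrite cabsM ler_wpM2r ?cabs_ge0//; exact: Hd.
Qed.

Lemma holo_derivative r f : 0 < r -> holo r f ->
  exists2 f1, (forall z, cabs z < r -> cderiv f z (f1 z)) & holo r f1.
Proof.
move=> r0 fh.
have ex z : exists d, cabs z < r -> cderiv f z d.
  by have [/fh[d fd]|?] := boolP (cabs z < r); [exists d|exists 0].
have [f1 Hf1] := choice ex; exists f1 => //; exact: holo_deriv r0 Hf1.
Qed.

Lemma holo_twice r f : 0 < r -> holo r f -> forall z, cabs z < r -> twice_at f z.
Proof.
move=> r0 /(holo_derivative r0)[f1 ff1 f1h] z zr; exists f1; last exact: f1h.
by apply: near0W (near0_disk zr) => h; exact: ff1.
Qed.

Lemma schwarz r G M : 0 < M -> holo r G -> G 0 = 0 ->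
  (forall z, cabs z < r -> cabs (G z) <= M) ->
  forall z, cabs z < r -> cabs (G z) * r <= M * cabs z.
Proof.
move=> M0 Gh G0 GM z zr; have r0 : 0 < r by apply: le_lt_trans zr; exact: cabs_ge0.
exact: schwarz_twice M0 (holo_twice r0 Gh) G0 GM z zr.
Qed.

Lemma holoB r f g : holo r f -> holo r g -> holo r (fun z => f z - g z).
Proof.
by move=> fh gh z zr; have [a fa] := fh z zr; have [b gb] := gh z zr; exists (a - b); exact: cderivB.
Qed.

Lemma holoD r f g : holo r f -> holo r g -> holo r (fun z => f z + g z).
Proof.
by move=> fh gh z zr; have [a fa] := fh z zr; have [b gb] := gh z zr; exists (a + b); exact: cderivD.
Qed.

Lemma holoM r f g : holo r f -> holo r g -> holo r (fun z => f z * g z).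
Proof.
by move=> fh gh z zr; have [a fa] := fh z zr; have [b gb] := gh z zr; eexists; exact: cderivM fa gb.
Qed.

Lemma holoV r f : (forall z, cabs z < r -> f z != 0) -> holo r f -> holo r (fun z => (f z)^-1).
Proof.
move=> f0 fh z zr; have [a fa] := fh z zr; eexists; apply: cderivV fa; exact: f0.
Qed.

Lemma holo_cst r (c : C) : holo r (fun=> c).
Proof. by move=> z _; exists 0; exact: cderiv_cst. Qed.

Lemma holo_lt r s f : s <= r -> holo r f -> holo s f.
Proof. by move=> sr fh z zs; apply: fh; exact: lt_le_trans sr. Qed.

(** Schwarz's lemma for (F - F(0)) / (F + conj F(0)), the composition of F with
a map from the left half-plane to the unit disk. *)
Lemma schwarz_pick r F : holo r F -> (forall z, cabs z < r -> complex.Re (F z) < 0) ->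
  forall z, cabs z < r -> cabs (F z - F 0) * r <= cabs z * cabs (F z + (F 0)^*%C).
Proof.
move=> Fh Fneg z zr; have r0 : 0 < r by apply: le_lt_trans zr; exact: cabs_ge0.
have F0neg : complex.Re (F 0) < 0 by apply: Fneg; rewrite cabs0.
have Rec (w : C) : complex.Re w^*%C = complex.Re w by case: w.
have Imc (w : C) : complex.Im w^*%C = - complex.Im w by case: w.
have den w : cabs w < r -> F w + (F 0)^*%C != 0.
  move=> wr; apply/eqP => /(congr1 (@complex.Re R)); rewrite ReD Rec /= => E.
  by have := Fneg w wr; lra.
have le1 w : cabs w < r -> cabs (F w - F 0) <= cabs (F w + (F 0)^*%C).
  move=> wr; rewrite -(@ler_pXn2r _ 2)// ?nnegrE ?cabs_ge0// !cabs_sqr !ReImE Rec Imc.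
  have := Fneg w wr; nra.
have := @schwarz r (fun w => (F w - F 0) * (F w + (F 0)^*%C)^-1) 1 ltr01 _ _ _ z zr.
rewrite mul1r cabsM cabsV mulrAC ler_pdivrMr ?cabs_gt0 ?den//; apply.
- apply: holoM; first by apply: holoB => //; exact: holo_cst.
  by apply: holoV => //; apply: holoD => //; exact: holo_cst.
- by rewrite subrr mul0r.
- by move=> w wr; rewrite cabsM cabsV ler_pdivrMr ?cabs_gt0 ?den// mul1r; exact: le1.
Qed.

Lemma add_conj_cabs (w : C) : cabs (w + w^*%C) = 2 * `|complex.Re w|.
Proof.
have -> : w + w^*%C = (2 * complex.Re w)%:C.
  by case: w => a b; apply: complex_ext => /=; ring.
by rewrite cabs_real normrM ger0_norm.
Qed.

Lemma harnack r F : holo r F -> (forall z, cabs z < r -> complex.Re (F z) < 0) ->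
  forall z, cabs z < r ->
    - complex.Re (F 0) * (r - cabs z) <= - complex.Re (F z) * (r + cabs z).
Proof.
move=> Fh Fneg z zr; have := schwarz_pick Fh Fneg zr.
have := Fneg z zr; have zp := cabs_ge0 z.
set D := cabs (F z - F 0) => Fz.
have le2 : cabs (F z + (F 0)^*%C) <= D + 2 * - complex.Re (F z).
  rewrite -cabs_conj; have -> : (F z + (F 0)^*%C)^*%C = (F 0 - F z) + (F z + (F z)^*%C).
    by case: (F z) => a b; case: (F 0) => a' b'; apply: complex_ext => /=; ring.
  apply: le_trans (ler_cabsD _ _) _; rewrite add_conj_cabs cabs_distC -/D.
  by rewrite ltr0_norm.
move=> H; have := ler_wpM2l zp le2.
have : `|complex.Re (F z) - complex.Re (F 0)| <= D.
  by have := cabs_Re (F z - F 0); rewrite !ReImE.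
rewrite ler_norml => /andP[_]; nra.
Qed.

Lemma borel_caratheodory r F : holo r F -> (forall z, cabs z < r -> complex.Re (F z) < 0) ->
  forall z, cabs z < r ->
    cabs (F z - F 0) * (r - cabs z) <= 2 * cabs z * - complex.Re (F 0).
Proof.
move=> Fh Fneg z zr; have := schwarz_pick Fh Fneg zr; have zp := cabs_ge0 z.
have F0 : complex.Re (F 0) < 0 by apply: Fneg; rewrite cabs0; lra.
set D := cabs (F z - F 0).
have le2 : cabs (F z + (F 0)^*%C) <= D + 2 * - complex.Re (F 0).
  have -> : F z + (F 0)^*%C = (F z - F 0) + (F 0 + (F 0)^*%C) by ring.
  apply: le_trans (ler_cabsD _ _) _; rewrite add_conj_cabs -/D.
  by rewrite ltr0_norm.
move=> H; have := ler_wpM2l zp le2; lra.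
Qed.

End Regularity.

(** * Exponential and holomorphic logarithms *)

Section Exponential.
Variable R : realType.
Local Notation C := R[i].
Implicit Types (f g : C -> C) (z w h : C) (r e : R).

Lemma cexpD z w : cexp (z + w) = cexp z * cexp w.
Proof.
case: z => a b; case: w => c d; rewrite /cexp /= expRD cosD sinD.
by apply: complex_ext; rewrite !ReImE /=; ring.
Qed.

Lemma cexp0 : cexp (0 : C) = 1.
Proof. by rewrite /cexp /= expR0 cos0 sin0; apply: complex_ext; rewrite !ReImE /=; ring. Qed.

Lemma cabs_cexp z : cabs (cexp z) = expR (complex.Re z).
Proof.
rewrite /cexp cabsM cabs_real ger0_norm ?expR_ge0// /cabs /= cos2Dsin2 sqrtr1 mulr1 //.
Qed.

Lemma cexp_neq0 z : cexp z != 0.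
Proof. by rewrite -cabs_gt0 cabs_cexp expR_gt0. Qed.

Lemma cexpN z : cexp (- z) = (cexp z)^-1.
Proof.
by apply: (mulfI (cexp_neq0 z)); rewrite -cexpD subrr cexp0 divff// cexp_neq0.
Qed.

Lemma cexp_real (x : R) : cexp x%:C = (expR x)%:C.
Proof. by rewrite /cexp /= cos0 sin0 mulr1. Qed.

Lemma cderiv_cexp0 : cderiv (@cexp R) 0 1.
Proof.
move=> e e0; have e8 : 0 < e / 8 by lra.
have [d1 d10 H1] := real_derive_eps (is_derive_expR (0 : R)) e8.
have [d2 d20 H2] := real_derive_eps (is_derive_cos (0 : R)) e8.
have [d3 d30 H3] := real_derive_eps (is_derive_sin (0 : R)) e8.
apply: near0W (near0I (near0I (near0_lt d10) (near0_lt d20))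
  (near0I (near0_lt d30) (near0I (near0_lt e8) (near0_lt (@ltr01 R))))).
move=> h [[h1 h2] [h3 [h4 h5]]].
rewrite add0r cexp0 mul1r.
case: h h1 h2 h3 h4 h5 => x y h1 h2 h3 h4 h5.
have xh : `|x| <= cabs (x +i* y) := cabs_Re (x +i* y).
have yh : `|y| <= cabs (x +i* y) := cabs_Im (x +i* y).
have x3 : `|y| < d3 by lra.
have S1 : `|sin y - y| <= e / 8 * `|y|.
  by have := H3 y x3; rewrite add0r sin0 cos0 subr0 mul1r.
have x2 : `|y| < d2 by lra.
have S2 : `|cos y - 1| <= e / 8 * `|y|.
  by have := H2 y x2; rewrite add0r sin0 cos0 oppr0 mul0r subr0.
have x1 : `|x| < d1 by lra.
have S3 : `|expR x - 1 - x| <= e / 8 * `|x|.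
  by have := H1 x x1; rewrite add0r expR0 mul1r.
move: S1 S2 S3; set s := sin y - y; set c := cos y - 1; set E := expR x - 1 - x => S1 S2 S3.
apply: le_trans (cabs_le_ReIm _) _.
have -> : complex.Re (cexp (x +i* y) - 1 - x +i* y) = E * cos y + (1 + x) * c.
  by rewrite /cexp !ReImE /= /E /c; ring.
have -> : complex.Im (cexp (x +i* y) - 1 - x +i* y) = E * sin y + (1 + x) * s + x * y.
  by rewrite /cexp !ReImE /= /E /s; ring.
have x12 : `|1 + x| <= 2 by have := ler_normD 1 x; rewrite normr1; lra.
have mx : e / 8 * `|x| <= e / 8 * cabs (x +i* y) by rewrite ler_pM2l.
have my : e / 8 * `|y| <= e / 8 * cabs (x +i* y) by rewrite ler_pM2l.
have A1 : `|E * cos y| <= e / 8 * cabs (x +i* y).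
  by rewrite normrM; apply: le_trans (ler_piMr _ (cos_max _)) (le_trans S3 mx).
have A2 : `|(1 + x) * c| <= 2 * (e / 8 * cabs (x +i* y)).
  by rewrite normrM; apply: ler_pM => //; lra.
have A3 : `|E * sin y| <= e / 8 * cabs (x +i* y).
  by rewrite normrM; apply: le_trans (ler_piMr _ (sin_max _)) (le_trans S3 mx).
have A4 : `|(1 + x) * s| <= 2 * (e / 8 * cabs (x +i* y)).
  by rewrite normrM; apply: ler_pM => //; lra.
have A5 : `|x * y| <= e / 8 * cabs (x +i* y).
  by rewrite normrM; apply: ler_pM => //; apply: ltW; lra.
have := ler_normD (E * cos y) ((1 + x) * c).
have := ler_normD (E * sin y + (1 + x) * s) (x * y).
have := ler_normD (E * sin y) ((1 + x) * s).
have := mulr_ge0 (ltW e0) (cabs_ge0 (x +i* y)); lra.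
Qed.

Lemma cderiv_cexp z : cderiv (@cexp R) z (cexp z).
Proof.
move=> e e0; have c0 : 0 < cabs (cexp z) by rewrite cabs_gt0 cexp_neq0.
have e1 : 0 < e / cabs (cexp z) by rewrite divr_gt0.
apply: near0W (cderiv_cexp0 e1) => h; rewrite add0r cexp0 mul1r cexpD => H.
have -> : cexp z * cexp h - cexp z - cexp z * h = cexp z * (cexp h - 1 - h) by ring.
by rewrite cabsM mulrC -ler_pdivlMr// mulrAC.
Qed.

Lemma holo_cexp r g : holo r g -> holo r (fun z => cexp (g z)).
Proof.
by move=> gh z /gh[a ga]; eexists; apply: cderiv_comp ga _; exact: cderiv_cexp.
Qed.

Lemma cexp_surj w : w != 0 -> exists2 z, cexp z = w & `|complex.Im z| <= pi.
Proof.
move=> w0; have rp : 0 < cabs w by rewrite cabs_gt0.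
case: w w0 rp => a b w0 rp; set rho := cabs (a +i* b) in rp *.
have rho2 : rho ^+ 2 = a ^+ 2 + b ^+ 2 by rewrite /rho cabs_sqr.
pose c := a / rho.
have c1 : -1 <= c <= 1.
  rewrite -ler_norml /c normrM (gtr0_norm (_ : 0 < rho^-1)) ?invr_gt0// ler_pdivrMr// mul1r.
  exact: (cabs_Re (a +i* b)).
have sE : sin (acos c) = `|b| / rho.
  have q0 : 0 <= `|b| / rho by rewrite divr_ge0// ltW.
  rewrite sin_acos// -[RHS](ger0_norm q0) -sqrtr_sqr; congr Num.sqrt.
  have -> : (`|b| / rho) ^+ 2 = b ^+ 2 / rho ^+ 2 by rewrite expr_div_n real_normK ?num_real.
  have -> : c ^+ 2 = a ^+ 2 / rho ^+ 2 by rewrite expr_div_n.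
  rewrite rho2.
  by field; rewrite -rho2 sqrf_eq0 gt_eqF.
have cE : cos (acos c) = c by rewrite acosK// in_itv.
have pi0 := acos_ge0 c1; have pi1 := acos_lepi c1.
have [b0|b0] := leP 0 b.
  exists (ln rho +i* acos c); last by rewrite /= ger0_norm.
  rewrite /cexp /= lnK// cE sE ger0_norm//.
  by apply: complex_ext; rewrite !ReImE /= /c; field; rewrite gt_eqF.
exists (ln rho +i* - acos c); last by rewrite /= normrN ger0_norm.
rewrite /cexp /= lnK// cosN sinN cE sE ltr0_norm//.
by apply: complex_ext; rewrite !ReImE /= /c; field; rewrite gt_eqF.
Qed.

(** A primitive g of f'/f makes f * exp(-g) constant. *)
Lemma holo_log r f w0 : 0 < r -> holo r f -> (forall z, cabs z < r -> f z != 0) ->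
  cexp w0 = f 0 ->
  exists g, [/\ holo r g, g 0 = w0 & forall z, cabs z < r -> cexp (g z) = f z].
Proof.
move=> r0 fh fn0 w0E; have [f1 ff1 f1h] := holo_derivative r0 fh.
have [G HG] := holo_primitive r0 (holoM f1h (holoV fn0 fh)).
pose g z := G z - G 0 + w0.
have gd z : cabs z < r -> cderiv g z (f1 z / f z).
  move=> zr; apply: cderiv_eq (cderivD (cderivB (HG z zr) (cderiv_cst _ _)) (cderiv_cst _ _)).
  by rewrite subr0 addr0.
have g0 : g 0 = w0 by rewrite /g subrr add0r.
exists g; split => // [z zr|z zr]; first by exists (f1 z / f z); exact: gd.
have z0r : cabs (0 : C) < r by rewrite cabs0.
have := @cderiv0_cst R (fun w => f w * cexp (- g w)) r _ 0 z z0r zr.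
rewrite g0 -w0E -cexpD subrr cexp0 => H.
have {}H : f z * cexp (- g z) = 1.
  apply: H => w wr.
  apply: cderiv_eq (cderivM (ff1 w wr) (cderiv_comp (cderivN (gd w wr)) (cderiv_cexp (- g w)))).
  by field; exact: fn0.
by rewrite -[LHS]mul1r -H -mulrA -cexpD addrC subrr cexp0 mulr1.
Qed.

End Exponential.

(** * Bloch's theorem *)

Section Bloch.
Variable R : realType.
Local Notation C := R[i].
Implicit Types (f g : C -> C) (z w h a : C) (r e : R).

Lemma holo_shift r a t f : (forall h, cabs h < t -> cabs (a + h) < r) -> holo r f ->
  holo t (fun h => f (a + h)).
Proof. by move=> at_ fh h /at_ /fh[d fd]; exists d; exact: cderiv_shift. Qed.

(** Let a maximise |g'(w)| (s - |w|) over |w| <= s and let t = (s - |a|) / 2. Then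
|g'| is at most twice |g'(a)| on the disk of radius t around a, so by Schwarz's
lemma g is nearly affine there and moves the circle of radius t / 6 around a
at least |g'(a)| t / 12 away from g(a). By the maximum principle for the inverse
of g - om, the omitted value om is not much closer to g(a) than to the image of
this circle, so |g'(a)| t / 24 <= D. *)
Lemma bloch r g g1 (D : R) : (forall z, cabs z < r -> cderiv g z (g1 z)) ->
  (forall p, exists2 a : C, cabs (a - p) <= D & forall z, cabs z < r -> g z != a) ->
  forall z, cabs z < r -> cabs (g1 z) * (r - cabs z) <= 48 * D.
Proof.
move=> gd omit z zr; have r0 : 0 < r by apply: le_lt_trans zr; exact: cabs_ge0.
have D0 : 0 <= D by have [a aD _] := omit 0; apply: le_trans aD; exact: cabs_ge0.
have gh : holo r g by move=> w /gd; exists (g1 w).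
have g1h : holo r g1 := holo_deriv r0 gd.
have main s : cabs z < s < r -> cabs (g1 z) * (s - cabs z) <= 48 * D.
  move=> /andP[zs sr].
  have [||||a Ka amax] := @compact_max R (fun w => cabs (w - 0) <= s)
      (* The truncation makes the function nonnegative outside the disk of radius s too. *)
      (fun w => cabs (g1 w) * Num.max 0 (s - cabs w)).
  - exact: cclosed_disk.
  - exact: cbounded_disk.
  - by exists z; rewrite subr0 ltW.
  - move=> w; rewrite subr0 => ws e e0.
    have [d /cderiv_cont g1c] := g1h w (le_lt_trans ws sr).
    have G0 := cabs_ge0 (g1 w); have s0 : 0 < s by have := cabs_ge0 z; lra.
    pose c := e / (s + 1 + cabs (g1 w) + 1).
    have cp : 0 < c by rewrite divr_gt0//; lra.
    have cE : c * (s + 1 + cabs (g1 w) + 1) = e by rewrite /c divfK// gt_eqF//; lra.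
    have c1 : 0 < Num.min c 1 by rewrite lt_min cp ltr01.
    apply: near0W (near0I (ccont_cabs g1c c1) (near0_lt c1)) => h [].
    have m1 : Num.min c 1 <= c by rewrite ge_min lexx.
    have m2 : Num.min c 1 <= 1 by rewrite ge_min lexx orbT.
    move=> H1 H2; rewrite (max_r (_ : 0 <= s - cabs w)) ?subr_ge0//.
    have mh : Num.max 0 (s - cabs (w + h)) <= s - cabs w + Num.min c 1.
      have := lerB_cabsD w h; case: (leP 0 (s - cabs (w + h))) => *; lra.
    have m0 : 0 <= Num.max 0 (s - cabs (w + h)) by rewrite le_max lexx.
    apply: (@le_trans _ _ ((cabs (g1 w) + Num.min c 1) * (s - cabs w + Num.min c 1))).
      by apply: ler_pM; rewrite ?cabs_ge0.
    have W0 := cabs_ge0 w; move: m1 m2 c1; set m := Num.min c 1 => m1 m2 c1.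
    have : m * (s - cabs w + m + cabs (g1 w)) <= c * (s + 1 + cabs (g1 w) + 1).
      by apply: ler_pM; lra.
    rewrite cE; nra.
  rewrite subr0 in Ka.
  have zmax : cabs (g1 z) * (s - cabs z) <= cabs (g1 a) * (s - cabs a).
    have := amax z; rewrite subr0 => /(_ (ltW zs)).
    by rewrite !max_r// ?subr_ge0// ltW.
  apply: le_trans zmax _.
  have [->|ga0] := eqVneq (g1 a) 0; first by rewrite cabs0 mul0r mulr_ge0.
  have gp : 0 < cabs (g1 a) by rewrite cabs_gt0.
  move: Ka; rewrite le_eqVlt => /predU1P[->|as_]; first by rewrite subrr mulr0 mulr_ge0.
  pose t := (s - cabs a) / 2; have t0 : 0 < t by rewrite /t; lra.
  have tE : s - cabs a = 2 * t by rewrite /t; lra.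
  have inr h : cabs h < t -> cabs (a + h) < s by move=> ht; have := ler_cabsD a h; lra.
  have g1t h : cabs h < t -> cabs (g1 (a + h)) <= 2 * cabs (g1 a).
    move=> ht; have ahs := inr h ht; have := amax (a + h); rewrite subr0 => /(_ (ltW ahs)).
    rewrite !max_r ?subr_ge0 ?(ltW ahs) ?(ltW as_)// tE => H.
    rewrite -(ler_pM2r t0); apply: le_trans (_ : _ <= cabs (g1 (a + h)) * (s - cabs (a + h))) _.
      by rewrite ler_wpM2l ?cabs_ge0//; have := ler_cabsD a h; lra.
    by apply: le_trans H _; lra.
  have M0 : 0 < 3 * cabs (g1 a) by lra.
  have sch h : cabs h < t -> cabs (g1 (a + h) - g1 a) * t <= 3 * cabs (g1 a) * cabs h.
    apply: (@schwarz R t (fun h => g1 (a + h) - g1 a)) => //.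
    - apply: holoB; last exact: holo_cst.
      by apply: holo_shift g1h => k /inr /lt_trans; apply.
    - by rewrite addr0 subrr.
    - by move=> k /g1t; have := ler_cabsB (g1 (a + k)) (g1 a); lra.
  have lin h : cabs h < t -> cabs (g (a + h) - g a - g1 a * h) * t <= 3 * cabs (g1 a) * cabs h ^+ 2.
    move=> ht; rewrite -ler_pdivlMr//.
    have := @complex_mvt R g a (a + h) (g1 a) (3 * cabs (g1 a) * cabs h / t).
    rewrite [a + h - a]addrAC subrr add0r expr2 => H.
    apply: le_trans (H _) _; last by rewrite mulrAC mulrA.
    move=> u /andP[u0 u1].
    have uh : cabs (u%:C * h) <= cabs h by rewrite cabsM cabs_real ger0_norm// ler_piMl ?cabs_ge0.
    have uht := le_lt_trans uh ht.
    exists (g1 (a + u%:C * h)); first by apply: gd; apply: lt_trans sr; exact: inr.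
    rewrite ler_pdivlMr//; apply: le_trans (sch _ uht) _.
    by rewrite ler_pM2l.
  (* The affine part moves by |g'(a)| t / 6 and the error is at most half of that. *)
  have bdry h : cabs h = t / 6 -> cabs (g1 a) * t / 12 <= cabs (g (a + h) - g a).
    move=> hE; have ht : cabs h < t by lra.
    have := lin h ht; rewrite hE => L.
    have L' : cabs (g (a + h) - g a - g1 a * h) <= cabs (g1 a) * t / 12.
      rewrite -(ler_pM2r t0); apply: le_trans L _.
      by rewrite le_eqVlt; apply/orP; left; apply/eqP; field.
    have := lerB_cabs (g1 a * h) (g (a + h) - g a); rewrite (cabs_distC (g1 a * h)) cabsM hE; lra.
  have [om omD omg] := omit (g a).
  rewrite tE leNgt; apply/negP => big.
  have big' : 2 * D < cabs (g1 a) * t / 12 by lra.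
  have nz h : cabs h < t -> g (a + h) - om != 0.
    by move=> ht; rewrite subr_eq0; apply: omg; apply: lt_trans sr; exact: inr.
  have hol : holo t (fun h => (g (a + h) - om)^-1).
    apply: holoV nz _; apply: holoB; last exact: holo_cst.
    by apply: holo_shift gh => k /inr /lt_trans; apply.
  have Q0 : 0 < cabs (g1 a) * t / 12 - D by lra.
  have := @maximum_principle R (fun h => cabs (h - 0) <= t / 6) (fun h => cabs h = t / 6)
    (fun h => (g (a + h) - om)^-1) (cabs (g1 a) * t / 12 - D)^-1.
  have q0 : 0 <= (cabs (g1 a) * t / 12 - D)^-1 by rewrite invr_ge0 ltW.
  have z6 : cabs (0 - 0 : C) <= t / 6 by rewrite subr0 cabs0; lra.
  move=> /(_ (@cclosed_disk R 0 _) (@cbounded_disk R 0 _) _ _ _ q0 0 z6); rewrite addr0.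
  have nz0 : 0 < cabs (g a - om) by have := nz 0; rewrite addr0 cabs0 cabs_gt0 => ->.
  rewrite cabsV lef_pV2 ?posrE// => H.
  have : cabs (g1 a) * t / 12 - D <= cabs (g a - om); last by rewrite cabs_distC; lra.
  apply: H => h.
  - rewrite subr0 => h6; have [|d /cderiv_cont//] := hol h; lra.
  - rewrite subr0 le_eqVlt => /predU1P[|h6]; first by left.
    right; split; last by apply: holo_twice t0 hol _ _; lra.
    by have := near0_disk h6; apply: near0W => k; rewrite subr0; exact: ltW.
  - move=> _ hE; rewrite cabsV lef_pV2 ?posrE//; last by rewrite cabs_gt0 nz//; lra.
    have := bdry h hE; have := lerB_cabsD (g (a + h) - g a) (g a - om).
    by rewrite addrA subrK (cabs_distC (g a)); lra.
rewrite leNgt; apply/negP => bad.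
have gp : 0 < cabs (g1 z).
  rewrite lt_def cabs_ge0 andbT; apply/negP => /eqP E.
  by move: bad; rewrite E mul0r; lra.
pose m := Num.max (cabs z) (cabs z + 48 * D / cabs (g1 z)).
have E : cabs (g1 z) * (48 * D / cabs (g1 z)) = 48 * D by rewrite mulrC divfK// gt_eqF.
have q0 : 0 <= 48 * D / cabs (g1 z) by apply: divr_ge0 (ltW gp); apply: mulr_ge0.
have mr : cabs z + 48 * D / cabs (g1 z) < r.
  rewrite -ltrBrDl ltr_pdivrMr// mulrC [_ * cabs (g1 z)]mulrC; lra.
have /main : cabs z < (cabs z + 48 * D / cabs (g1 z) + r) / 2 < r by apply/andP; split; lra.
nra.
Qed.

End Bloch.

(** * Schottky's theorem *)

Section Schottky.
Variable R : realType.
Local Notation C := R[i].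
Implicit Types (f g : C -> C) (z w h a : C) (r e : R).

Let ii : C := 0 +i* 1.

Lemma iiM : ii * ii = -1.
Proof. by apply: complex_ext; rewrite !ReImE /=; ring. Qed.

Lemma cabs_ii : cabs ii = 1.
Proof. by rewrite /ii /cabs /= expr0n /= add0r expr1n sqrtr1. Qed.

Definition ccos z : C := (cexp (ii * z) + cexp (- (ii * z))) / 2.

Lemma ccosN z : ccos (- z) = ccos z.
Proof. by rewrite /ccos mulrN opprK addrC. Qed.

Lemma cexp_ipi : cexp (ii * (pi : R)%:C) = -1.
Proof.
have -> : ii * (pi : R)%:C = 0 +i* pi by apply: complex_ext; rewrite !ReImE /=; ring.
rewrite /cexp /= expR0 cospi sinpi.
by apply: complex_ext; rewrite !ReImE /=; ring.
Qed.

Lemma ccosDpi z : ccos (z + (pi : R)%:C) = - ccos z.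
Proof.
rewrite /ccos mulrDr opprD !cexpD (cexpN (ii * (pi : R)%:C)) cexp_ipi invrN invr1.
ring.
Qed.

Lemma ccosDpin z n : ccos (z + (n%:R * pi : R)%:C) = (-1) ^+ n * ccos z.
Proof.
elim: n => [|n IH]; first by rewrite mul0r addr0 expr0 mul1r.
rewrite -natr1 mulrDl mul1r rmorphD /= addrA ccosDpi IH exprS; ring.
Qed.

Lemma ccos0 : ccos 0 = 1.
Proof. by rewrite /ccos mulr0 oppr0 cexp0; field. Qed.

Lemma cabs_ccos z : cabs (ccos z) <= expR (cabs z).
Proof.
rewrite /ccos cabsM cabsV.
have -> : cabs (2 : C) = 2 by rewrite -[2]/(2%:R) -(rmorph_nat (real_complex R)) cabs_real ger0_norm.
rewrite ler_pdivrMr//; apply: le_trans (ler_cabsD _ _) _; rewrite !cabs_cexp.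
have b w : cabs w = cabs z -> expR (complex.Re w) <= expR (cabs z).
  by move=> <-; rewrite ler_expR; apply: le_trans (cabs_Re w); exact: ler_norm.
have := b (ii * z); have := b (- (ii * z)); rewrite cabsN cabsM cabs_ii mul1r.
by move=> /(_ erefl) ? /(_ erefl) ?; lra.
Qed.

Lemma ccos_im (y : R) : ccos (0 +i* y) = ((expR y + expR (- y)) / 2)%:C.
Proof.
have -> : (((expR y + expR (- y)) / 2)%:C : C) = ((expR (- y))%:C + (expR y)%:C) / 2.
  by apply: complex_ext; rewrite !ReImE /=; field.
rewrite /ccos; congr (_ / 2).
have -> : ii * (0 +i* y) = (- y)%:C by apply: complex_ext; rewrite !ReImE /=; ring.
by rewrite cexp_real -rmorphN /= opprK cexp_real.
Qed.

(** With q a square root of 1 - f^2, the product of f + iq and f - iq is 1, so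
f + iq has a logarithm k, and -ik is the required function. Both factors have
modulus at most 1 + 2|f|, which bounds the logarithm at 0. *)
Lemma holo_arccos r f : 0 < r -> holo r f -> (forall z, cabs z < r -> f z != 1 /\ f z != -1) ->
  exists g, [/\ holo r g, cabs (g 0) <= pi + ln (1 + 2 * cabs (f 0))
    & forall z, cabs z < r -> ccos (g z) = f z].
Proof.
move=> r0 fh fn; have z0r : cabs (0 : C) < r by rewrite cabs0.
have nz1 z : cabs z < r -> 1 - f z * f z != 0.
  move=> /fn[f1 f2]; have -> : 1 - f z * f z = - ((f z - 1) * (f z + 1)) by ring.
  by rewrite oppr_eq0 mulf_eq0 negb_or subr_eq0 f1 addr_eq0 f2.
have [w0 w0E _] := cexp_surj (nz1 0 z0r).
have [g [gh _ gE]] := holo_log r0 (holoB (@holo_cst R r 1) (holoM fh fh)) nz1 w0E.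
pose q z := cexp (g z / 2).
have qE z : cabs z < r -> q z * q z = 1 - f z * f z.
  by move=> zr; rewrite /q -cexpD -gE//; congr cexp; field.
have qh : holo r q.
  by apply: holo_cexp; apply: holoM => //; exact: holo_cst.
have prod1 : forall z, cabs z < r -> (f z + ii * q z) * (f z - ii * q z) = 1.
  move=> z zr; have -> : (f z + ii * q z) * (f z - ii * q z) = f z * f z - ii * ii * (q z * q z) by ring.
  by rewrite qE// iiM; ring.
have nz2 z : cabs z < r -> f z + ii * q z != 0.
  by move=> zr; apply/eqP => E; have := prod1 z zr; rewrite E mul0r => /eqP; rewrite eq_sym oner_eq0.
have [v0 v0E v0pi] := cexp_surj (nz2 0 z0r).
have [k [kh k0 kE]] := holo_log r0 (holoD fh (holoM (@holo_cst R r ii) qh)) nz2 v0E.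
exists (fun z => - (ii * k z)); split.
- move=> z zr; have [d kd] := kh z zr; exists (- (ii * d)).
  by apply: cderivN; exact: cderivZ.
- rewrite cabsN cabsM cabs_ii mul1r k0; apply: le_trans (cabs_le_ReIm _) _.
  rewrite addrC lerD//.
  pose L := 1 + 2 * cabs (f 0).
  have F0 := cabs_ge0 (f 0); have L0 : 0 < L by rewrite /L; lra.
  have q1 : cabs (q 0) <= 1 + cabs (f 0).
    rewrite -(@ler_pXn2r _ 2)// ?nnegrE ?cabs_ge0 ?addr_ge0//.
    rewrite expr2 -cabsM qE//; apply: le_trans (ler_cabsB _ _) _; rewrite cabs1 cabsM; nra.
  have e1 : cabs (f 0 + ii * q 0) <= L.
    by apply: le_trans (ler_cabsD _ _) _; rewrite cabsM cabs_ii mul1r /L; lra.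
  have e2 : cabs (f 0 - ii * q 0) <= L.
    by apply: le_trans (ler_cabsB _ _) _; rewrite cabsM cabs_ii mul1r /L; lra.
  rewrite -ler_expR lnK ?posrE//.
  have E1 : expR (complex.Re v0) <= L by rewrite -cabs_cexp v0E.
  have E2 : expR (- complex.Re v0) <= L.
    have -> : - complex.Re v0 = complex.Re (- v0) by rewrite ReN.
    rewrite -cabs_cexp cexpN v0E.
    suff -> : (f 0 + ii * q 0)^-1 = f 0 - ii * q 0 by [].
    by apply: (mulfI (nz2 0 z0r)); rewrite prod1// divff// nz2.
  by case: (ger0P (complex.Re v0)) => _.
move=> z zr; rewrite /ccos mulrN opprK mulrA iiM mulN1r opprK cexpN kE//.
suff -> : (f z + ii * q z)^-1 = f z - ii * q z by field.
by apply: (mulfI (nz2 z zr)); rewrite prod1// divff// nz2.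
Qed.

(** cosh(pi s) increases by at least 1 over an interval of length 2, hence
meets an integer. *)
Lemma cosh_nat (t : R) : 0 <= t -> exists2 s, t <= s <= t + 2 &
  exists n : nat, (expR (pi * s) + expR (- (pi * s))) / 2 = n%:R.
Proof.
move=> t0; pose ch s : R := (expR (pi * s) + expR (- (pi * s))) / 2.
have p2 : 2 <= (pi : R) by exact: pi_ge2.
have chc : continuous ch.
  move=> s; rewrite /ch; apply: cvgM; last exact: cvg_cst.
  apply: cvgD; (apply: continuous_comp; last exact: continuous_expR).
    by apply: cvgM; [exact: cvg_cst|exact: cvg_id].
  by apply: cvgN; apply: cvgM; [exact: cvg_cst|exact: cvg_id].
have step : ch t + 1 <= ch (t + 2).
  pose E : R := expR (pi * t); have E1 : 1 <= E by rewrite -expR0 ler_expR mulr_ge0 ?pi_ge0.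
  (* Multiplying exp(pi t) by q >= 5 raises the hyperbolic cosine by at least 1. *)
  pose q : R := expR (pi * 2); have q5 : 5 <= q.
    by apply: le_trans (expR_ge1Dx _); lra.
  rewrite /ch mulrDr opprD !expRD !expRN -/E -/q.
  have E0 : 0 < E by lra.
  have q0 : 0 < q by lra.
  have : E * q * (E^-1 * q^-1) = 1 by field; rewrite !gt_eqF.
  have : E * E^-1 = 1 by rewrite divff// gt_eqF.
  have iq : q^-1 <= 1 by rewrite invf_le1//; lra.
  have iq0 : 0 < q^-1 by rewrite invr_gt0.
  have iE : E^-1 <= 1 by rewrite invf_le1.
  have iE0 : 0 < E^-1 by rewrite invr_gt0.
  have : 0 <= E^-1 * q^-1 by rewrite mulr_ge0// ltW.
  nra.
pose n := (Num.truncn (ch t)).+1.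
have ch0 : 0 <= ch t by rewrite /ch divr_ge0// addr_ge0// expR_ge0.
have n1 : ch t < n%:R by rewrite /n truncnS_gt.
have n2 : n%:R <= ch t + 1.
  by rewrite /n -natr1 lerD2r; have /andP[] := truncn_itv ch0.
have [|||s] := @IVT R ch t (t + 2) n%:R.
- by lra.
- by apply: continuous_subspaceT.
- by rewrite ge_min le_max (ltW n1) (le_trans n2 step) orbT.
by rewrite in_itv /= => ts sE; exists s => //; exists n.
Qed.

(** On the vertical lines Re z = m with m an integer, cos(pi z) is up to sign
the hyperbolic cosine of pi Im z. *)
Lemma ccos_int_dense (p : C) : exists2 a : C, cabs (a - p) <= 3 &
  exists n : nat, ccos ((pi : R)%:C * a) = n%:R \/ ccos ((pi : R)%:C * a) = - n%:R.
Proof.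
wlog x0 : p / 0 <= complex.Re p => [H|].
  have [/H//|xn] := leP 0 (complex.Re p).
  have [|a ap [n an]] := H (- p); first by rewrite ReN; lra.
  exists (- a).
    rewrite -cabsN. have -> : - (- a - p) = a - - p by ring.
    exact: ap.
  by exists n; rewrite mulrN ccosN.
have [s st [n sn]] := cosh_nat (normr_ge0 (complex.Im p)).
pose m := Num.truncn (complex.Re p).
have /andP[m1 m2] := truncn_itv x0.
pose y := if 0 <= complex.Im p then s else - s.
have ch : ccos ((pi : R)%:C * (0 +i* y)) = n%:R.
  have -> : (pi : R)%:C * (0 +i* y) = 0 +i* (pi * y) by apply: complex_ext; rewrite !ReImE /=; ring.
  rewrite ccos_im -(rmorph_nat (real_complex R)) -sn /y; congr _%:C.
  by case: ifP => _ //; rewrite mulrN opprK addrC.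
exists (m%:R +i* y).
  apply: le_trans (cabs_le_ReIm _) _; rewrite !ReImE /=.
  have : `|m%:R - complex.Re p| <= 1.
    by rewrite ler_norml; move: m2; rewrite -natr1 -/m => m2; rewrite -/m in m1; lra.
  have : `|y - complex.Im p| <= 2.
    rewrite /y; move: st; case: (leP 0 (complex.Im p)) => y0.
      by rewrite ger0_norm// ler_norml; lra.
    by rewrite ltr0_norm// ler_norml; lra.
  lra.
exists n.
have -> : (pi : R)%:C * (m%:R +i* y) = (pi : R)%:C * (0 +i* y) + (m%:R * pi : R)%:C.
  by apply: complex_ext; rewrite !ReImE /=; ring.
rewrite ccosDpin ch -signr_odd; case: (odd m); rewrite ?expr1 ?expr0 ?mul1r ?mulN1r; by [left|right].
Qed.

(** Since 2f - 1 omits 1 and -1, it equals cos(pi F) with F holomorphic, and F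
omits all integers because 2f - 1 omits the values of cos(pi n). In particular F
omits 1 and -1, hence F = cos(pi g), and g omits all points a for which
cos(pi a) is an integer. As those are 3-dense, Bloch's theorem bounds g', hence g
and then F and f. *)
Lemma schottky (K rho : R) : 0 <= rho -> rho < 1 -> exists2 B : R, 0 < B &
  forall f, holo 1 f -> (forall z, cabs z < 1 -> f z != 0 /\ f z != 1) ->
    cabs (f 0) <= K -> forall z, cabs z <= rho -> cabs (f z) <= B.
Proof.
move=> rho0 rho1.
have p2 : 2 <= (pi : R) by exact: pi_ge2.
have pi0 : (pi : R)%:C != 0 :> C by rewrite -cabs_gt0 cabs_real gtr0_norm; lra.
have cpi : cabs ((pi : R)%:C : C) = pi by rewrite cabs_real ger0_norm//; lra.
pose A1 : R := pi + ln (1 + 2 * (2 * `|K| + 1)).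
pose A2 : R := pi + ln (1 + 2 * `|A1|).
pose A3 := A2 + 144 / (1 - rho).
exists (expR (pi * expR (pi * A3)) + 1); first by rewrite ltr_wpDl// expR_ge0.
move=> f fh fn f0K z zrho.
have z0r : cabs (0 : C) < 1 by rewrite cabs0.
have zr : cabs z < 1 by lra.
have [|w wr|H [Hh H0 HE]] := @holo_arccos 1 (fun z => 2 * f z - 1) ltr01.
- by apply: holoB; [apply: holoM => //; exact: holo_cst|exact: holo_cst].
- have [f1 f2] := fn w wr; split.
    by apply: contra f2 => /eqP E; apply/eqP/(mulfI (_ : (2 : C) != 0)); rewrite ?pnatr_eq0//; rewrite -[LHS](subrK 1) E; ring.
  by apply: contra f1 => /eqP E; apply/eqP/(mulfI (_ : (2 : C) != 0)); rewrite ?pnatr_eq0//; rewrite -[LHS](subrK 1) E; ring.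
pose F w := H w / (pi : R)%:C.
have FH w : (pi : R)%:C * F w = H w by rewrite /F mulrC divfK.
have Fint w n : cabs w < 1 -> F w != n%:R /\ F w != - n%:R.
  move=> wr; have [f1 f2] := fn w wr.
  have key : ccos (n%:R * pi : R)%:C <> 2 * f w - 1.
    rewrite -[(_)%:C]add0r ccosDpin ccos0 mulr1 -signr_odd; case: (odd n).
      rewrite expr1 => E; move: f1; rewrite (_ : f w = (2 * f w - 1 + 1) / 2); last by field.
      by rewrite -E addNr mul0r eqxx.
    rewrite expr0 => E; move: f2; rewrite (_ : f w = (2 * f w - 1 + 1) / 2); last by field.
    by rewrite -E -[1 + 1]/2 divff ?eqxx// pnatr_eq0.
  have HnE : H w = (n%:R * pi : R)%:C \/ H w = - (n%:R * pi : R)%:C -> False.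
    by move=> [] E; apply: key; rewrite -HE// E ?ccosN.
  split; apply/eqP => E; apply: HnE; rewrite -FH E.
    by left; rewrite rmorphM rmorph_nat /= mulrC.
  by right; rewrite rmorphM rmorph_nat /= mulrN mulrC.
have Fh : holo 1 F by apply: holoM => //; exact: holo_cst.
have [|G [Gh G0 GE]] := holo_arccos ltr01 Fh.
  by move=> w wr; have := Fint w 1%N wr.
pose g w := G w / (pi : R)%:C.
have gG w : (pi : R)%:C * g w = G w by rewrite /g mulrC divfK.
have gh : holo 1 g by apply: holoM => //; exact: holo_cst.
have [g1 gd _] := holo_derivative ltr01 gh.
have bl := @bloch R 1 g g1 3 gd.
have {}bl w : cabs w < 1 -> cabs (g1 w) * (1 - cabs w) <= 144.
  have -> : 144 = 48 * 3 :> R by ring.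
  apply: bl => p; have [a ap [n an]] := ccos_int_dense p; exists a => // v vr.
  apply/eqP => E; have [F1 F2] := Fint v n vr.
  by case: an => an; move: F1 F2; rewrite -GE// -gG E an eqxx.
have A1E : cabs (H 0) <= A1.
  apply: le_trans H0 _; rewrite /A1 lerD2l ler_ln ?posrE.
  - have := ler_cabsB (2 * f 0) 1; rewrite cabsM cabs1.
    have -> : cabs (2 : C) = 2 by rewrite -(rmorph_nat (real_complex R)) cabs_real ger0_norm.
    by have := ler_norm K; lra.
  - by have := cabs_ge0 (2 * f 0 - 1); lra.
  - by have := normr_ge0 K; lra.
have F0A : cabs (F 0) <= `|A1|.
  have : cabs (F 0) <= cabs (H 0).
    by rewrite -FH cabsM cpi ler_peMl ?cabs_ge0//; lra.
  by have := ler_norm A1; lra.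
have A2E : cabs (g 0) <= A2.
  have : cabs (g 0) <= cabs (G 0).
    by rewrite -gG cabsM cpi ler_peMl ?cabs_ge0//; lra.
  move/le_trans; apply; apply: le_trans G0 _; rewrite /A2 lerD2l ler_ln ?posrE; first lra.
    by have := cabs_ge0 (F 0); lra.
  by have := normr_ge0 A1; lra.
have gz : cabs (g z) <= A3.
  have := @complex_mvt0 R g 0 z (144 / (1 - rho)); rewrite subr0 => mvt.
  have {}mvt : cabs (g z - g 0) <= 144 / (1 - rho) * cabs z.
    apply: mvt => t /andP[t0 t1]; rewrite add0r.
    have tz : cabs (t%:C * z) <= rho.
      rewrite cabsM cabs_real ger0_norm//; apply: le_trans zrho.
      by rewrite ler_piMl ?cabs_ge0.
    exists (g1 (t%:C * z)); first by apply: gd; lra.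
    rewrite ler_pdivlMr ?subr_gt0//; apply: le_trans (bl (t%:C * z) _); last by lra.
    by rewrite ler_wpM2l ?cabs_ge0//; lra.
  have c0 : 0 <= 144 / (1 - rho) by rewrite divr_ge0//; lra.
  have : 144 / (1 - rho) * cabs z <= 144 / (1 - rho) by rewrite ler_piMr//; lra.
  have := lerB_cabs (g z) (g 0); rewrite /A3; lra.
have Fz : cabs (F z) <= expR (pi * A3).
  rewrite -GE// -gG; apply: le_trans (cabs_ccos _) _.
  by rewrite ler_expR cabsM cpi ler_pM2l//; lra.
have hz : cabs (2 * f z - 1) <= expR (pi * expR (pi * A3)).
  rewrite -HE// -FH; apply: le_trans (cabs_ccos _) _.
  by rewrite ler_expR cabsM cpi ler_pM2l//; lra.
have -> : f z = (2 * f z - 1 + 1) / 2 by field.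
rewrite cabsM cabsV.
have -> : cabs (2 : C) = 2 by rewrite -(rmorph_nat (real_complex R)) cabs_real ger0_norm.
rewrite ler_pdivrMr//; have := ler_cabsD (2 * f z - 1) 1; rewrite cabs1.
have := expR_ge0 (pi * expR (pi * A3)); lra.
Qed.

End Schottky.

(** * Distortion of holomorphic motions *)

Section Motions.
Variable R : realType.
Local Notation C := R[i].
Variable Phi : C -> C -> C.
Hypothesis Phi_motion : holomorphic_motion [set: C] Phi.
Implicit Types (z w a b x mu l : C) (r e rho : R).

Lemma motion_holo z : holo 1 (fun mu => Phi mu z).
Proof.
have [_ H _] := Phi_motion.
by move=> mu mu1; apply: derivable_cderiv; exact: H.
Qed.

Lemma motion_neq mu z w : cabs mu < 1 -> z != w -> Phi mu z - Phi mu w != 0.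
Proof.
move=> mu1; apply: contraNN; rewrite subr_eq0 => /eqP E; apply/eqP.
by have [H _ _] := Phi_motion; apply: (H mu mu1) E; rewrite inE.
Qed.

Lemma motion0 z : Phi 0 z = z.
Proof. by have [_ _ ->] := Phi_motion. Qed.

Lemma motion_diff_holo z w : holo 1 (fun mu => Phi mu z - Phi mu w).
Proof. by apply: holoB; exact: motion_holo. Qed.

Lemma motion_ratio_holo a b x : a != b ->
  holo 1 (fun mu => (Phi mu x - Phi mu a) * (Phi mu b - Phi mu a)^-1).
Proof.
move=> ab; apply: holoM; first exact: motion_diff_holo.
apply: holoV; last exact: motion_diff_holo.
by move=> mu mu1; apply: motion_neq => //; rewrite eq_sym.
Qed.

(** The ratio of the two differences is holomorphic in mu and omits 0 and 1;
Schottky's theorem bounds it by its value at mu = 0. *)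
Lemma motion_quasisymmetric (K rho : R) : 0 <= rho -> rho < 1 -> exists2 B : R, 0 < B &
  forall a b x, a != b -> cabs (x - a) <= K * cabs (b - a) ->
  forall mu, cabs mu <= rho -> cabs (Phi mu x - Phi mu a) <= B * cabs (Phi mu b - Phi mu a).
Proof.
move=> rho0 rho1; have [B B0 HB] := @schottky R K rho rho0 rho1.
exists (B + 1) => [|a b x ab xK mu mur]; first by lra.
have mu1 : cabs mu < 1 by lra.
have p0 : 0 < cabs (Phi mu b - Phi mu a) by rewrite cabs_gt0 motion_neq// eq_sym.
have [->|xa] := eqVneq x a; first by rewrite subrr cabs0 mulr_ge0 ?(ltW p0)//; lra.
have [->|xb] := eqVneq x b; first by rewrite ler_peMl ?(ltW p0)//; lra.
have : cabs ((Phi mu x - Phi mu a) * (Phi mu b - Phi mu a)^-1) <= B.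
  apply: (HB _ (motion_ratio_holo x ab)) => // [nu nu1|].
    have q0 : Phi nu b - Phi nu a != 0 by rewrite motion_neq// eq_sym.
    split; first by rewrite mulf_neq0 ?invr_eq0// motion_neq.
    apply/eqP => /(congr1 (fun t => t * (Phi nu b - Phi nu a))).
    rewrite divfK// mul1r => /eqP; rewrite -subr_eq0 opprB addrA subrK.
    exact/negP/motion_neq.
  by rewrite !motion0 cabsM cabsV ler_pdivrMr// cabs_gt0 subr_eq0 eq_sym.
rewrite cabsM cabsV ler_pdivrMr// => H; apply: le_trans H _.
by rewrite ler_pM2r//; lra.
Qed.

(** By quasisymmetry the modulus of the ratio f is at most some B, so
ln B + 1 - ln |f| is a positive harmonic function. Its value at 0 is large when
x is close to a, and by Harnack's inequality so are its values for
|mu| <= rho. *)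
Lemma motion_equicontinuous (rho eta : R) : 0 <= rho -> rho < 1 -> 0 < eta ->
  exists2 d : R, 0 < d & forall a b x, a != b -> cabs (x - a) <= d * cabs (b - a) ->
  forall mu, cabs mu <= rho -> cabs (Phi mu x - Phi mu a) <= eta * cabs (Phi mu b - Phi mu a).
Proof.
move=> rho0 rho1 eta0; pose rho' := (1 + rho) / 2.
have r1 : rho' < 1 by rewrite /rho'; lra.
have rr : rho < rho' by rewrite /rho'; lra.
have [B B0 HB] := @motion_quasisymmetric 1 rho' ltac:(lra) r1.
(* The exponent m is so negative that Harnack's inequality brings ln |f| below ln eta. *)
pose X := ln B + 1; pose m := Num.min (-1) (X - 2 * `|X - ln eta| / (rho' - rho)).
have m1 : m <= -1 by rewrite ge_min lexx.
have m2 : m <= X - 2 * `|X - ln eta| / (rho' - rho) by rewrite ge_min lexx orbT.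
exists (expR m) => [|a b x ab xd mu mur]; first exact: expR_gt0.
have d1 : expR m < 1 by rewrite -expR0 ltr_expR; lra.
have mu1 : cabs mu < 1 by lra.
have ba0 : 0 < cabs (b - a) by rewrite cabs_gt0 subr_eq0 eq_sym.
have p0 nu : cabs nu < 1 -> 0 < cabs (Phi nu b - Phi nu a) by move=> ?; rewrite cabs_gt0 motion_neq// eq_sym.
have [->|xa] := eqVneq x a; first by rewrite subrr cabs0 mulr_ge0 ?(ltW (p0 _ mu1)) ?(ltW eta0).
have xb : cabs (x - a) <= 1 * cabs (b - a).
  by apply: le_trans xd _; rewrite ler_pM2r// ltW.
pose f nu := (Phi nu x - Phi nu a) * (Phi nu b - Phi nu a)^-1.
have fh : holo rho' f by apply: holo_lt (motion_ratio_holo x ab); exact: ltW.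
have f0 nu : cabs nu < rho' -> f nu != 0.
  move=> nu1; have nu2 : cabs nu < 1 by lra.
  by rewrite mulf_neq0 ?invr_eq0// motion_neq// eq_sym.
have fB nu : cabs nu < rho' -> cabs (f nu) <= B.
  move=> nu1; have nu2 : cabs nu < 1 by lra.
  by rewrite cabsM cabsV ler_pdivrMr ?p0//; apply: HB => //; exact: ltW.
have r'0 : 0 < rho' by lra.
have z0r : cabs (0 : C) < rho' by rewrite cabs0.
have [w0 w0E _] := cexp_surj (f0 0 z0r).
have [g [gh _ gE]] := holo_log r'0 fh f0 w0E.
have Reg nu : cabs nu < rho' -> complex.Re (g nu) = ln (cabs (f nu)).
  by move=> nur; rewrite -gE// cabs_cexp expRK.
have mur' : cabs mu < rho' by lra.
have := @harnack R rho' (fun nu => g nu - X%:C) _ _ mu mur'.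
rewrite !ReImE /= !Reg// => H.
have {}H : - (ln (cabs (f 0)) - X) * (rho' - cabs mu) <= - (ln (cabs (f mu)) - X) * (rho' + cabs mu).
  apply: H; first by apply: holoB gh _; exact: holo_cst.
  move=> nu nur; rewrite !ReImE /= Reg// /X.
  have : ln (cabs (f nu)) <= ln B by rewrite ler_ln ?posrE ?cabs_gt0 ?f0//; exact: fB.
  lra.
have lf0 : ln (cabs (f 0)) <= m.
  rewrite -[m]expRK ler_ln ?posrE ?expR_gt0 ?cabs_gt0 ?f0//.
  by rewrite /f !motion0 cabsM cabsV ler_pdivrMr.
have lfB : ln (cabs (f mu)) <= ln B by rewrite ler_ln ?posrE ?cabs_gt0 ?f0//; exact: fB.
have mu0 := cabs_ge0 mu.
have dr : 0 < rho' - rho by lra.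
have : 2 * `|X - ln eta| <= (X - m) * (rho' - rho).
  by rewrite -ler_pdivrMr//; lra.
have : (X - m) * (rho' - rho) <= - (ln (cabs (f 0)) - X) * (rho' - cabs mu).
  have := normr_ge0 (X - ln eta) => n0.
  have q0 : 0 <= 2 * `|X - ln eta| / (rho' - rho) by apply: divr_ge0; lra.
  have Xm : 0 <= X - m by lra.
  apply: ler_pM; lra.
have : - (ln (cabs (f mu)) - X) * (rho' + cabs mu) <= - (ln (cabs (f mu)) - X) * 2.
  by apply: ler_wpM2l; rewrite ?/X; lra.
move=> A1 A2 A3.
have : ln (cabs (f mu)) <= ln eta by have := ler_norm (X - ln eta); lra.
rewrite ler_ln ?posrE ?cabs_gt0 ?f0// => fe.
by move: fe; rewrite cabsM cabsV ler_pdivrMr// p0.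
Qed.

(** The normalisation at mu = 0 by a real logarithm singles out the branch whose
imaginary part measures the rotation accumulated along the motion. *)
Lemma motion_log z r : 0 < r -> exists g, [/\ holo 1 g, g 0 = (ln r)%:C &
  forall mu, cabs mu < 1 -> cexp (g mu) = Phi mu (z + r%:C) - Phi mu z].
Proof.
move=> r0; apply: holo_log => //; first exact: motion_diff_holo.
  move=> mu mu1; apply: motion_neq => //.
  by rewrite addrC -subr_eq0 addrK -cabs_gt0 cabs_real gtr0_norm.
by rewrite cexp_real lnK ?posrE// !motion0 addrAC subrr add0r.
Qed.

(** For r close to r0 the ratio of the two differences is close to 1 for all
mu with |mu| <= rho, so G_r - G_r0 has small real part there. Borel-Caratheodory
then controls its imaginary part, which is 0 at the centre. *)
Lemma motion_log_cont z l r0 (G : R -> C -> C) : cabs l < 1 -> 0 < r0 ->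
  (forall r, 0 < r -> [/\ holo 1 (G r), G r 0 = (ln r)%:C &
    forall mu, cabs mu < 1 -> cexp (G r mu) = Phi mu (z + r%:C) - Phi mu z]) ->
  forall e, 0 < e -> exists2 d : R, 0 < d & forall r, 0 < r -> `|r - r0| < d ->
    cabs (G r l - G r0 l) <= e.
Proof.
move=> l1 r00 HG e e0; pose rho := (1 + cabs l) / 2.
have l0 := cabs_ge0 l.
have rho1 : rho < 1 by rewrite /rho; lra.
have lrho : cabs l < rho by rewrite /rho; lra.
have rl : 0 < rho - cabs l by lra.
pose K := 8 / (rho - cabs l) + 2.
have K0 : 0 < K by rewrite /K addr_gt0// divr_gt0.
pose eta := Num.min (1 / 2) (e / K).
have eta0 : 0 < eta by rewrite lt_min divr_gt0// divr_gt0.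
have eta1 : eta <= 1 / 2 by rewrite ge_min lexx.
have eta2 : eta * K <= e by rewrite -ler_pdivlMr// ge_min lexx orbT.
have [d d0 Hd] := @motion_equicontinuous rho eta ltac:(lra) rho1 eta0.
exists (Num.min (d * r0) (eta * r0)) => [|r rp]; first by rewrite lt_min !mulr_gt0.
rewrite lt_min => /andP[rd reta].
have [Gh G0 GE] := HG r rp; have [Gh0 G00 GE0] := HG r0 r00.
have zr0 : z + r0%:C != z by rewrite addrC -subr_eq0 addrK -cabs_gt0 cabs_real gtr0_norm.
(* Equicontinuity with base point z + r0 and reference point z. *)
have q mu : cabs mu <= rho -> cabs (cexp (G r mu - G r0 mu) - 1) <= eta.
  move=> mur; have mu1 : cabs mu < 1 by lra.
  rewrite cexpD cexpN GE// GE0//.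
  have nz := motion_neq mu1 zr0.
  have -> : (Phi mu (z + r%:C) - Phi mu z) / (Phi mu (z + r0%:C) - Phi mu z) - 1 =
    (Phi mu (z + r%:C) - Phi mu (z + r0%:C)) / (Phi mu (z + r0%:C) - Phi mu z) by field.
  rewrite cabsM cabsV ler_pdivrMr ?cabs_gt0// (cabs_distC (Phi mu (z + r0%:C))).
  apply: Hd => //.
  have -> : z + r%:C - (z + r0%:C) = (r - r0)%:C by rewrite rmorphB /=; ring.
  have -> : z - (z + r0%:C) = - r0%:C by ring.
  by rewrite cabsN !cabs_real (gtr0_norm r00) ltW.
have lnr : - (2 * eta) <= ln r - ln r0 <= 2 * eta.
  have b1 : r <= (1 + eta) * r0 by move: reta; rewrite ltr_norml; lra.
  have b2 : (1 - eta) * r0 <= r by move: reta; rewrite ltr_norml; lra.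
  have L1 : ln r <= ln (1 + eta) + ln r0.
    rewrite -lnM ?posrE//; last by lra.
    by rewrite ler_ln ?posrE// mulr_gt0//; lra.
  have L2 : ln (1 - eta) + ln r0 <= ln r.
    rewrite -lnM ?posrE//; last by lra.
    by rewrite ler_ln ?posrE// mulr_gt0//; lra.
  have L3 : ln (1 + eta) <= eta by apply: le_ln1Dx; lra.
  have L4 : - ln (1 - eta) <= 2 * eta.
    rewrite -lnV ?posrE; last by lra.
    have -> : (1 - eta)^-1 = 1 + eta / (1 - eta) by field; lra.
    have q0 : 0 <= eta / (1 - eta) by apply: divr_ge0; lra.
    apply: le_trans (le_ln1Dx _) _; first by lra.
    rewrite ler_pdivrMr; [nra|lra].
  lra.
have := @borel_caratheodory R rho (fun mu => G r mu - G r0 mu - (2 * eta)%:C) _ _ l lrho.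
rewrite G0 G00 !ReImE /= => H.
have {}H := H _ _.
have Hb : cabs (G r l - G r0 l - (2 * eta)%:C - ((ln r)%:C - (ln r0)%:C - (2 * eta)%:C)) * (rho - cabs l)
    <= 2 * cabs l * - (ln r - ln r0 - 2 * eta).
  apply: H.
    by apply: holoB; [apply: holoB; apply: holo_lt (ltW rho1) _|exact: holo_cst].
  move=> mu mur; rewrite !ReImE /=.
  have := q mu (ltW mur); have := lerB_cabs (cexp (G r mu - G r0 mu)) 1; rewrite cabs1 cabs_cexp !ReImE.
  have := expR_ge1Dx (complex.Re (G r mu) - complex.Re (G r0 mu)); lra.
have -> : G r l - G r0 l = (G r l - G r0 l - (2 * eta)%:C - ((ln r)%:C - (ln r0)%:C - (2 * eta)%:C))
    + (ln r - ln r0)%:C by rewrite rmorphB /=; ring.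
apply: le_trans (ler_cabsD _ _) _; rewrite cabs_real.
have : `|ln r - ln r0| <= 2 * eta by rewrite ler_norml.
have : cabs (G r l - G r0 l - (2 * eta)%:C - ((ln r)%:C - (ln r0)%:C - (2 * eta)%:C)) <= eta * (8 / (rho - cabs l)).
  rewrite mulrA ler_pdivlMr//; apply: le_trans Hb _.
  have : 2 * cabs l * - (ln r - ln r0 - 2 * eta) <= 2 * 1 * (4 * eta) by apply: ler_pM; lra.
  lra.
by move: eta2; rewrite /K mulrDr; lra.
Qed.

(** A continuous function with values in the multiples of 2 pi is constant. *)
Lemma cos1_const (v : R -> R) : (forall r, 0 < r -> cos (v r) = 1) ->
  (forall r0, 0 < r0 -> forall e, 0 < e -> exists2 d : R, 0 < d &
     forall r, 0 < r -> `|r - r0| < d -> `|v r - v r0| <= e) ->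
  forall r s, 0 < r -> 0 < s -> v r = v s.
Proof.
move=> v1 vc.
have sin0_ r : 0 < r -> sin (v r) = 0.
  move=> r0; apply/eqP; rewrite -sqrf_eq0; have := cos2Dsin2 (v r); rewrite v1// expr1n.
  by move=> E; apply/eqP; lra.
(* A value of modulus at most 1 and cosine 1 is 0. *)
have close r s : 0 < r -> 0 < s -> `|v r - v s| <= 1 -> v r = v s.
  move=> r0 s0 H; have E : cos `|v r - v s| = 1.
    have : cos (v r - v s) = 1 by rewrite cosB !v1// !sin0_// mulr1 mulr0 addr0.
    by have [/ger0_norm ->|/ltr0_norm ->] := leP 0 (v r - v s); rewrite ?cosN.
  apply/eqP; rewrite -subr_eq0 -normr_eq0; apply/negPn/negP => nz.
  have p2 := pi_ge2 R.
  have : cos `|v r - v s| < cos 0.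
    rewrite ltr_cos ?in_itv /= ?lexx ?normr_ge0 ?pi_ge0//=; first by rewrite lt_def nz normr_ge0.
    lra.
  by rewrite E cos0 ltxx.
move=> r s; wlog rs : r s / r < s.
  by move=> H r0 s0; have [/H|/H h|->] := ltgtP r s => //; [apply|rewrite h].
move=> r0 s0.
suff : v (r + (s - r)) = v r by rewrite subrKC.
have sr0 : 0 < s - r by lra.
apply: (@interval_induction R (fun x t : R => v (x + t) = v x) r (s - r)) => //.
  by move=> x t t0 H1; rewrite -addrA -splitr H1.
move=> a /andP[ra _]; have a0 : 0 < a by lra.
have [d d0 Hd] := vc a a0 1 ltr01.
exists (Num.min d a) => [|x t /andP[t0]]; first by rewrite lt_min d0.
rewrite lt_min => /andP[td ta] /andP[xa axt].
have H (y : R) : x <= y <= x + t -> v y = v a.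
  move=> xyt; apply: close => //; [lra|apply: Hd; [lra|]]; rewrite ltr_norml; lra.
by rewrite !H//; lra.
Qed.

Lemma log_branch_cont (f : C -> C) z (L : R -> C) r0 : log_branch f z L -> 0 < r0 ->
  forall e, 0 < e -> exists2 d : R, 0 < d & forall r, 0 < r -> `|r - r0| < d ->
    cabs (L r - L r0) <= e.
Proof.
move=> [Lc _] r00 e e0.
have := Lc; rewrite continuous_open_subspace; last exact: open_gt.
move=> /(_ r0); rewrite inE => /(_ r00)/cvgrPdist_le/(_ e%:C).
rewrite ltcR => /(_ e0) /nbhs_ballP[d /= d0 Hd]; exists d => // r rp rd.
have := Hd r; rewrite /ball /= distrC => /(_ rd).
by rewrite normr_cabs lecR cabs_distC.
Qed.

(** Both sides are continuous in r and are logarithms of the same function, so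
their difference takes values in the multiples of 2 pi i. *)
Lemma log_branch_shift z l (L : R -> C) (G : R -> C -> C) : cabs l < 1 ->
  log_branch (Phi l) z L ->
  (forall r, 0 < r -> [/\ holo 1 (G r), G r 0 = (ln r)%:C &
    forall mu, cabs mu < 1 -> cexp (G r mu) = Phi mu (z + r%:C) - Phi mu z]) ->
  exists c : R, forall r, 0 < r -> complex.Im (L r) = complex.Im (G r l) + c.
Proof.
move=> l1 HL HG.
pose v r := complex.Im (L r) - complex.Im (G r l).
have vE : forall r s, 0 < r -> 0 < s -> v r = v s.
  apply: cos1_const.
    move=> r r0; have [_ _ /(_ l l1) GE] := HG r r0; have [_ /(_ r r0) LE] := HL.
    have : cexp (L r - G r l) = 1.
      by rewrite cexpD LE -GE cexpN divff// cexp_neq0.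
    move=> E; have := cabs_cexp (L r - G r l); rewrite E cabs1 => E1.
    move: E => /(congr1 (@complex.Re R)); rewrite /cexp -E1 mul1r /= /v.
    by rewrite !ReImE.
  move=> r0 r00 e e0; have e2 : 0 < e / 2 by lra.
  have [d1 d10 H1] := log_branch_cont HL r00 e2.
  have [d2 d20 H2] := motion_log_cont l1 r00 HG e2.
  exists (Num.min d1 d2) => [|r rp]; first by rewrite lt_min d10.
  rewrite lt_min => /andP[/(H1 r rp) {}H1 /(H2 r rp) {}H2].
  have -> : v r - v r0 = complex.Im (L r - L r0) - complex.Im (G r l - G r0 l).
    by rewrite !ReImE /v; ring.
  apply: le_trans (ler_normB _ _) _.
  have := cabs_Im (L r - L r0); have := cabs_Im (G r l - G r0 l); lra.
exists (v 1) => r r0; rewrite -(vE r 1 r0 ltr01) /v; ring.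
Qed.

End Motions.

(** * Packing bound for separated points *)

Section Packing.
Variable R : realType.
Local Notation C := R[i].

(** The squares with centres c_i and sides 2 s_i are disjoint, because one of the
two coordinates of c_i - c_j is at least half of its modulus; compare areas. *)
Lemma square_packing n (c : 'I_n -> C) (s : 'I_n -> R) (M : R) :
  (forall i, 0 < s i) -> (forall i, cabs (c i) + s i <= M) ->
  (forall i j, i != j -> 2 * (s i + s j) <= cabs (c i - c j)) ->
  \sum_i s i ^+ 2 <= M ^+ 2.
Proof.
move=> s0 cM sep.
case: n c s s0 cM sep => [|n] c s s0 cM sep; first by rewrite big_ord0 sqr_ge0.
have M0 : 0 < M by have := cM ord0; have := s0 ord0; have := cabs_ge0 (c ord0); lra.
pose I (x t : R) : set R := `](x - t), (x + t)[%classic.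
have mI x t : measurable (I x t) by exact: measurable_itv.
have muI x t : 0 < t -> lebesgue_measure (I x t) = (2 * t)%:E.
  move=> t0; rewrite lebesgue_measure_itv /= lte_fin ifT; last by lra.
  by rewrite EFinN -EFinB; congr _%:E; ring.
pose mu := (@lebesgue_measure R \x @lebesgue_measure R)%E.
pose F i := I (complex.Re (c i)) (s i) `*` I (complex.Im (c i)) (s i).
have muX x y t : 0 < t -> mu (I x t `*` I y t) = (4 * t ^+ 2)%:E.
  move=> t0; transitivity (lebesgue_measure (I x t) * lebesgue_measure (I y t))%E.
    by apply: product_measure1E; exact: mI.
  by rewrite !muI// -EFinM; congr _%:E; ring.
have mF i : measurable (F i) by apply: measurableX; exact: mI.
have muF i : mu (F i) = (4 * s i ^+ 2)%:E.
  exact: muX.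
have tF : trivIset [set: 'I_n.+1] F.
  apply/trivIsetP => i j _ _ ij; rewrite -subset0 /F /I => -[x y] /=.
  rewrite !in_itv /= => -[[/andP[x1 x2] /andP[y1 y2]] [/andP[x3 x4] /andP[y3 y4]]].
  have := sep i j ij; apply/negP; rewrite -ltNge; apply: le_lt_trans (cabs_le_ReIm _) _.
  rewrite !ReImE.
  have : `|complex.Re (c i) - complex.Re (c j)| < s i + s j by rewrite ltr_norml; lra.
  have : `|complex.Im (c i) - complex.Im (c j)| < s i + s j by rewrite ltr_norml; lra.
  lra.
have : (mu (\big[setU/set0]_(i < n.+1) F i) <= mu (I 0%R M `*` I 0%R M))%E.
  apply: le_measure; rewrite ?inE.
  - by apply: bigsetU_measurable => i _; exact: mF.
  - by apply: measurableX; exact: mI.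
  - rewrite -bigcup_seq /F /I => -[x y] [i _] /=; rewrite !in_itv /= => -[/andP[x1 x2] /andP[y1 y2]].
    have := cM i; have := cabs_Re (c i); have := cabs_Im (c i); rewrite !ler_norml.
    by move=> /andP[? ?] /andP[? ?] ?; split; apply/andP; split; lra.
have -> : mu (\big[setU/set0]_(i < n.+1) F i) = (\sum_(i < n.+1) mu (F i))%E.
  exact: measure_bigsetU_ord.
rewrite (eq_bigr _ (fun i _ => muF i)) muX//.
rewrite sumEFin lee_fin -mulr_sumr.
by rewrite ler_pM2l.
Qed.

Variable Phi : C -> C -> C.
Hypothesis Phi_motion : holomorphic_motion [set: C] Phi.

(** The constant depends on rho and M but not on the number of points: by
quasisymmetry the images of the z_i are separated in proportion to the moduli of
the differences, and all of them stay in a bounded region. *)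
Lemma motion_packing (rho M : R) : 0 <= rho -> rho < 1 -> 0 <= M -> exists2 B : R, 0 < B &
  forall n (z : 'I_n -> C) (r : 'I_n -> R),
    (forall i, cabs (z i) <= M) -> (forall i, 0 < r i <= 1) ->
    (forall i j, i != j -> 2 * r i <= cabs (z i - z j)) ->
    forall mu, cabs mu <= rho ->
      \sum_i cabs (Phi mu (z i + (r i)%:C) - Phi mu (z i)) ^+ 2 <= B.
Proof.
move=> rho0 rho1 M0.
have [B B0 HB] := motion_quasisymmetric Phi_motion 1 rho0 rho1.
pose b : C := (M + 1)%:C.
have b0 : 0 != b by rewrite eq_sym -cabs_gt0 cabs_real gtr0_norm; lra.
have bE : cabs b = M + 1 by rewrite cabs_real ger0_norm//; lra.
have [|S S0 HS] := @compact_bounded R (fun mu => cabs (mu - 0) <= rho)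
   (fun mu => Phi mu b - Phi mu 0) (@cclosed_disk R 0 rho) (@cbounded_disk R 0 rho).
  move=> mu; rewrite subr0 => mur.
  have [|d /cderiv_cont//] := motion_diff_holo Phi_motion b 0 (z := mu); lra.
pose k := (4 * (B + 1))^-1.
have k0 : 0 < k by rewrite invr_gt0; lra.
have kB : k * B <= 1 / 4.
  have : k * (4 * (B + 1)) = 1 by rewrite /k mulVf// gt_eqF//; lra.
  by nra.
exists ((B * S + k * (2 * (B * S))) ^+ 2 / k ^+ 2).
  by rewrite divr_gt0// exprn_gt0// addr_gt0// !mulr_gt0.
move=> n z r zM r1 sep mu mur.
have mu1 : cabs mu < 1 by lra.
have rabs i : cabs ((r i)%:C : C) = r i.
  by rewrite cabs_real gtr0_norm//; have /andP[] := r1 i.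
pose phi i := Phi mu (z i + (r i)%:C) - Phi mu (z i).
have phi0 i : 0 < cabs (phi i).
  rewrite cabs_gt0 motion_neq// -subr_eq0 addrAC subrr add0r -cabs_gt0 rabs.
  by have /andP[] := r1 i.
have bnd w : cabs w <= M + 1 -> cabs (Phi mu w - Phi mu 0) <= B * S.
  move=> wM; apply: le_trans (HB 0 b w b0 _ mu mur) _; first by rewrite !subr0 mul1r bE.
  by rewrite ler_pM2l//; apply: HS; rewrite subr0.
have zb i : cabs (Phi mu (z i) - Phi mu 0) <= B * S by apply: bnd; have := zM i; lra.
have phib i : cabs (phi i) <= 2 * (B * S).
  have := bnd (z i + (r i)%:C); have := ler_cabsD (z i) (r i)%:C; rewrite rabs.
  have /andP[_ ri] := r1 i; have := zM i => H1 H2 H3.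
  have {}H3 := H3 ltac:(lra); have H4 := zb i.
  have -> : phi i = (Phi mu (z i + (r i)%:C) - Phi mu 0) - (Phi mu (z i) - Phi mu 0) by rewrite /phi; ring.
  have := ler_cabsB (Phi mu (z i + (r i)%:C) - Phi mu 0) (Phi mu (z i) - Phi mu 0); lra.
(* The reference distance is that of z_j to z_i, which exceeds r_i. *)
have half i j : i != j -> cabs (phi i) <= B * cabs (Phi mu (z i) - Phi mu (z j)).
  move=> ij; have ri0 : 0 < r i by have /andP[] := r1 i.
  have := sep i j ij => sij.
  rewrite (cabs_distC (Phi mu (z i)) (Phi mu (z j))); apply: HB => //.
    by rewrite -subr_eq0 -cabs_gt0; lra.
  by rewrite addrAC subrr add0r rabs mul1r cabs_distC; lra.
rewrite ler_pdivlMr ?exprn_gt0// mulr_suml.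
have := @square_packing n (fun i => Phi mu (z i) - Phi mu 0) (fun i => k * cabs (phi i)) (B * S + k * (2 * (B * S))).
under eq_bigr do rewrite exprMn mulrC.
apply.
- by move=> i; rewrite mulr_gt0.
- by move=> i; apply: lerD => //; rewrite ler_pM2l.
- move=> i j ij.
  have -> : Phi mu (z i) - Phi mu 0 - (Phi mu (z j) - Phi mu 0) = Phi mu (z i) - Phi mu (z j) by ring.
  have h1 := half i j ij; have := half j i; rewrite eq_sym => /(_ ij).
  rewrite (cabs_distC (Phi mu (z j))); move: h1; set d := cabs (Phi mu (z i) - Phi mu (z j)) => h1 h2.
  have d0 : 0 <= d by exact: cabs_ge0.
  have := ler_wpM2l (ltW k0) h1; have := ler_wpM2l (ltW k0) h2.
  have := ler_wpM2r d0 kB; lra.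
Qed.

End Packing.

(** * Counting separated points at one scale *)

Section Counting.
Variable R : realType.
Local Notation C := R[i].

(** For X the right-hand side of the hypothesis, L |X + iq| = |(1 - a) + iq|. So
y < X makes L |y + iq| < |(1 - a) + iq| when y >= 0, with room for rho < 1 and
for errors e; when y < 0 no x lies between -e and y + e for small e. *)
Lemma exponent_gap (a q L y : R) : 0 < L -> L < 1 ->
  y < L^-1 * Num.sqrt ((1 - a) ^+ 2 + (1 - L ^+ 2) * q ^+ 2) ->
  exists e rho, [/\ 0 < e, L < rho < 1 & forall x, - e < x -> x < y + e ->
    L * (cabs (x +i* q) + e) < rho * (cabs ((1 - a) +i* q) - e)].
Proof.
move=> L0 L1; set X := L^-1 * _ => yX.
have L2 : 0 <= 1 - L ^+ 2 by nra.
have X0 : 0 <= X by rewrite mulr_ge0 ?sqrtr_ge0// invr_ge0 ltW.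
have XE : L * cabs (X +i* q) = cabs ((1 - a) +i* q).
  apply/eqP; rewrite -(@eqrXn2 _ 2) ?mulr_ge0 ?cabs_ge0 ?(ltW L0)//; apply/eqP.
  rewrite exprMn !cabs_sqr /= /X exprMn sqr_sqrtr; last first.
    by rewrite addr_ge0 ?sqr_ge0// mulr_ge0// sqr_ge0.
  by field; rewrite gt_eqF.
have [y0|y0] := ltP y 0.
  exists (- y / 3), ((1 + L) / 2); split; [lra|lra|].
  by move=> x x1 x2; lra.
have W : cabs (y +i* q) < cabs (X +i* q).
  rewrite -(@ltr_pXn2r _ 2) ?nnegrE ?cabs_ge0// !cabs_sqr /= ltrD2r.
  by rewrite ltr_pXn2r ?nnegrE.
set w := cabs (y +i* q) in W *; set v := cabs ((1 - a) +i* q) in XE *.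
have Lw : L * w < v by rewrite -XE ltr_pM2l.
have w0 : 0 <= w by exact: cabs_ge0.
have v0 : 0 < v by apply: le_lt_trans Lw; rewrite mulr_ge0// ltW.
pose m := (1 + Num.max L (L * w / v)) / 2.
have lm : Num.max L (L * w / v) < 1 by rewrite gt_max L1 /= ltr_pdivrMr// mul1r.
have l1 : L <= Num.max L (L * w / v) by rewrite le_max lexx.
have l2 : L * w / v <= Num.max L (L * w / v) by rewrite le_max lexx orbT.
have m1 : m < 1 by rewrite /m; lra.
have m2 : L < m by rewrite /m; lra.
have m3 : L * w < m * v by rewrite -ltr_pdivrMr// /m; lra.
pose e := (m * v - L * w) / 8.
exists e, m; split; [by rewrite /e; lra|by rewrite m2|].
move=> x x1 x2.
have e0 : 0 < e by rewrite /e; lra.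
have : cabs (x +i* q) <= w + e.
  apply: (@le_trans _ _ (cabs ((y + e) +i* q))).
    by apply: cabs_mono => //; rewrite (ger0_norm (_ : 0 <= y + e)) ?ler_norml; lra.
  have -> : (y + e) +i* q = y +i* q + e%:C by apply: complex_ext; rewrite /= ?addr0.
  by apply: le_trans (ler_cabsD _ _) _; rewrite cabs_real (gtr0_norm e0).
move=> xw; have : L * (cabs (x +i* q) + e) <= L * (w + e + e) by rewrite ler_pM2l// lerD2r.
have eE : 8 * e = m * v - L * w by rewrite /e; lra.
nra.
Qed.

(** The last two hypotheses are the negative real parts of F(0) and F(l) in
[motion_counting], and s * T - b <= lam expresses a large number of points; the
terms b and c are negligible because tau is large. *)
Lemma exponent_window (a e s T tau lam b c eta : R) :
  0 < tau -> T <= tau -> tau <= T + c -> 0 <= c ->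
  2 * (`|b| + `|s| * c) < e * tau -> s * T - b <= lam -> - (e / 2 * tau) <= eta ->
  lam - 2 * tau < 0 -> lam - 2 * (a * tau - eta) < 0 ->
  - e < 1 + a - lam / tau < 1 + a - s + e.
Proof.
move=> t0 Tt tT c0 Ke lamT et R0 Rl.
have bn := ler_norm b; have sn := normr_ge0 s.
have ecn : 0 <= `|b| + `|s| * c by rewrite addr_ge0// mulr_ge0.
have st : s * (tau - T) <= `|s| * c.
  apply: (@le_trans _ _ (`|s| * (tau - T))).
    by rewrite ler_wpM2r ?ler_norm// subr_ge0.
  by rewrite ler_wpM2l// lerBlDl.
(* The upper bound is half the sum of R0 and Rl. *)
have up : lam / tau < 1 + a + e.
  have : 0 < e * tau by apply: le_lt_trans Ke; rewrite mulr_ge0.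
  by rewrite ltr_pdivrMr//; lra.
have lo : s - e < lam / tau by rewrite ltr_pdivlMr//; lra.
by apply/andP; split; lra.
Qed.

Variable Phi : C -> C -> C.
Hypothesis Phi_motion : holomorphic_motion [set: C] Phi.

(** The exponents a of stretching and g of rotation enter as the single complex
exponent a + i a g, and G is the logarithm that is continuous in the parameter
of the motion, in place of the one that is continuous in r. *)
Definition scale_witness (l : C) (a g e : R) (z : C) (r : R) : Prop :=
  exists G : C -> C, [/\ holo 1 G, G 0 = (ln r)%:C,
    forall mu, cabs mu < 1 -> cexp (G mu) = Phi mu (z + r%:C) - Phi mu z &
    cabs (G l - (a +i* (a * g)) * (ln r)%:C) <= e * `|ln r|].

(** The Schwarz-Pick inequality for the average F of the logarithms, as explained
at the beginning. Here exp(-T) is the scale, tau the average of the -ln r_i, and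
all quantities are divided by tau: F(0) = (1 + a - x - 2) tau for the number x
that is compared with 1 + a - s by [exponent_gap]. *)
Lemma motion_counting (l : C) (a g s : R) : 0 < cabs l -> cabs l < 1 ->
  1 + a - (cabs l)^-1 * Num.sqrt ((1 - a) ^+ 2 + (1 - cabs l ^+ 2) * a ^+ 2 * g ^+ 2) < s ->
  exists2 e, 0 < e & forall M, 0 <= M -> exists K : R, 0 < K /\
    forall (T : R) n (z : 'I_n -> C) (r : 'I_n -> R), K <= T -> (0 < n)%N ->
      (forall i, cabs (z i) <= M) ->
      (forall i, expR (- T) / 2 < r i <= expR (- T)) ->
      (forall i j, i != j -> 2 * expR (- T) <= cabs (z i - z j)) ->
      (forall i, scale_witness l a g e (z i) (r i)) ->
      ln (n%:R) < s * T.
Proof.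
move=> l0 l1 Hs.
have [|e [rho [e0 /andP[lrho rho1] gap]]] := @exponent_gap a (- (a * g)) (cabs l) (1 + a - s) l0 l1.
  have -> : (1 - cabs l ^+ 2) * (- (a * g)) ^+ 2 = (1 - cabs l ^+ 2) * a ^+ 2 * g ^+ 2 by ring.
  lra.
exists (e / 2) => [|M M0]; first by lra.
have rho0 : 0 < rho by lra.
have [B B0 HB] := motion_packing Phi_motion (ltW rho0) rho1 M0.
pose B' := B + 1; have B'0 : 0 < B' by rewrite /B'; lra.
pose K := 1 + 2 * (`|ln B'| + `|s| * ln 2) / e.
have ln20 : 0 < ln (2 : R) by rewrite ln_gt0//; lra.
have K1 : 1 <= K.
  rewrite /K lerDl divr_ge0 ?(ltW e0)// mulr_ge0// addr_ge0// mulr_ge0// ltW//.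
exists K; split=> [|T n z r KT n0 zM rT sep wit]; first by lra.
have T0 : 0 < T by lra.
rewrite ltNge; apply/negP => nbig.
have r0 i : 0 < r i.
  by have /andP[ri _] := rT i; apply: lt_trans ri; rewrite divr_gt0// expR_gt0.
have lnr i : - (T + ln 2) <= ln (r i) <= - T.
  have /andP[r1 r2] := rT i; apply/andP; split.
    rewrite -ler_expR opprD expRD (expRN (ln 2)) !lnK ?posrE//.
    exact: ltW.
  by rewrite -ler_expR lnK ?posrE.
have [G HG] := choice wit.
have n0R : 0 < n%:R :> R by rewrite ltr0n.
pose tau := - (n%:R^-1 * \sum_i ln (r i)).
have nK (x : R) : n%:R^-1 * \sum_(i < n) x = x.
  by rewrite sumr_const card_ord -[x *+ n]mulr_natl mulrA mulVf ?mul1r// gt_eqF.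
have tau1 : T <= tau.
  rewrite /tau lerNr -[leRHS]nK ler_pM2l ?invr_gt0//.
  by apply: ler_sum => i _; have /andP[] := lnr i.
have tau2 : tau <= T + ln 2.
  rewrite /tau lerNl -[leLHS]nK ler_pM2l ?invr_gt0//.
  by apply: ler_sum => i _; have /andP[] := lnr i.
have tau0 : 0 < tau by lra.
pose lam := ln n%:R - ln B'.
pose F mu := (2 * n%:R^-1)%:C * \sum_i G i mu + lam%:C.
have Fh : holo rho F.
  apply: holoD; last exact: holo_cst.
  apply: holoM; first exact: holo_cst.
  move=> mu mur.
  have ex i : exists d, cderiv (G i) mu d.
    by have [Gh _ _ _] := HG i; apply: Gh; lra.
  by have [d Hd] := choice ex; eexists; exact: cderiv_sum Hd.
have ReS (x : 'I_n -> C) : complex.Re (\sum_i x i) = \sum_i complex.Re (x i).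
  by apply: (big_morph _ (@ReD R)).
(* Concavity of the logarithm, in the form ln x <= x - 1 for x = n |phi_i|^2 / B'. *)
have Fneg mu : cabs mu < rho -> complex.Re (F mu) < 0.
  move=> mur; rewrite /F !ReImE /= ReS mul0r subr0.
  have mu1 : cabs mu < 1 by lra.
  pose p i := cabs (Phi mu (z i + (r i)%:C) - Phi mu (z i)).
  have ReG i : complex.Re (G i mu) = ln (p i).
    by have [_ _ GE _] := HG i; rewrite /p -GE// cabs_cexp expRK.
  have p0 i : 0 < p i by have [_ _ GE _] := HG i; rewrite /p -GE// cabs_cexp expR_gt0.
  have packB : \sum_i p i ^+ 2 <= B.
    apply: HB (ltW mur) => // i.
      have /andP[_ ri] := rT i; rewrite r0 (le_trans ri)// -expR0 ler_expR; lra.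
    move=> j ij; apply: le_trans (sep i j ij); rewrite ler_pM2l//.
    by have /andP[] := rT i.
  have jensen i : 2 * ln (p i) + lam <= n%:R * p i ^+ 2 / B' - 1.
    have -> : 2 * ln (p i) + lam = ln (n%:R * p i ^+ 2 / B').
      rewrite lnM ?posrE ?mulr_gt0 ?exprn_gt0 ?invr_gt0// lnM ?posrE ?exprn_gt0//.
      by rewrite lnXn// lnV ?posrE// /lam -mulr_natl; ring.
    set x := n%:R * p i ^+ 2 / B'.
    have x0 : 0 < x by rewrite /x !mulr_gt0 ?exprn_gt0 ?invr_gt0.
    by have := @le_ln1Dx R (x - 1); rewrite subrKC; apply; lra.
  have -> : 2 / n%:R * \sum_i complex.Re (G i mu) + lam = n%:R^-1 * \sum_i (2 * ln (p i) + lam).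
    rewrite big_split /= mulrDr nK -mulr_sumr mulrA [n%:R^-1 * 2]mulrC.
    by congr (_ * _ + _); apply: eq_bigr => i _; rewrite ReG.
  apply: (@le_lt_trans _ _ (n%:R^-1 * \sum_i (n%:R * p i ^+ 2 / B' - 1))).
    by rewrite ler_pM2l ?invr_gt0//; apply: ler_sum => i _.
  rewrite big_split /= mulrDr nK.
  have -> : n%:R^-1 * \sum_i (n%:R * p i ^+ 2 / B') = (\sum_i p i ^+ 2) / B'.
    rewrite -mulr_suml -mulr_sumr; field; rewrite !gt_eqF//.
  rewrite subr_lt0 ltr_pdivrMr// /B'; lra.
have F0 : F 0 = (lam - 2 * tau)%:C.
  rewrite /F (eq_bigr (fun i => (ln (r i))%:C)); last by move=> i _; have [_ ->] := HG i.
  rewrite -rmorph_sum -rmorphM -rmorphD /=; congr _%:C; rewrite /tau; ring.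
pose w : C := a +i* (a * g).
pose eta := (n%:R^-1)%:C * \sum_i (G i l - w * (ln (r i))%:C).
have etaB : cabs eta <= e / 2 * tau.
  rewrite /eta cabsM cabs_real (gtr0_norm (_ : 0 < n%:R^-1)) ?invr_gt0//.
  have -> : e / 2 * tau = n%:R^-1 * \sum_i (e / 2 * `|ln (r i)|).
    rewrite -mulr_sumr /tau mulrCA -mulrN -sumrN; congr (_ * (_ * _)).
    by apply: eq_bigr => i _; rewrite ler0_norm//; have /andP[] := lnr i; lra.
  rewrite ler_pM2l ?invr_gt0//; apply: le_trans (cabs_sum _ _ _) _.
  by apply: ler_sum => i _; have [_ _ _] := HG i.
have FlE : F l = lam%:C - 2 * (w * tau%:C - eta).
  rewrite /F /eta big_split /= sumrN -mulr_sumr -rmorph_sum /tau.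
  rewrite rmorphN !rmorphM /= rmorph_nat; ring.
move: eta etaB FlE => eta etaB FlE.
have lr : cabs l < rho by [].
have SP := schwarz_pick Fh Fneg lr.
have Rl := Fneg l lr.
have R0 : complex.Re (F 0) < 0 by apply: Fneg; rewrite cabs0.
pose x := 1 + a - lam / tau.
have et : - (e / 2 * tau) <= complex.Re eta.
  by have := le_trans (cabs_Re eta) etaB; rewrite ler_norml => /andP[].
have lt1 : lam = (1 + a - x) * tau by rewrite /x; field; rewrite gt_eqF.
have Ke : 2 * (`|ln B'| + `|s| * ln 2) < e * tau.
  rewrite [e * tau]mulrC -ltr_pdivrMr//; apply: lt_le_trans (le_trans KT tau1).
  by rewrite /K ltrDr.
have lamT : s * T - ln B' <= lam by rewrite lerB.
have /andP[x1 x2] : - e < x < 1 + a - s + e.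
  apply: (exponent_window tau0 tau1 tau2 (ltW ln20) Ke lamT et).
    by rewrite F0 in R0.
  have <- : complex.Re (F l) = lam - 2 * (a * tau - complex.Re eta) by rewrite FlE /w !ReImE /=; ring.
  exact: Rl.
have := gap x x1 x2; apply/negP; rewrite -leNgt.
have tC : cabs (tau%:C : C) = tau by rewrite cabs_real gtr0_norm.
have c2 : cabs (2 : C) = 2 by rewrite -(rmorph_nat (real_complex R)) cabs_real ger0_norm.
have F0C : F 0 = lam%:C - 2 * tau%:C.
  rewrite F0; have -> : 2 * tau%:C = (2 * tau)%:C :> C by rewrite rmorphM rmorph_nat.
  by apply: complex_ext; rewrite !ReImE /=; ring.
have lamC : lam%:C = (1 + a%:C - x%:C) * tau%:C :> C.
  by rewrite lt1; apply: complex_ext; rewrite !ReImE /=; ring.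
have eta2 : 2 * cabs eta <= 2 * tau * e.
  apply: le_trans (ler_wpM2l (ler0n R 2) etaB) _.
  by rewrite [e / 2 * tau]mulrC !mulrA ler_piMr ?invf_le1 ?ler1n// !mulr_ge0 ?(ltW tau0) ?(ltW e0).
have D1 : 2 * tau * (cabs ((1 - a) +i* - (a * g)) - e) <= cabs (F l - F 0).
  have -> : F l - F 0 = 2 * tau%:C * ((1 - a) +i* - (a * g)) + 2 * eta.
    have -> : (1 - a) +i* - (a * g) = 1 - w by apply: complex_ext; rewrite !ReImE /=; ring.
    by rewrite FlE F0C; ring.
  apply: le_trans (lerB_cabsD _ _); rewrite !cabsM c2 tC.
  by rewrite mulrBr lerD2l lerN2.
have D2 : cabs (F l + (F 0)^*%C) <= 2 * tau * (cabs (x +i* - (a * g)) + e).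
  have -> : F l + (F 0)^*%C = - (2 * tau%:C * (x +i* (a * g))) + 2 * eta.
    have -> : x +i* (a * g) = x%:C + w - a%:C by apply: complex_ext; rewrite !ReImE /=; ring.
    by rewrite F0 conjc_real -F0 FlE F0C lamC; ring.
  apply: le_trans (ler_cabsD _ _) _; rewrite cabsN !cabsM c2 tC.
  have -> : cabs (x +i* - (a * g)) = cabs (x +i* (a * g)) by rewrite -[LHS]cabs_conj /= opprK.
  by rewrite mulrDr lerD2l.
have t2 : 0 < 2 * tau by rewrite mulr_gt0.
rewrite -(ler_pM2l t2) mulrCA [leRHS]mulrCA.
apply: le_trans (ler_wpM2l (ltW rho0) D1) _.
by rewrite mulrC; apply: le_trans SP (ler_wpM2l (cabs_ge0 l) D2).
Qed.

End Counting.

(** * Covers and the vanishing of Hausdorff measure *)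

Section Hausdorff.
Variable R : realType.
Local Notation C := R[i].
Local Open Scope ereal_scope.
Implicit Types (A U : set C) (s d : R).

Lemma diam_ge0 U : 0 <= diam U.
Proof. by apply: ereal_sup_ubound; left. Qed.

Lemma diam_pow_ge0 s U : 0 <= diam_pow s U.
Proof. by rewrite /diam_pow; case: pselect => ? //; exact: poweR_ge0. Qed.

Lemma diam_le U d : (0 <= d)%R -> (forall z w, U z -> U w -> (cabs (z - w) <= d)%R) ->
  diam U <= d%:E.
Proof.
move=> d0 H; apply: ge_ereal_sup => x [->|[[z w] [/= Uz Uw] <-]]; rewrite lee_fin//.
exact: H.
Qed.

Lemma diam_pow_le s U d : (0 <= s)%R -> (0 <= d)%R -> diam U <= d%:E ->
  diam_pow s U <= (d `^ s)%:E.
Proof.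
move=> s0 d0 Ud; rewrite /diam_pow; case: pselect => ?; first by rewrite lee_fin powR_ge0.
by rewrite -poweR_EFin; apply: gt0_ler_poweR; rewrite ?in_itv /= ?leey ?andbT ?diam_ge0// lee_fin.
Qed.

Definition has_cover s d (b : \bar R) A := exists U : nat -> set C,
  [/\ A `<=` \bigcup_i U i, forall i, diam (U i) <= d%:E
    & \sum_(0 <= i <oo) diam_pow s (U i) <= b].

(** Countable subadditivity, by enumerating a double sequence of sets. *)
Lemma has_cover_bigcup s d (b : nat -> \bar R) (A : nat -> set C) :
  (forall n, has_cover s d (b n) (A n)) ->
  has_cover s d (\sum_(0 <= n <oo) b n) (\bigcup_n A n).
Proof.
move=> Acov; have [U HU] := choice Acov.
have /card_esym/ppcard_eqP[f] := card_nat2.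
exists (fun n => U (f n).1 (f n).2); split.
- move=> z [n _ Anz]; have [cov _ _] := HU n; have [k _ Uz] := cov z Anz.
  by exists (f^-1%FUN (n, k)) => //=; rewrite invK ?inE.
- by move=> i; have [_ Ud _] := HU (f i).1; exact: Ud.
rewrite nneseries_esumT; last by move=> n; exact: diam_pow_ge0.
have fbij : set_bij [set: nat] [set: nat * nat] f by exact: bij.
rewrite -(@reindex_esum R _ _ [set: nat] [set: nat * nat] f (fun p => diam_pow s (U p.1 p.2)))//.
have -> : [set: nat * nat] = [set: nat] `*`` (fun=> [set: nat]).
  by apply/seteqP; split.
rewrite -(@esum_esum R _ _ [set: nat] (fun=> [set: nat]) (fun i j => diam_pow s (U i j))); last first.
  by move=> i j _ _; exact: diam_pow_ge0.
rewrite -nneseries_esumT; last by move=> n; apply: esum_ge0 => k _; exact: diam_pow_ge0.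
apply: lee_nneseries => n *; first by apply: esum_ge0 => k _; exact: diam_pow_ge0.
rewrite -nneseries_esumT; last by move=> k; exact: diam_pow_ge0.
by have [_ _] := HU n.
Qed.

Lemma has_cover_sub s d b b' A A' : A' `<=` A -> b <= b' ->
  has_cover s d b A -> has_cover s d b' A'.
Proof.
move=> AA bb [U [H1 H2 H3]]; exists U; split => //; first exact: subset_trans H1.
exact: le_trans bb.
Qed.

Lemma nneseries_le_bound (u : nat -> \bar R) (b : \bar R) : (forall n, 0 <= u n) ->
  (forall m, \sum_(0 <= i < m) u i <= b) -> \sum_(0 <= i <oo) u i <= b.
Proof.
move=> u0 ub; apply: lime_le; first exact: is_cvg_nneseries.
by apply: nearW => m.
Qed.

Lemma has_cover_finite s d n (V : 'I_n -> set C) A : (0 <= s)%R -> (0 <= d)%R ->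
  A `<=` [set z | exists i, V i z] -> (forall i, diam (V i) <= d%:E) ->
  has_cover s d (n%:R * d `^ s)%:E A.
Proof.
move=> s0 d0 AV Vd.
pose U i := if insub i is Some j then V j else set0 : set C.
have U0 i : diam (U i) <= d%:E.
  rewrite /U; case: insubP => [j _ _|_]; first exact: Vd.
  by apply: diam_le.
exists U; split=> // [z /AV[i Viz]|]; first by exists i => //; rewrite /U valK.
apply: nneseries_le_bound => [i|m]; first exact: diam_pow_ge0.
apply: (@le_trans _ _ (\sum_(0 <= i < m) (if (i < n)%N then d `^ s else 0%R)%:E)).
  apply: lee_sum => i _; rewrite /U; case: insubP => [j ji _|/negbTE ->].
    by rewrite ji; exact: diam_pow_le.
  by rewrite /diam_pow; case: pselect.
rewrite sumEFin lee_fin.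
suff -> : (\sum_(0 <= i < m) (if (i < n)%N then d `^ s else 0%R) = (minn m n)%:R * d `^ s)%R.
  by rewrite ler_wpM2r ?powR_ge0// ler_nat geq_minr.
elim: m => [|m IH]; first by rewrite big_nil min0n mul0r.
rewrite big_nat_recr //= IH; case: ltnP => mn.
  by rewrite (minn_idPl mn) ?(minn_idPl (ltnW mn)) -natr1 mulrDl mul1r.
by rewrite ?(minn_idPr mn) (minn_idPr (leqW mn)) addr0.
Qed.

Lemma hausdorff_measure_eq0 s A :
  (forall d e, (0 < d)%R -> (0 < e)%R -> has_cover s d e%:E A) -> hausdorff_measure s A = 0.
Proof.
move=> H; have pre0 d : (0 < d)%R -> hausdorff_premeasure s d A = 0.
  move=> d0; apply/le_anti/andP; split.
    apply/lee_addgt0Pr => e e0; rewrite add0e.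
    have [U [H1 H2 H3]] := H d e d0 e0.
    by apply: le_trans H3; apply: ereal_inf_lbound; exists U.
  apply: le_ereal_inf_tmp => _ [U _ <-]; apply: nneseries_ge0 => n _ _.
  exact: diam_pow_ge0.
apply/le_anti/andP; split.
  by apply: ge_ereal_sup => _ [d /= d0 <-]; rewrite pre0.
by apply: ereal_sup_ubound; exists 1%R; rewrite /= ?pre0.
Qed.

Lemma geometric_tail (c t e : R) : (0 <= c)%R -> (0 < t)%R -> (0 < e)%R ->
  exists K : nat, forall k, (K <= k)%N ->
    \sum_(0 <= i <oo) (c * expR (- ((k + i)%:R * t)))%:E <= e%:E.
Proof.
move=> c0 t0 e0; pose q := expR (- t).
have q0 : (0 < q)%R by exact: expR_gt0.
have q1 : (q < 1)%R by rewrite -expR0 ltr_expR oppr_lt0.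
have q10 : (0 < 1 - q)%R by rewrite subr_gt0.
exists (Num.truncn (c / (1 - q) / e / t)).+1 => k Kk.
have kt : (c / (1 - q) / e < k%:R * t)%R.
  by rewrite -ltr_pdivrMr//; apply: lt_le_trans (truncnS_gt _) _; rewrite ler_nat.
have qk : (c / (1 - q) * expR (- (k%:R * t)) <= e)%R.
  rewrite expRN ler_pdivrMr ?expR_gt0// [leRHS]mulrC -ler_pdivrMr//.
  by apply: (le_trans (ltW kt)); apply: le_trans (expR_ge1Dx _); rewrite lerDr.
apply: le_trans (_ : _ <= (c / (1 - q) * expR (- (k%:R * t)))%:E) _; last by rewrite lee_fin.
apply: nneseries_le_bound => [i|m]; first by rewrite lee_fin mulr_ge0// expR_ge0.
rewrite sumEFin lee_fin.
suff : (\sum_(0 <= i < m) (c * expR (- ((k + i)%:R * t))) =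
    c / (1 - q) * expR (- (k%:R * t)) * (1 - q ^+ m))%R.
  move=> ->; rewrite ler_piMr//; last by rewrite gerBl exprn_ge0// ltW.
  by rewrite !mulr_ge0 ?expR_ge0// invr_ge0 ltW.
elim: m => [|m IH]; first by rewrite big_nil expr0 subrr mulr0.
rewrite big_nat_recr //= IH natrD mulrDl opprD expRD.
have -> : expR (- (m%:R * t)) = (q ^+ m)%R by rewrite /q -expRM_natl mulrN.
by rewrite exprS; field; rewrite gt_eqF.
Qed.

End Hausdorff.

(** * Maximal separated families *)

Section SeparatedFamilies.
Variable R : realType.
Local Notation C := R[i].

(** A separated family of maximal size cannot be enlarged, so every point is close to one of its members. *)
Lemma separated_cover (A : set C) (d : R) (N : nat) :
  (forall n (z : 'I_n -> C), (forall i, A (z i)) ->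
     (forall i j, i != j -> d <= cabs (z i - z j)) -> (n <= N)%N) ->
  exists n (z : 'I_n -> C), [/\ forall i, A (z i), forall i j, i != j -> d <= cabs (z i - z j)
    & forall w, A w -> exists i, cabs (w - z i) < d].
Proof.
move=> Nmax.
pose P n := `[< exists z : 'I_n -> C, (forall i, A (z i)) /\
   (forall i j, i != j -> d <= cabs (z i - z j)) >].
have P0 : exists n, P n.
  by exists 0%N; apply/asboolP; exists (fun=> 0); split => -[].
have PN n : P n -> (n <= N)%N by move=> /asboolP[z [H1 H2]]; exact: Nmax H1 H2.
case: (ex_maxnP P0 PN) => n /asboolP[z [H1 H2]] nmax.
exists n, z; split => // w Aw; apply: contrapT => H.
have far i : d <= cabs (w - z i) by rewrite leNgt; apply/negP => wz; apply: H; exists i.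
suff /nmax : P n.+1 by rewrite ltnn.
apply/asboolP; exists (fun i => if unlift ord0 i is Some j then z j else w); split.
  by move=> i; case: (unlift ord0 i).
move=> i j; case: (unliftP ord0 i) => [i' ->|->]; case: (unliftP ord0 j) => [j' ->|->].
- by move=> ij; apply: H2; apply: contraNneq ij => ->.
- by rewrite cabs_distC.
- by [].
- by rewrite eqxx.
Qed.

End SeparatedFamilies.

(** * From stretching and rotation to logarithms in the motion parameter *)

Section Witness.
Variable R : realType.
Local Notation C := R[i].
Variable Phi : C -> C -> C.
Hypothesis Phi_motion : holomorphic_motion [set: C] Phi.

Lemma scale_witness_small (l z : C) (a g : R) (r : nat -> R) (L : R -> C) :
  cabs l < 1 -> 0 < a -> (forall j, 0 < r j) -> r j @[j --> \oo] --> (0 : R) ->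
  ln (cabs (Phi l (z + (r j)%:C) - Phi l z)) / ln (r j) @[j --> \oo] --> a ->
  log_branch (Phi l) z L ->
  complex.Im (L (r j)) / ln (cabs (Phi l (z + (r j)%:C) - Phi l z)) @[j --> \oo] --> g ->
  forall e t, 0 < e -> 0 < t -> exists2 x : R, 0 < x < t & scale_witness Phi l a g e z x.
Proof.
move=> l1 a0 rp r0 st HL rot e t e0 t0.
have exG (x : R) : exists G : C -> C, 0 < x -> [/\ holo 1 G, G 0 = (ln x)%:C &
    forall mu, cabs mu < 1 -> cexp (G mu) = Phi mu (z + x%:C) - Phi mu z].
  have [x0|_] := boolP (0 < x); last by exists (fun=> 0).
  by have [G HG] := motion_log Phi_motion z x0; exists G.
have [G HG] := choice exG.
have [c Hc] := log_branch_shift Phi_motion l1 HL HG.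
pose p j := ln (cabs (Phi l (z + (r j)%:C) - Phi l z)).
(* At scales below m the constant c is at most (e / 4) |ln r|. *)
pose m := Num.min t (expR (- (4 * `|c| / e + 1))).
have m0 : 0 < m by rewrite lt_min t0 expR_gt0.
have e4 : 0 < e / 4 by lra.
have ea : 0 < Num.min (e / 4) (a / 2) by rewrite lt_min e4; lra.
have rs : complex.Im (L (r j)) / p j * (p j / ln (r j)) @[j --> \oo] --> g * a.
  exact: cvgM rot st.
have n1 : \forall j \near \oo, `|0 - r j| < m by have H := (cvgrPdist_lt _ _).1 r0; exact: H.
have n2 : \forall j \near \oo, `|a - p j / ln (r j)| < Num.min (e / 4) (a / 2).
  by have H := (cvgrPdist_lt _ _).1 st; exact: H.
have n3 : \forall j \near \oo, `|g * a - complex.Im (L (r j)) / p j * (p j / ln (r j))| < e / 4.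
  by have H := (cvgrPdist_lt _ _).1 rs; exact: H.
have [j [[j1 j2] j3]] := @filter_ex _ _ _ _ (filterI (filterI n1 n2) n3).
have rj0 := rp j.
rewrite sub0r normrN (gtr0_norm rj0) lt_min in j1.
have [rt rc] := andP j1.
have lnr : ln (r j) < - (4 * `|c| / e + 1).
  by rewrite -ltr_expR lnK ?posrE.
have q0 : 0 <= 4 * `|c| / e by rewrite !mulr_ge0 ?invr_ge0// ltW.
have lr0 : ln (r j) < 0 by lra.
have lrn : ln (r j) != 0 by rewrite lt_eqF.
exists (r j); first by rewrite rj0.
have [Gh G0 GE] := HG (r j) rj0.
exists (G (r j)); split => //.
have [j2a j2b] := andP (eq_ind _ is_true j2 _ (lt_min _ _ _)).
have pj0 : p j != 0.
  by apply: contraTneq j2b => ->; rewrite mul0r subr0 gtr0_norm// -leNgt; lra.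
have ReG : complex.Re (G (r j) l) = p j.
  by rewrite /p -GE// cabs_cexp expRK.
have ImG : complex.Im (G (r j) l) = complex.Im (L (r j)) - c by rewrite Hc//; ring.
have E3 : complex.Im (L (r j)) / p j * (p j / ln (r j)) = complex.Im (L (r j)) / ln (r j).
  by field; rewrite lrn pj0.
rewrite E3 in j3.
have A1 : `|p j - a * ln (r j)| <= e / 4 * `|ln (r j)|.
  have -> : p j - a * ln (r j) = - (a - p j / ln (r j)) * ln (r j) by field.
  by rewrite normrM normrN ler_wpM2r// ltW.
have A2 : `|complex.Im (L (r j)) - a * g * ln (r j)| <= e / 4 * `|ln (r j)|.
  have -> : complex.Im (L (r j)) - a * g * ln (r j) =
     - (g * a - complex.Im (L (r j)) / ln (r j)) * ln (r j) by field.
  by rewrite normrM normrN ler_wpM2r// ltW.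
have A3 : `|c| <= e / 4 * `|ln (r j)|.
  have -> : `|c| = e / 4 * (4 * `|c| / e) by field; rewrite gt_eqF.
  by rewrite (ltr0_norm lr0) ler_pM2l//; lra.
apply: le_trans (cabs_le_ReIm _) _.
rewrite !ReImE /= ReG ImG !mulr0 subr0 add0r.
have -> : complex.Im (L (r j)) - c - a * g * ln (r j) = (complex.Im (L (r j)) - a * g * ln (r j)) - c by ring.
have := ler_normB (complex.Im (L (r j)) - a * g * ln (r j)) c.
have := normr_ge0 (ln (r j)) => n0.
have : 0 <= e * `|ln (r j)| by rewrite mulr_ge0// ltW.
lra.
Qed.

End Witness.

(** * The dimension bound *)

Section DimensionBound.
Variable R : realType.
Local Notation C := R[i].
Variable Phi : C -> C -> C.
Hypothesis Phi_motion : holomorphic_motion [set: C] Phi.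
Variables (E : set C) (l : C) (a g : R).
Hypothesis l_gt0 : 0 < cabs l.
Hypothesis l_lt1 : cabs l < 1.
Hypothesis E_witness : forall z, E z -> forall e t : R, 0 < e -> 0 < t ->
  exists2 x : R, 0 < x < t & scale_witness Phi l a g e z x.

Let s0 : R := 1 + a - (cabs l)^-1 * Num.sqrt ((1 - a) ^+ 2 + (1 - cabs l ^+ 2) * a ^+ 2 * g ^+ 2).

Let scale (k : nat) : R := k%:R * ln 2.

Definition dyadic_witness (e : R) (k : nat) (z : C) : Prop :=
  exists2 x : R, expR (- scale k) / 2 < x <= expR (- scale k) & scale_witness Phi l a g e z x.

Lemma ln2_gt0 : 0 < ln (2 : R). Proof. by rewrite ln_gt0//; lra. Qed.

(** Every small scale lies in exactly one dyadic range. The range depends on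
the point, which is why E is covered by countably many pieces, one per range. *)
Lemma exists_dyadic_witness z e (K : nat) : E z -> 0 < e ->
  exists2 k, (K <= k)%N & dyadic_witness e k z.
Proof.
move=> Ez e0; have l2 := ln2_gt0.
have [x /andP[x0 xK] wx] := E_witness Ez e0 (expR_gt0 (- scale K)).
have xK' : K%:R < - ln x / ln 2.
  by rewrite ltr_pdivlMr// -/(scale K) ltrNr -ltr_expR lnK ?posrE.
have q0 : 0 <= - ln x / ln 2 by apply: ltW; apply: le_lt_trans xK'.
have /andP[k1 k2] := truncn_itv q0.
set k := Num.truncn (- ln x / ln 2) in k1 k2.
exists k; first by rewrite /k truncn_ge_nat// ltW.
exists x => //; rewrite ler_pdivlMr// in k1; rewrite ltr_pdivrMr// in k2.
apply/andP; split.
  have -> : expR (- scale k) / 2 = expR (- (k.+1%:R * ln 2)).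
    by rewrite -[k.+1%:R]natr1 mulrDl mul1r opprD expRD (expRN (ln 2)) lnK ?posrE.
  by rewrite -[ltRHS]lnK ?posrE// ltr_expR ltrNl.
by rewrite -[leLHS]lnK ?posrE// ler_expR /scale lerNr.
Qed.

(** A single point is a separated family, and 1 < 2^(k s) fails for s = 0. So the
counting bound with exponent 0 excludes points in E as soon as s0 < 0. *)
Lemma dimension_bound_ge0 : E !=set0 -> 0 <= s0.
Proof.
move=> [z Ez]; rewrite leNgt; apply/negP => neg.
have [e e0 Hcount] := motion_counting Phi_motion l_gt0 l_lt1 neg.
have [K [K0 HK]] := Hcount (cabs z) (cabs_ge0 z).
have l2 := ln2_gt0.
have [k Kk [x xk wx]] := exists_dyadic_witness (Num.truncn (K / ln 2)).+1 Ez e0.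
have := HK (scale k) 1%N (fun=> z) (fun=> x).
rewrite ln1 mul0r ltxx => H; suff : false by []; apply: H => //.
  rewrite /scale -ler_pdivrMr//; apply: ltW (lt_le_trans (truncnS_gt _) _).
  by rewrite ler_nat.
by move=> i j; rewrite !ord1 eqxx.
Qed.

(** With s1 strictly between s0 and s, at most exp(s1 T) disks of diameter at
most 4 exp(-T) cover the points with scale exp(-T). Their contribution to the
s-dimensional measure is at most 4^s exp(-(s - s1) T), the term of a convergent
geometric series over the dyadic scales. *)
Lemma bounded_piece_cover (s d eps : R) (M : nat) : s0 < s -> 0 < s -> 0 < d -> 0 < eps ->
  has_cover s d eps%:E [set z | E z /\ cabs z <= M%:R].
Proof.
move=> s0s sp d0 eps0; have l2 := ln2_gt0.
pose s1 := (s0 + s) / 2; have s1s : s1 < s by rewrite /s1; lra.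
have s01 : s0 < s1 by rewrite /s1; lra.
have [e e0 Hcount] := motion_counting Phi_motion l_gt0 l_lt1 s01.
have [K [K0 HK]] := Hcount M%:R (ler0n _ _).
pose c : R := 4 `^ s; have c0 : 0 <= c by exact: powR_ge0.
pose t := (s - s1) * ln 2; have t0 : 0 < t by rewrite mulr_gt0// subr_gt0.
have [K1 HK1] := geometric_tail c0 t0 eps0.
(* N makes the tail of the series small, the counting bound valid and the disks smaller than d. *)
pose N := (K1 + (Num.truncn (K / ln 2)).+1 + (Num.truncn (ln (4 / d) / ln 2)).+1)%N.
pose A k := [set z | E z /\ cabs z <= M%:R /\ dyadic_witness e k z].
have piece k : (N <= k)%N -> has_cover s d (c * expR (- (k%:R * t)))%:E (A k).
  move=> Nk; set T := scale k.
  have KT : K <= T.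
    rewrite /T /scale -ler_pdivrMr//; apply: ltW (lt_le_trans (truncnS_gt _) _).
    by rewrite ler_nat; apply: leq_trans Nk; rewrite /N -addnA addnCA leq_addr.
  have dT : 4 * expR (- T) <= d.
    have : ln (4 / d) <= T.
      rewrite /T /scale -ler_pdivrMr//; apply: ltW (lt_le_trans (truncnS_gt _) _).
      by rewrite ler_nat; apply: leq_trans Nk; rewrite /N leq_addl.
    rewrite -ler_expR lnK ?posrE ?divr_gt0// ler_pdivrMr// => H.
    by rewrite expRN ler_pdivrMr ?expR_gt0// mulrC.
  have sepn n (z : 'I_n -> C) : (forall i, A k (z i)) ->
      (forall i j, i != j -> 2 * expR (- T) <= cabs (z i - z j)) -> n%:R <= expR (s1 * T).
    move=> Az sep; have [->|n0] := posnP n; first by rewrite expR_ge0.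
    have wit i : exists x : R, expR (- T) / 2 < x <= expR (- T) /\ scale_witness Phi l a g e (z i) x.
      by have [_ [_ [x x1 x2]]] := Az i; exists x.
    have [x Hx] := choice wit.
    have lnn : ln n%:R < s1 * T.
      apply: (HK T n z x KT n0) => // i; last by have [] := Hx i.
      - by have [_ []] := Az i.
      - by have [] := Hx i.
    by rewrite -[leLHS]lnK ?posrE ?ltr0n// ler_expR ltW.
  have [|n [z [Az sep cov]]] := @separated_cover R (A k) (2 * expR (- T)) (Num.truncn (expR (s1 * T))).
    move=> n z Az sep; rewrite truncn_ge_nat ?expR_ge0//; exact: sepn Az sep.
  have d'0 : 0 <= 4 * expR (- T) by rewrite mulr_ge0// expR_ge0.
  have := @has_cover_finite R s (4 * expR (- T)) n (fun i => [set w | cabs (w - z i) < 2 * expR (- T)]) (A k) (ltW sp) d'0 _ _.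
  case.
  - by move=> w /cov[i wi]; exists i.
  - move=> i; apply: diam_le => // w v /= wi vi.
    have -> : w - v = (w - z i) - (v - z i) by ring.
    by apply: le_trans (ler_cabsB _ _) _; lra.
  move=> U [U1 U2 U3]; exists U; split => //.
    by move=> i; apply: le_trans (U2 i) _; rewrite lee_fin.
  apply: le_trans U3 _; rewrite lee_fin powRM ?expR_ge0// -expRM -/c mulrCA.
  rewrite ler_wpM2l//; apply: le_trans (ler_wpM2r (expR_ge0 _) (sepn _ _ Az sep)) _.
  by rewrite -expRD ler_expR le_eqVlt; apply/orP; left; apply/eqP; rewrite /T /scale /t; ring.
have cover := has_cover_bigcup (fun i => piece (N + i)%N (leq_addr i N)).
apply: has_cover_sub cover; last first.
  by apply: HK1; rewrite /N -addnA leq_addr.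
move=> z [Ez zM]; have [k Nk wk] := exists_dyadic_witness N Ez e0.
by exists (k - N)%N => //; rewrite /A subnKC.
Qed.

Lemma hausdorff_measure_supercritical (s : R) : s0 < s -> 0 < s -> hausdorff_measure s E = 0%E.
Proof.
move=> s0s sp; apply: hausdorff_measure_eq0 => d e d0 e0.
have piece M : has_cover s d (e / (2 ^ M.+1)%:R)%:E [set z | E z /\ cabs z <= M%:R].
  by apply: bounded_piece_cover => //; rewrite divr_gt0// ltr0n expn_gt0.
apply: has_cover_sub (has_cover_bigcup piece); last exact: (@epsilon_trick0 R e xpredT (ltW e0)).
move=> z Ez; exists (Num.truncn (cabs z)).+1 => //; split => //.
by apply: ltW; exact: truncnS_gt.
Qed.

Lemma hausdorff_dim_le : (hausdorff_dim E <= s0%:E)%E.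
Proof.
rewrite /hausdorff_dim; case: pselect => E0; first by rewrite leNye.
have s00 : 0 <= s0.
  by apply: dimension_bound_ge0; apply/set0P/eqP.
apply/lee_addgt0Pr => e e0; rewrite -EFinD.
apply: ereal_inf_lbound; exists (s0 + e) => //; split; first by lra.
by apply: hausdorff_measure_supercritical; lra.
Qed.

End DimensionBound.

Theorem theorem1p4 (R : realType) (E : set R[i])
  (Psi Phi : R[i] -> R[i] -> R[i]) (alpha gamma : R) (l : R[i])
  (Psi_motion : holomorphic_motion E Psi)
  (Phi_motion : holomorphic_motion [set: R[i]] Phi)
  (Phi_ext : forall w z, unit_disk R w -> E z -> Phi w z = Psi w z)
  (alpha_gt0 : 0 < alpha)
  (l_disk : unit_disk R l) (l_neq0 : l <> 0)
  (stretch_rotate : forall z, E z ->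
    exists r : nat -> R, exists L : R -> R[i],
      [/\ forall j, 0 < r j,
          r j @[j --> \oo] --> (0 : R),
          ln (cabs (Phi l (z + (r j)%:C) - Phi l z)) / ln (r j)
            @[j --> \oo] --> alpha,
          log_branch (Phi l) z L
        & complex.Im (L (r j)) / ln (cabs (Phi l (z + (r j)%:C) - Phi l z))
            @[j --> \oo] --> gamma]) :
  (hausdorff_dim E <=
    (1 + alpha - (cabs l)^-1 *
       Num.sqrt ((1 - alpha) ^+ 2 +
                 (1 - cabs l ^+ 2) * alpha ^+ 2 * gamma ^+ 2))%:E)%E.
Proof.
apply: (hausdorff_dim_le Phi_motion) => //; first by rewrite cabs_gt0; apply/eqP.
move=> z /stretch_rotate[r [L [r0 rl st HL rot]]] e t e0 t0.
exact: (scale_witness_small Phi_motion l_disk alpha_gt0 r0 rl st HL rot e0 t0).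
Qed.
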